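(* Let $n \geq 13$ and let $G$ be a $2$-connected graph on $n$ vertices with $\sigma_2(G) \geq \frac{2n-3}{3}$, i.e. $d(u)+d(v) \ge \frac{2n-3}{3}$ for every pair of distinct non-adjacent vertices $u,v$ of $G$. Then $G$ contains a spanning jellyfish.
   Context: Graphs are finite and simple. For a graph $G$, $\sigma_2(G) = \min\{d(u)+d(v) : u \neq v,\ uv \notin E(G)\}$ (if $G$ is complete the minimum is over the empty set and any lower bound on $\sigma_2(G)$ holds vacuously). A jellyfish is a graph consisting of a cycle $C$ together with a (possibly empty) set $X$ of vertices outside $C$, each joined by an edge to one and the same vertex of $C$. A spanning jellyfish in $G$ is a (not necessarily induced) subgraph of $G$ that is a jellyfish and contains all vertices of $G$; equivalently, $G$ has a cycle $C$ and a vertex $v\in V(C)$ such that every vertex of $V(G)\setminus V(C)$ is adjacent to $v$. *)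

(* Defs.v *)
From mathcomp Require Import all_boot all_order all_algebra.
Import Order.TTheory GRing.Theory Num.Theory.

Set Implicit Arguments.
Unset Strict Implicit.
Unset Printing Implicit Defensive.

Record sgraph (T : finType) := SGraph {
  adj :> rel T;
  adj_sym : symmetric adj;
  adj_irrefl : irreflexive adj }.

Definition deg (T : finType) (G : sgraph T) (v : T) : nat := #|[set u | G v u]|.

(* The minimum defining sigma_2 ranges over the empty set when G is complete,
   so the condition sigma_2(G) >= r is expressed pair by pair. *)
Definition sigma2_ge (T : finType) (G : sgraph T) (r : rat) : Prop :=
  forall u v : T, u != v -> ~~ G u v -> (r <= (deg G u + deg G v)%N%:R)%R.

Definition connected_on (T : finType) (G : sgraph T) (A : {set T}) : Prop :=
  {in A &, forall x y : T, connect [rel u v in A | G u v] x y}.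

(* Nonemptiness of the remaining graph is implied by #|S| < k < #|T|. *)
Definition k_connected (T : finType) (k : nat) (G : sgraph T) : Prop :=
  k < #|T| /\ forall S : {set T}, #|S| < k -> connected_on G (~: S).

(* Edges of the cycle that visits the vertices of c in order and returns to
   its first vertex; a genuine simple cycle when c is uniq and 2 < size c. *)
Definition cycle_edge (T : finType) (c : seq T) : rel T :=
  [rel x y in c | (y == next c x) || (x == next c y)].

(* Every vertex outside c belongs to X, and v is its only neighbour. *)
Definition jellyfish (T : finType) (J : sgraph T) : Prop :=
  exists (c : seq T) (v : T),
    [/\ 2 < size c, uniq c, v \in c &
      forall x y : T, J x y = [|| cycle_edge c x y,
                                  (x == v) && (y \notin c) |
                                  (y == v) && (x \notin c)]].

(* A spanning subgraph lives on the same vertex type, with fewer edges. *)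
Definition has_spanning_jellyfish (T : finType) (G : sgraph T) : Prop :=
  exists J : sgraph T, subrel J G /\ jellyfish J.

(* Main.v *)
(** Suppose that there is no spanning jellyfish, so that no vertex of a longest
cycle C is adjacent to all vertices outside C.

If every longest cycle has an independent complement X, then |X| >= 4, and the
set U of vertices of C with a neighbour in X has no two consecutive members:
otherwise two outside vertices x, x' satisfy d(x) + 2 d(x') <= |C| + 2 and
symmetrically, against the degree condition.  A vertex of C both of whose cycle
neighbours are adjacent to some x in X can be exchanged with x; hence X and
these vertices together form an independent set B with all neighbours in U.
Choose C with maximal degree sum of X.  Averaging over U yields a vertex of C
with so many neighbours in B that its non-neighbours in X can be exchanged into
the cycle one by one, which leaves a spanning jellyfish.

Otherwise let H be a component of G - C with at least two vertices, and let t be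
the number of its attachments on C.  The successors of two attachments are
nonadjacent to each other and to H, and counting their edges along C shows that
every vertex of H has degree at least |H| + t - 3.  A longest path through H
between two attachments then covers H up to few exceptions, which counting
excludes; so any two attachments are more than |H| apart on C, and
t (|H| + 1) <= |C|.  If some vertex lies outside C and H, comparing degrees gives
an attachment adjacent to everything outside C.  If C and H cover the graph and
t >= 3, counting leaves only n = 15 with |H| = t = 3, where replacing a segment of
C by H produces a forbidden component.  If t = 2, either there is no edge between
the two sides of C, and then the smaller side is joined completely to an
attachment, or a longest path between the attachments inside the two sides
leads to a contradiction. *)

Require Import Defs.
From mathcomp Require Import all_boot all_order all_algebra zify.
From Stdlib Require Import Classical_Prop.

Set Implicit Arguments.
Unset Strict Implicit.
Unset Printing Implicit Defensive.

(** The dichotomy ranges over all longest cycles, not over one: exchanging an outside vertex with a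
    cycle vertex changes the cycle, and the complement of the new one must again be independent. The
    extremal choice of C in the independent case deals with an outside vertex of degree below (2n -
    3)/6. The degree condition puts each of its non-neighbours above that value, so an exchange
    would raise the degree sum outside. Hence no two of its neighbours lie at distance two on C, and
    the averaging runs over these neighbours instead of over U. In the other case a vertex of H has
    degree at most |H| + t - 1, so the bound |H| + t - 3 leaves it at most two non-neighbours among
    H and the attachments. Spanning paths between any two attachments need at most one; lowering two
    to one is a large part of the work. The value n = 15 is the equality case of (t - 2)(|H| - 2) <=
    1, to which the counting for t >= 3 amounts. *)

Ltac arith_hyp P :=
  lazymatch P with
  | is_true (leq _ _) => idtac
  | is_true (~~ leq _ _) => idtac
  | @eq nat _ _ => idtac
  | not (@eq nat _ _) => idtac
  | ?A \/ ?B => arith_hyp A; arith_hyp B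
  | ?A /\ ?B => arith_hyp A; arith_hyp B
  end.

(* lia gets slow when the context contains boolean facts about vertices. *)
Ltac nlia :=
  repeat match goal with
  | H : ?P |- _ =>
    lazymatch type of P with Prop => tryif arith_hyp P then fail else clear H end
  end; lia.

(** * Longest cycles and their reroutings *)

Section Walks.
Variables (T : finType) (G : sgraph T).
Implicit Types (x y z : T) (s p q : seq T) (A B : {set T}).

Lemma adjC x y : G x y = G y x. Proof. exact: adj_sym. Qed.
Lemma adjxx x : G x x = false. Proof. exact: adj_irrefl. Qed.

Definition ucyc s := [&& 2 < size s, uniq s & cycle G s].

Lemma jellyfish_of_cycle s v : ucyc s -> v \in s ->
  (forall x, x \notin s -> G v x) -> has_spanning_jellyfish G.
Proof.
case/and3P=> s2 us cs vs Gv.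
have Gn x : x \in s -> G x (next s x) by move=> xs; apply: next_cycle cs xs.
pose e := [rel x y | [|| cycle_edge s x y, (x == v) && (y \notin s) | (y == v) && (x \notin s)]].
have es : symmetric e.
  move=> x y; rewrite /e /cycle_edge /=.
  by do !case: (_ \in _); do !case: (_ == _).
have eG : subrel e G.
  move=> x y /or3P[/andP[/andP[xs ys] /orP[]/eqP->]|/andP[/eqP-> /Gv]|/andP[/eqP-> /Gv]] //.
  - exact: Gn.
  - by rewrite adjC Gn.
  - by rewrite adjC.
have ei : irreflexive e.
  by move=> x; apply/negP => /eG; rewrite adjxx.
exists (SGraph es ei); split; first exact: eG.
by exists s, v.
Qed.

(** The list [s] omits the start [x] but contains the end [y], so walks concatenate by [++], and a
    closed walk lists each vertex of its cycle once. *)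
Definition wk x s y := path G x s && (last x s == y).

Lemma wk_cat x s y s' z : wk x s y -> wk y s' z -> wk x (s ++ s') z.
Proof.
case/andP=> p1 /eqP l1 /andP[p2 /eqP l2].
by rewrite /wk cat_path last_cat p1 l1 p2 l2 eqxx.
Qed.

Lemma wk1 x y : G x y -> wk x [:: y] y.
Proof. by move=> g; rewrite /wk /= g eqxx. Qed.

Lemma wk_rev x s y : wk x s y -> wk y (rev (belast x s)) x.
Proof.
case/andP=> ps /eqP <-; rewrite /wk rev_path; apply/andP; split.
  by apply: sub_path ps => a b; rewrite /= adjC.
case: s ps => [|z s] //= _.
by rewrite rev_cons last_rcons.
Qed.

Lemma ucyc_wk x s : wk x s x -> uniq s -> 2 < size s -> ucyc s.
Proof.
case/andP=> ps ls us s2; rewrite /ucyc s2 us /=.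
case/lastP: s ps ls us s2 => [|s z] // ps.
rewrite last_rcons => /eqP zx; rewrite zx in ps *.
by move=> _ _; rewrite -(rot_cycle (size s)) -cats1 rot_size_cat.
Qed.

(* [v] runs periodically around a longest cycle of length [N].  Indices are
   unbounded, so [fun k => v (k * N.-1)] runs around the same cycle backwards. *)
Record lcyc (v : nat -> T) (N : nat) : Prop := Lcyc {
  lc2 : 2 < N;
  lcP : forall k, v (k + N) = v k;
  lcG : forall k, G (v k) (v k.+1);
  lcI : forall i j, v i = v j -> i = j %[mod N];
  lcM : forall s, ucyc s -> size s <= N }.

Definition seg (v : nat -> T) i m := [seq v k | k <- iota i m].
Definition cset (v : nat -> T) N := [set x in seg v 0 N].

Lemma size_seg v i m : size (seg v i m) = m.
Proof. by rewrite size_map size_iota. Qed.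

Lemma segS v i m : seg v i m.+1 = v i :: seg v i.+1 m. Proof. by []. Qed.
Lemma segSr v i m : seg v i m.+1 = rcons (seg v i m) (v (i + m)).
Proof. by rewrite /seg -addn1 iotaD map_cat /= cats1. Qed.

Section Cycle.
Variables (v : nat -> T) (N : nat).
Hypothesis (c : lcyc v N).

Lemma lcN0 : 0 < N. Proof. by case: c; lia. Qed.

Lemma v_addM k m : v (k + m * N) = v k.
Proof. by elim: m => [|m IH]; rewrite ?mul0n ?addn0 // mulSnr addnA (lcP c). Qed.

Lemma v_mod k : v (k %% N) = v k.
Proof. by rewrite {2}(divn_eq k N) addnC v_addM. Qed.

Lemma csetP x : reflect (exists2 k, k < N & x = v k) (x \in cset v N).
Proof.
rewrite inE; apply: (iffP mapP) => [[k]|[k kN ->]].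
  by rewrite mem_iota add0n => /andP[_ kN] ->; exists k.
by exists k; rewrite ?mem_iota.
Qed.

Lemma mem_cset k : v k \in cset v N.
Proof. by apply/csetP; exists (k %% N); rewrite ?v_mod // ltn_mod lcN0. Qed.

Lemma v_inj i j : i < N -> j < N -> v i = v j -> i = j.
Proof. by move=> iN jN /(lcI c); rewrite !modn_small. Qed.

Lemma v_inj_in ix : all (fun k => k < N) ix -> {in ix &, injective v}.
Proof. by move=> /allP h i j /h iN /h jN; apply: v_inj. Qed.

Lemma seg_wk i m : wk (v i) (seg v i.+1 m) (v (i + m)).
Proof.
elim: m i => [|m IH] i; first by rewrite /wk /= addn0 eqxx.
by rewrite segS -cat1s -addSnnS; apply: wk_cat (IH _); apply/wk1/(lcG c).
Qed.

Lemma seg_wkr i m : wk (v (i + m)) (rev (seg v i m)) (v i).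
Proof.
have := wk_rev (seg_wk i m); congr wk; congr rev.
elim: m i => // m IH i; rewrite segS /= IH //.
Qed.

Lemma uniq_pieces ix q : uniq ix -> all (fun k => k < N) ix ->
  uniq q -> {in q, forall x, x \notin cset v N} -> uniq (map v ix ++ q).
Proof.
move=> ui ai uq oq; rewrite cat_uniq uq andbT (map_inj_in_uniq (v_inj_in ai)) ui /=.
apply/hasPn => x /oq; apply: contra => /mapP[k _ ->]; exact: mem_cset.
Qed.

Lemma reroute_cycle x s ix q : wk x s x -> perm_eq s (map v ix ++ q) ->
  uniq ix -> all (fun k => k < N) ix -> uniq q -> {in q, forall x, x \notin cset v N} ->
  2 < size ix + size q -> ucyc s.
Proof.
move=> ws ps ui ai uq oq s2; apply: (ucyc_wk ws).
  by rewrite (perm_uniq ps); apply: uniq_pieces.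
by rewrite (perm_size ps) size_cat size_map.
Qed.

(** Source of most length contradictions: [s] is a candidate cycle made of the cycle vertices with
    indices [ix] and the outside vertices [q], and maximality of [N] bounds their number. At most
    two vertices form no cycle, but then [2 < N] suffices. *)
Lemma reroute x s ix q : wk x s x -> perm_eq s (map v ix ++ q) ->
  uniq ix -> all (fun k => k < N) ix -> uniq q -> {in q, forall x, x \notin cset v N} ->
  size ix + size q <= N.
Proof.
move=> ws ps ui ai uq oq; case: (ltnP 2 (size ix + size q)) => [s2|]; last first.
  by move=> h; apply: leq_trans h _; apply: ltnW (lc2 c).
have := lcM c (reroute_cycle ws ps ui ai uq oq s2).
by rewrite (perm_size ps) size_cat size_map.
Qed.

(** Only the interior [q] has to avoid the cycle, and it may be empty, so that a single edge counts
    as well. *)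
Definition opath x q y := [&& path G x (rcons q y), uniq q & all (fun z => z \notin cset v N) q].

Lemma opath_rev x q y : opath x q y -> opath y (rev q) x.
Proof.
case/and3P=> p u a; rewrite /opath rev_uniq u all_rev a !andbT.
have /wk_rev : wk x (rcons q y) y by rewrite /wk p last_rcons eqxx.
by rewrite belast_rcons rev_cons => /andP[].
Qed.

Lemma opath_wk x q y : opath x q y -> wk x (rcons q y) y.
Proof. by case/and3P=> p _ _; rewrite /wk p last_rcons eqxx. Qed.

Lemma chord_perm i q : perm_eq (seg v 1 i ++ rcons q (v 0)) (map v (iota 0 i.+1) ++ q).
Proof.
apply/permP => P; rewrite -cats1 !count_cat /= -/(seg v 1 i).
lia.
Qed.

Lemma chord_wk i q : opath (v i) q (v 0) -> wk (v 0) (seg v 1 i ++ rcons q (v 0)) (v 0).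
Proof. by move=> oq; apply: wk_cat (opath_wk oq); apply: seg_wk. Qed.

Lemma chord_cycle i q : i < N -> opath (v i) q (v 0) -> 1 < i + size q -> ucyc (seg v 1 i ++ rcons q (v 0)).
Proof.
move=> iN oq s2; have /and3P[_ uq /allP aq] := oq.
apply: (reroute_cycle (chord_wk oq) (chord_perm i q)) => //; rewrite ?iota_uniq ?size_iota //.
  by apply/allP=> k; rewrite mem_iota; lia.
Qed.

(** On the way back to [v 0] the path [q] replaces the [N.-1 - i] vertices after [v i]. *)
Lemma reroute_chord i q : i < N -> opath (v i) q (v 0) -> size q <= N.-1 - i.
Proof.
move=> iN oq; have /and3P[_ uq /allP aq] := oq.
have := reroute (chord_wk oq) (chord_perm i q) (iota_uniq _ _) _ uq aq.
rewrite size_iota => h; suff: i.+1 + size q <= N by lia.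
by apply: h; apply/allP=> k; rewrite mem_iota; lia.
Qed.

(** The new cycle runs from [v 0] to [v i], along [q1] to [v (j + l)], backwards to [v j] and along
    [q2] home. It loses only the vertices strictly between [v i] and [v j] and those after
    [v (j + l)]. *)
Lemma reroute_crossing i j l q1 q2 : i < j -> j + l < N ->
  opath (v i) q1 (v (j + l)) -> opath (v j) q2 (v 0) ->
  {in q1, forall x, x \notin q2} ->
  size q1 + size q2 <= (j - i - 1) + (N.-1 - (j + l)).
Proof.
move=> ij jl o1 o2 dis; have /and3P[_ u1 /allP a1] := o1; have /and3P[_ u2 /allP a2] := o2.
pose s := seg v 1 i ++ (rcons q1 (v (j + l)) ++ (rev (seg v j l) ++ rcons q2 (v 0))).
have ws : wk (v 0) s (v 0).
  apply: (wk_cat (seg_wk 0 i)); apply: (wk_cat (opath_wk o1)).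
  by apply: (wk_cat (seg_wkr j l)); apply: opath_wk.
have ps : perm_eq s (map v (iota 0 i.+1 ++ iota j l.+1) ++ (q1 ++ q2)).
  apply/permP => P; rewrite /s map_cat -![in X in _ = X]/(seg _ _ _) -!cats1 !count_cat count_rev.
  rewrite (segSr v j l) -cats1 !count_cat segS /= ?addn0; lia.
have ui : uniq (iota 0 i.+1 ++ iota j l.+1).
  by rewrite cat_uniq !iota_uniq andbT andTb; apply/hasPn => k; rewrite !mem_iota; lia.
have ai : all (fun k => k < N) (iota 0 i.+1 ++ iota j l.+1).
  by rewrite all_cat; apply/andP; split; apply/allP=> k; rewrite mem_iota; lia.
have uq : uniq (q1 ++ q2).
  rewrite cat_uniq u1 u2 andbT andTb; apply/hasPn => x; apply: contraL; exact: dis.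
have := reroute ws ps ui ai uq _; rewrite !size_cat !size_iota => h.
suff: i.+1 + l.+1 + (size q1 + size q2) <= N by nlia.
by apply: h => x; rewrite mem_cat => /orP[/a1|/a2].
Qed.

(** The new cycle runs from [v m] to [v N.-1], along [q] to [v m.-1], backwards to [v z'], over to
    [v 0], forwards to [v z] and back to [v m]. It loses only the vertices strictly between [v z]
    and [v z']. *)
Lemma reroute_parallel (m z z' : nat) q : z < z' -> z' < m -> m < N ->
  opath (v N.-1) q (v m.-1) -> G (v z') (v 0) -> G (v z) (v m) ->
  size q <= z' - z - 1.
Proof.
move=> zz zm mN oq g1 g2; have /and3P[_ uq /allP aq] := oq.
pose s := seg v m.+1 (N.-1 - m) ++ (rcons q (v m.-1) ++ (rev (seg v z' (m.-1 - z')) ++ (v 0 :: (seg v 1 z ++ [:: v m])))).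
have ws : wk (v m) s (v m).
  apply: (@wk_cat _ _ (v N.-1)).
    have := seg_wk m (N.-1 - m); congr wk; congr v; lia.
  apply: (wk_cat (opath_wk oq)).
  apply: (@wk_cat _ _ (v z')).
    have := seg_wkr z' (m.-1 - z'); congr wk; congr v; lia.
  rewrite -cat1s; apply: (wk_cat (wk1 g1)).
  by apply: (wk_cat (seg_wk 0 z)); apply: wk1.
have ps : perm_eq s (map v (iota 0 z.+1 ++ iota z' (m - z') ++ iota m (N - m)) ++ q).
  apply/permP => P; rewrite /s !map_cat -![in X in _ = X]/(seg _ _ _) -!cats1 !count_cat count_rev.
  have -> : m - z' = (m.-1 - z').+1 by lia.
  have -> : N - m = (N.-1 - m).+1 by lia.
  rewrite (segSr v z') -cats1 !count_cat !segS /= !count_cat /= ?addn0.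
  have -> : z' + (m.-1 - z') = m.-1 by lia.
  lia.
have ui : uniq (iota 0 z.+1 ++ iota z' (m - z') ++ iota m (N - m)).
  by rewrite !cat_uniq !iota_uniq !andbT !andTb; apply/andP; split; apply/hasPn => k; rewrite ?mem_cat !mem_iota; lia.
have ai : all (fun k => k < N) (iota 0 z.+1 ++ iota z' (m - z') ++ iota m (N - m)).
  by rewrite !all_cat; apply/and3P; split; apply/allP=> k; rewrite mem_iota; lia.
have := reroute ws ps ui ai uq aq; rewrite !size_cat !size_iota; lia.
Qed.

End Cycle.
End Walks.

(** * Counting along a cycle, exchanges, and existence of a longest cycle *)

Section Counting.
Variables (T : finType) (G : sgraph T).
Implicit Types (x y z : T) (s p q : seq T) (A B : {set T}) (v : nat -> T).

Lemma lcyc_shift v N m : lcyc G v N -> lcyc G (fun k => v (k + m)) N.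
Proof.
move=> c; case: (c) => h2 hP hG hI hM; split=> // [k|i j /hI /eqP].
- by rewrite addnAC hP.
- by rewrite eqn_modDr => /eqP.
Qed.

(** Multiplication by [N.-1] is negation modulo [N]; the summand [j * N] keeps the subtraction
    inside the natural numbers. *)
Lemma rev_ix v N k j : lcyc G v N -> k <= j * N -> v (k * N.-1) = v (j * N - k).
Proof.
move=> c kj; rewrite -(v_addM c _ j) -[RHS](v_addM c _ k); congr v.
have := lc2 c; case: N {c} kj => // N kj _; rewrite /= mulnS; lia.
Qed.

Lemma lcyc_rev v N : lcyc G v N -> lcyc G (fun k => v (k * N.-1)) N.
Proof.
move=> c; case: (c) => h2 hP hG hI hM; split=> // [k|k|i j].
- by rewrite mulnDl [N * _]mulnC (v_addM c).
- have -> : v (k * N.-1) = v (k.+1 * N.-1).+1 by rewrite -(lcP c (k * _)) mulSn; congr v; lia.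
  by rewrite adjC hG.
move=> /hI e.
(* Adding [i + j] turns the congruence of the negatives into one between [j] and [i]. *)
have {}e : i * N.-1 + (i + j) = j * N.-1 + (i + j) %[mod N] by apply/eqP; rewrite eqn_modDr; apply/eqP.
have N0 : 0 < N by lia.
have e1 : i * N.-1 + (i + j) = i * N + j by case: N N0 {h2 hP hI hM e c} => // N _ /=; rewrite mulnS; lia.
have e2 : j * N.-1 + (i + j) = j * N + i by case: N N0 {h2 hP hI hM e e1 c} => // N _ /=; rewrite mulnS; lia.
by rewrite e1 e2 !modnMDl in e.
Qed.

Lemma cset_sub v N v' : lcyc G v N -> (forall k, exists j, v' k = v j) ->
  {subset cset v' N <= cset v N}.
Proof.
move=> c h x; rewrite inE => /mapP[k _ ->]; have [j ->] := h k; exact: mem_cset c j.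
Qed.

Lemma card_cset v N : lcyc G v N -> #|cset v N| = N.
Proof.
move=> c; rewrite cardsE; have /card_uniqP-> : uniq (seg v 0 N).
  rewrite map_inj_in_uniq ?iota_uniq //; apply: (v_inj_in c); apply/allP=> k; rewrite mem_iota; lia.
by rewrite size_seg.
Qed.

Lemma cset_eq v N v' : lcyc G v N -> lcyc G v' N -> (forall k, exists j, v' k = v j) ->
  cset v' N = cset v N.
Proof.
move=> c c' h; apply/eqP; rewrite eqEcard (card_cset c) (card_cset c') leqnn andbT.
by apply/subsetP; apply: cset_sub c h.
Qed.

Lemma cset_shift v N m : lcyc G v N -> cset (fun k => v (k + m)) N = cset v N.
Proof. by move=> c; apply: cset_eq => //; [apply: lcyc_shift|move=> k; exists (k + m)]. Qed.

Lemma cset_rev v N : lcyc G v N -> cset (fun k => v (k * N.-1)) N = cset v N.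
Proof. by move=> c; apply: cset_eq => //; [apply: lcyc_rev|move=> k; exists (k * N.-1)]. Qed.

Lemma sum_cset v N (P : pred T) : lcyc G v N ->
  \sum_(k < N) (P (v k) : nat) = #|[set x in cset v N | P x]|.
Proof.
move=> c; rewrite -(big_mkord xpredT (fun k => (P (v k) : nat))) /index_iota subn0.
have u : uniq (seg v 0 N).
  rewrite map_inj_in_uniq ?iota_uniq //; apply: (v_inj_in c); apply/allP=> k; rewrite mem_iota; lia.
have -> : #|[set x in cset v N | P x]| = size (filter P (seg v 0 N)).
  rewrite -(card_uniqP (filter_uniq P u)); apply: eq_card => x.
  by rewrite !inE mem_filter andbC.
rewrite size_filter count_map -sum1_count [RHS]big_mkcond.
by apply: eq_bigr => k _ /=; case: (P (v k)).
Qed.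

Lemma sum_shift1 (f : nat -> nat) N : f N = f 0 -> \sum_(k < N) f k.+1 = \sum_(k < N) f k.
Proof.
case: N => [|N] fN; first by rewrite !big_ord0.
by rewrite big_ord_recr big_ord_recl /= fN addnC.
Qed.

Lemma sum_shift (f : nat -> nat) N m : (forall k, f (k + N) = f k) ->
  \sum_(k < N) f (k + m) = \sum_(k < N) f k.
Proof.
move=> fP; elim: m => [|m IH]; first by apply: eq_bigr => k _; rewrite addn0.
rewrite -IH -(sum_shift1 (f := fun k => f (k + m))) /=; last by rewrite addnC fP add0n.
by apply: eq_bigr => k _; rewrite addSnnS.
Qed.

Lemma deg_split x A : deg G x = #|[set y in A | G x y]| + #|[set y in ~: A | G x y]|.
Proof.
rewrite /deg -(cardsID A); congr (_ + _); apply: eq_card => y; rewrite !inE // andbC //.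
Qed.

Definition exchange v y x := fun k => if v k == y then x else v k.

(** The length is unchanged, so the new cycle is again a longest one and exchanges can be
    iterated. *)
Lemma exchange_lcyc v N i x : lcyc G v N -> x \notin cset v N -> G x (v i) -> G x (v i.+2) ->
  lcyc G (exchange v (v i.+1) x) N.
Proof.
move=> c xo g1 g2; case: (c) => h2 hP hG hI hM.
have nx k : (v k == x) = false.
  by apply/negP => /eqP e; move: xo; rewrite -e (mem_cset c).
have np k : v k.+1 = v i.+1 -> v k = v i.
  move=> /hI/eqP; rewrite -[k.+1]addn1 -[i.+1]addn1 eqn_modDr => /eqP e.
  by rewrite -(v_mod c) e (v_mod c).
have ns k : v k = v i.+1 -> v k.+1 = v i.+2.
  move=> /hI/eqP; rewrite -(eqn_modDr 1) !addn1 => /eqP e.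
  by rewrite -(v_mod c) e (v_mod c).
split=> // [k|k|a b]; rewrite /exchange.
- by rewrite hP.
- case: (v k =P v i.+1) => [e|ne]; case: (v k.+1 =P v i.+1) => [e'|ne'] //.
  + by move: (hG k); rewrite e e' adjxx.
  + by rewrite (ns _ e).
  + by rewrite adjC (np _ e').
case: (v a =P _) => [e|ne]; case: (v b =P _) => [e'|ne'] //; last exact: hI.
- by move=> _; apply: hI; rewrite e e'.
- by move/eqP; rewrite eq_sym nx.
- by move/eqP; rewrite nx.
Qed.

Lemma exchange_cset v N i x : lcyc G v N -> x \notin cset v N -> G x (v i) -> G x (v i.+2) ->
  cset (exchange v (v i.+1) x) N = x |: cset v N :\ v i.+1.
Proof.
move=> c xo g1 g2; have c' := exchange_lcyc c xo g1 g2.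
apply/eqP; rewrite eqEcard (card_cset c'); apply/andP; split.
  apply/subsetP => y; rewrite inE => /mapP[k _ ->]; rewrite /exchange; case: ifP => ne; rewrite !inE ?eqxx // ne.
  by have := mem_cset c k; rewrite inE => ->; rewrite orbT.
rewrite cardsU1 !inE (negPf (_ : x \notin seg v 0 N)); last by move: xo; rewrite inE.
have := cardsD1 (v i.+1) (cset v N); rewrite (mem_cset c) (card_cset c) andbF /=; lia.
Qed.

Definition some_lcyc := exists v N, lcyc G v N.

Lemma lcyc_of_seq s : ucyc G s -> (forall s', ucyc G s' -> size s' <= size s) ->
  exists2 v, lcyc G v (size s) & cset v (size s) =i s.
Proof.
case/and3P=> s2 us cs sM; case: s => // x0 s in s2 us cs sM *.
set S := x0 :: s in s2 us cs sM *.
have S0 : 0 < size S by [].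
pose v k := nth x0 S (k %% size S).
have vin k : v k \in S by rewrite mem_nth // ltn_mod.
have c : lcyc G v (size S).
  split=> // [k|k|i j e]; rewrite ?/v ?modnDr //.
    have -> : k.+1 %% size S = (k %% size S).+1 %% size S by rewrite -addn1 -modnDml addn1.
    move: (k %% size S) (ltn_pmod k S0) => a kl.
    have /(pathP x0)/(_ a) := cs; rewrite size_rcons => /(_ kl).
    rewrite -[x0 :: rcons s x0]/(rcons S x0) [nth x0 (rcons S x0) _]nth_rcons kl.
    rewrite nth_rcons; case: (ltngtP a (size s)) kl => [lt||->] // kl.
    - by rewrite modn_small.
    - by move: kl; rewrite /S /=; lia.
    - by rewrite modnn.
  by have /eqP := e; rewrite nth_uniq ?ltn_mod // => /eqP.
exists v => // x; apply/idP/idP => [|xS].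
  by rewrite inE => /mapP[k _ ->].
apply/(csetP); exists (index x S); rewrite ?index_mem //.
by rewrite /v modn_small ?index_mem // nth_index.
Qed.

Lemma lcyc_seq v N : lcyc G v N -> ucyc G (seg v 0 N).
Proof.
move=> c; have := lc2 c; case: N c => // N c N2.
have o : opath G v N.+1 (v N) [::] (v 0).
  by rewrite /opath /= !andbT -[v 0](lcP c) add0n (lcG c).
have := chord_cycle c (ltnSn N) o; rewrite addn0 => /(_ N2) /and3P[h1 h2 h3].
apply/and3P; split; first by rewrite size_seg.
  by rewrite segS; move: h2; rewrite /= cats1 rcons_uniq.
by rewrite segS -(rot_cycle 1) /= rot1_cons -cats1.
Qed.

Lemma exists_lcyc : (exists s, ucyc G s) -> some_lcyc.
Proof.
move=> [s0 cs0].
have ub m : [exists s : m.-tuple T, ucyc G s] -> m <= #|T|.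
  by case/existsP=> s /and3P[_ /card_uniqP us _]; rewrite -(size_tuple s) -us max_card.
have ex : exists m, [exists s : m.-tuple T, ucyc G s].
  by exists (size s0); apply/existsP; exists (in_tuple s0).
case: (ex_maxnP ex ub) => m /existsP[s cs] mM.
have [|v c _] := lcyc_of_seq cs; last by exists v, (size s).
move=> s' cs'; rewrite size_tuple; apply: mM; apply/existsP; by exists (in_tuple s').
Qed.

Hypothesis k2 : k_connected 2 G.

(** The working form of 2-connectivity: the graph without [a] is still connected, so some edge
    leaves [X] and avoids [a]. *)
Lemma cut_edge a (X : {set T}) x z : x \in X -> x != a -> z \notin X -> z != a ->
  exists x' z', [/\ x' \in X, x' != a, z' \notin X, z' != a & G x' z'].
Proof.
move=> xX xa zX za; case: k2 => _ /(_ [set a]); rewrite cards1 => /(_ isT) /(_ x z).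
rewrite !inE => /(_ xa za) co.
case: (boolP [exists x', exists z', [&& x' \in X, x' != a, z' \notin X, z' != a & G x' z']]).
  by case/existsP=> x' /existsP[z' /and5P[]]; exists x', z'.
move=> /existsPn h; exfalso.
have cl : closed [rel u v in ~: [set a] | G u v] (mem X).
  have h' x' z' : x' \in X -> z' \notin X -> ~ [rel u v in ~: [set a] | G u v] x' z'.
    move=> x'X z'X /=; rewrite !inE => /andP[/andP[x'a z'a] g].
    by have /existsPn/(_ z')/negP := h x'; apply; apply/and5P.
  move=> x' z' e; apply/idP/idP => hx; apply: contraT => hz; exfalso.
    exact: h' e.
  apply: (h' z' x') => //; move: e => /=; rewrite !inE adjC => /andP[/andP[-> ->] ->] //.
by have := closed_connect cl co; rewrite xX (negPf zX).
Qed.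

Lemma third x y : exists2 z, z != x & z != y.
Proof.
have [T2 _] := k2; have := cardsC [set x; y]; rewrite cards2 => e.
have /card_gt0P[z] : 0 < #|~: [set x; y]|.
  by move: T2; rewrite -e; case: (x != y) => /=; lia.
by rewrite !inE negb_or => /andP[zx zy]; exists z.
Qed.

Lemma deg_ge2 x : 1 < deg G x.
Proof.
have [y yx _] := third x x; have [z zx zy] := third x y.
have [|||x1 [z1 [/set1P-> _ z1x z1y g1]]] := @cut_edge y [set x] x z (set11 x); rewrite ?inE // 1?eq_sym //.
have [|||x2 [z2 [/set1P-> _ z2x z2y g2]]] := @cut_edge z1 [set x] x y (set11 x); rewrite ?inE // 1?eq_sym //.
  by move: z1x; rewrite inE.
by apply/card_gt1P; exists z1, z2; rewrite !inE g1 g2 eq_sym z2y.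
Qed.

(** All neighbours of the first vertex of a longest path lie on that path. There are at least two,
    and the farther one closes a cycle with at least three vertices. *)
Lemma exists_ucyc : exists s, ucyc G s.
Proof.
pose P m := [exists s : m.-tuple T, uniq s && sorted G s].
have ub m : P m -> m <= #|T|.
  by case/existsP=> s /andP[/card_uniqP us _]; rewrite -(size_tuple s) -us max_card.
have [y _ _] : exists2 y : T, true & true.
  by have [T2 _] := k2; have /card_gt0P[y] : 0 < #|T| by lia; exists y.
have ex : exists m, P m by exists 1; apply/existsP; exists [tuple y].
case: (ex_maxnP ex ub) => m /existsP[[s /= sm] /andP[us ss]] mM.
case: s => [|x p] in sm us ss *.
  have /mM : P 1 by apply/existsP; exists [tuple y].
  by rewrite -(eqP sm).
have nin z : G x z -> z \in p.
  move=> g; apply: contraT => zp.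
  have /mM : P m.+1.
    apply/existsP; have sz : size [:: z, x & p] == m.+1 by rewrite /= in sm *; rewrite (eqP sm).
    exists (Tuple sz); move: us ss => /= /andP[-> ->] ->; rewrite adjC g inE (negPf zp) !andbT orbF.
    by apply/eqP => e; rewrite e adjxx in g.
  by rewrite ltnn.
have /card_gt1P[z1 [z2 [+ + z12]]] := deg_ge2 x; rewrite !inE => g1 g2.
wlog lt : z1 z2 z12 g1 g2 / index z1 p < index z2 p.
  move=> h; case: (ltngtP (index z1 p) (index z2 p)) => [|| e]; [exact: h|apply: h => //|].
    by rewrite eq_sym.
  by case/eqP: z12; rewrite -(nth_index x (nin _ g1)) e nth_index ?nin.
exists (x :: take (index z2 p).+1 p).
have lp : index z2 p < size p by rewrite index_mem nin.
have ep : take (index z2 p).+1 p = rcons (take (index z2 p) p) z2.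
  by rewrite (take_nth x) ?nth_index ?nin.
apply/and3P; split.
- by rewrite /= size_takel //; lia.
- move: us; rewrite -{1}(cat_take_drop (index z2 p).+1 p) -cat_cons cat_uniq => /and3P[] //.
- move: ss; rewrite /= -{1}(cat_take_drop (index z2 p).+1 p) cat_path rcons_path => /andP[-> _].
  by rewrite ep last_rcons adjC.
Qed.

End Counting.

(** * Positions relative to a base vertex, and neighbours of outside vertices *)

Section Positions.
Variables (T : finType) (G : sgraph T).
Implicit Types (x y z : T) (s p q : seq T) (A B : {set T}) (v : nat -> T).

Lemma lcyc_eqm v N i j : lcyc G v N -> i = j %[mod N] -> v i = v j.
Proof. by move=> c e; rewrite -(v_mod c) e (v_mod c). Qed.

(** Moves the origin to [k]: [v l] and its successors get an offset [d < N] from there, so that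
    reroutings stated from index 0 apply. *)
Lemma pos_from v N k l : lcyc G v N -> exists2 d, d < N & forall m, v (l + m) = v (d + k + m).
Proof.
move=> c; have N0 := lcN0 c; exists ((l + (N - k %% N)) %% N); first by rewrite ltn_mod.
move=> m; apply: (lcyc_eqm c); apply/eqP; rewrite eqn_modDr modnDml -addnA.
have -> : N - k %% N + k = (k %/ N).+1 * N.
  by rewrite {2}(divn_eq k N) mulSn addnCA subnK 1?addnC // ltnW // ltn_pmod.
by rewrite addnC modnMDl.
Qed.

Lemma opath_shift v N m x q y : lcyc G v N ->
  opath G (fun k => v (k + m)) N x q y = opath G v N x q y.
Proof. by move=> c; rewrite /opath (cset_shift m c). Qed.

Lemma reroute_chord_at v N m i q : lcyc G v N -> i < N -> opath G v N (v (i + m)) q (v m) ->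
  size q <= N.-1 - i.
Proof.
move=> c iN o; apply: (reroute_chord (lcyc_shift m c) iN); by rewrite (opath_shift _ _ _ _ c).
Qed.

Lemma reroute_crossing_at v N m i j l q1 q2 : lcyc G v N -> i < j -> j + l < N ->
  opath G v N (v (i + m)) q1 (v (j + l + m)) -> opath G v N (v (j + m)) q2 (v m) ->
  {in q1, forall x, x \notin q2} ->
  size q1 + size q2 <= (j - i - 1) + (N.-1 - (j + l)).
Proof.
move=> c ij jl o1 o2; apply: (reroute_crossing (lcyc_shift m c) ij jl); by rewrite (opath_shift _ _ _ _ c).
Qed.

Lemma opath_vertex v N a x b : x \notin cset v N -> G a x -> G x b -> opath G v N a [:: x] b.
Proof. by move=> xo g1 g2; rewrite /opath /= g1 g2 xo. Qed.

Lemma opath_edge v N a b : G a b -> opath G v N a [::] b.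
Proof. by move=> g; rewrite /opath /= g. Qed.

(** From [k'] on, the reversed cycle shows the segment from [k] to [k + m] backwards; this transfers
    facts about successors to predecessors. *)
Lemma rev_at v N k m : lcyc G v N ->
  exists k', forall i, i <= m -> v ((k' + i) * N.-1) = v (k + m - i).
Proof.
move=> c; exists ((k + m) * N - (k + m)) => i im.
have N0 := lcN0 c.
have le : k + m <= (k + m) * N by apply: leq_pmulr.
rewrite (rev_ix (j := k + m) c); last by lia.
congr v; lia.
Qed.

Lemma sum_le1 (P : nat -> bool) N :
  (forall i j, i < N -> j < N -> P i -> P j -> i = j) -> \sum_(k < N) (P k : nat) <= 1.
Proof.
move=> h; case: (boolP [exists k : 'I_N, P k]) => [/existsP[k Pk]|/existsPn n].
  rewrite (bigD1 k) //= Pk big1 // => i ik; case: (boolP (P i)) => // Pi.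
  by move: (h _ _ (ltn_ord i) (ltn_ord k) Pi Pk) => /val_inj e; rewrite e eqxx in ik.
by rewrite big1 // => i _; rewrite (negPf (n i)).
Qed.

Lemma v_pred v N k : lcyc G v N -> v (N.-1 + k.+1) = v k.
Proof. by move=> c; rewrite -(lcP c k); congr v; have := lcN0 c; lia. Qed.

Lemma insert_no v N x k : lcyc G v N -> x \notin cset v N -> G x (v k) -> ~~ G x (v k.+1).
Proof.
move=> c xo g; apply/negP => g'; have N0 := lcN0 c.
have : opath G v N (v (N.-1 + k.+1)) [:: x] (v k.+1).
  by apply: opath_vertex; rewrite // adjC (v_pred k c).
by move/(reroute_chord_at c (_ : N.-1 < N)); rewrite subnn prednK // => /(_ (leqnn _)).
Qed.

(** Otherwise a crossing joins [v l] to [v k] through [x] and their successors through [y]; it loses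
    no vertex and gains two. *)
Lemma succ_pair v N x y k l : lcyc G v N -> x \notin cset v N -> y \notin cset v N -> x != y ->
  G x (v k) -> G y (v k.+1) -> G x (v l) -> G y (v l.+1) -> v k = v l.
Proof.
move=> c xo yo xy g1 g2 g3 g4; have N0 := lcN0 c.
have [d dN e] := pos_from k.+1 l c.
have ek := v_pred k c.
have e0 := e 0; have e1 := e 1; rewrite !addn0 addn1 in e0 e1.
case: (ltngtP d N.-1) => [lt||eq]; [|by lia|by rewrite -ek e0 eq].
have := @reroute_crossing_at v N k.+1 d d.+1 (N.-1 - d.+1) [:: x] [:: y] c (ltnSn _).
have -> : d.+1 + (N.-1 - d.+1) = N.-1 by lia.
move=> h; have : 2 <= d.+1 - d - 1 + (N.-1 - N.-1); last by lia.
apply: h; [lia| | |].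
- by apply: opath_vertex; rewrite // ?ek // adjC -e0.
- by apply: opath_vertex => //; rewrite adjC addSn -addn1 -e1.
- by move=> z; rewrite !inE => /eqP->.
Qed.

Definition sumd v N x := \sum_(k < N) (G x (v k) : nat).

Lemma sumd_shift v N x m : lcyc G v N -> \sum_(k < N) (G x (v (k + m)) : nat) = sumd v N x.
Proof. by move=> c; apply: (sum_shift (f := fun k => (G x (v k) : nat))) => k; rewrite (lcP c). Qed.

Lemma sumd_S v N x : lcyc G v N -> \sum_(k < N) (G x (v k.+1) : nat) = sumd v N x.
Proof. by move=> c; rewrite -(sumd_shift x 1 c); apply: eq_bigr => k _; rewrite addn1. Qed.

Lemma sumd_card v N x : lcyc G v N -> sumd v N x = #|[set y in cset v N | G x y]|.
Proof. by move=> c; rewrite /sumd (sum_cset (G x) c). Qed.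

Lemma deg_sumd v N x : lcyc G v N -> (forall y, y \notin cset v N -> ~~ G x y) -> deg G x = sumd v N x.
Proof.
move=> c h; rewrite (deg_split G x (cset v N)) -(sumd_card x c).
rewrite [X in _ + X](_ : _ = 0) ?addn0 //; apply/eqP; rewrite cards_eq0; apply/eqP/setP => y.
rewrite !inE; case: (boolP (y \in seg v 0 N)) => //= yo.
by apply/negbTE/h; rewrite inE.
Qed.

Lemma sumd_gt0 v N x : 0 < sumd v N x -> exists k, G x (v k).
Proof.
case: (boolP [exists k : 'I_N, G x (v k)]) => [/existsP[k g]|/existsPn h]; first by exists k.
by rewrite /sumd big1 // => k _; rewrite (negPf (h k)).
Qed.

Lemma sum_leD (f g : nat -> nat) N : (forall k, k < N -> f k <= g k) -> \sum_(k < N) f k <= \sum_(k < N) g k.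
Proof. by move=> h; apply: leq_sum => k _; apply: h. Qed.

Lemma sum_const1 N : \sum_(k < N) 1 = N.
Proof. by rewrite sum1_card card_ord. Qed.

Lemma v_shift v N i j m : lcyc G v N -> v i = v j -> v (i + m) = v (j + m).
Proof. by move=> c /(lcI c) e; apply: (lcyc_eqm c); apply/eqP; rewrite eqn_modDr e. Qed.

Lemma v_unshift v N i j m : lcyc G v N -> v (i + m) = v (j + m) -> v i = v j.
Proof. by move=> c /(lcI c)/eqP; rewrite eqn_modDr => /eqP/(lcyc_eqm c). Qed.

Lemma v_neq v N k o : lcyc G v N -> 0 < o < N -> v k != v (k + o).
Proof.
move=> c /andP[o0 oN]; apply/eqP => e; have := lcI c e; rewrite -{1}[k]addn0 => /eqP.
by rewrite eqn_modDl mod0n modn_small //; nlia.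
Qed.

End Positions.

(** * Longest cycles with independent complement *)

Section Twin.
Variables (T : finType) (G : sgraph T).
Implicit Types (x y z : T) (s p q : seq T) (A B : {set T}) (v : nat -> T).

Lemma iota_split a b c : b <= c -> iota a c = iota a b ++ iota (a + b) (c - b).
Proof. by move=> bc; rewrite -iotaD subnKC. Qed.

(** Needed when two exchangeable vertices, the twins [v k0.+1] and [v k1.+1], depend on the same
    [x], so that they cannot be exchanged one after the other. A cycle through [x] and all old
    vertices is built directly. *)
Lemma twin_swap v N x k0 k1 k : lcyc G v N -> x \notin cset v N ->
  G x (v k0) -> G x (v k0.+2) -> G x (v k1) -> G x (v k1.+2) ->
  v k0.+1 != v k1.+1 -> G (v k0.+1) (v k) -> G (v k1.+1) (v k.+1) ->
  v k != v k1.+1 -> v k.+1 != v k0.+1 -> False.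
Proof.
move=> c xo g0 g2 g3 g4 yy ga gb ne1 ne2.
have N2 := lc2 c.
(* With this origin the first twin is [w N.-1], and the second one will be [w p0.+1]. *)
pose w j := v (j + k0.+2).
have c' : lcyc G w N := lcyc_shift k0.+2 c.
have xo' : x \notin cset w N by rewrite (cset_shift k0.+2 c).
have wN1 : w N.-1 = v k0.+1 by apply: v_pred c.
have wN2 : w N.-2 = v k0 by rewrite -(lcP c k0) /w; congr v; nlia.
have w0 : w 0 = v k0.+2 by [].
have [p0 p0N ep] := pos_from k0.+2 k1 c.
have ep0 : v k1 = w p0 by have := ep 0; rewrite !addn0.
have ep1 : v k1.+1 = w p0.+1 by have := ep 1; rewrite !addn1.
have ep2 : v k1.+2 = w p0.+2 by have := ep 2; rewrite !addn2.
have [i iN ei] := pos_from k0.+2 k c.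
have ei0 : v k = w i by have := ei 0; rewrite !addn0.
have ei1 : v k.+1 = w i.+1 by have := ei 1; rewrite !addn1.
clearbody w.
have pN : p0.+1 < N.-1.
  have h1 : p0.+1 <> N.-1 by move=> e; move: yy; rewrite ep1 e wN1 eqxx.
  have h2 : p0.+1 <> N.
    move=> e; have := insert_no c xo g3; rewrite ep1 e.
    by have := lcP c' 0; rewrite add0n => ->; rewrite w0 g2.
  nlia.
have iN1 : i.+1 < N.-1.
  have h1 : i <> N.-1 by move=> e; move: ga; rewrite ei0 e wN1 adjxx.
  have h2 : i.+1 <> N.-1 by move=> e; move: ne2; rewrite ei1 e wN1 eqxx.
  nlia.
have ip : i.+1 < p0.+1 \/ p0.+1 < i.
  have h1 : i <> p0.+1 by move=> e; move: ne1; rewrite ei0 ep1 e eqxx.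
  have h2 : i.+1 <> p0.+1 by move=> e; move: gb; rewrite ei1 ep1 e adjxx.
  nlia.
rewrite ei0 -wN1 in ga. rewrite ei1 ep1 in gb. rewrite ep0 in g3. rewrite ep2 in g4.
rewrite -wN2 in g0. rewrite -w0 in g2.
have fin s : wk G (w N.-1) s (w N.-1) -> perm_eq s (map w (iota 0 N) ++ [:: x]) -> False.
  move=> ws ps.
  have := reroute c' ws ps (iota_uniq _ _) _ isT _; rewrite size_iota /= => h.
  suff : N + 1 <= N by nlia.
  apply: h; first by apply/allP=> j; rewrite mem_iota.
  by move=> z; rewrite inE => /eqP->.
(* The cycle edge from [w i] to [w i.+1] lies before or after the second twin; each position has its
   own rerouting. *)
case: ip => ip.
- pose s := [:: w i] ++ (rev (seg w 0 i) ++ ([:: x] ++ ([:: w p0] ++ (rev (seg w i.+1 (p0 - i.+1)) ++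
     ([:: w p0.+1] ++ seg w p0.+2 (N.-1 - p0.+1)))))).
  apply: (fin s).
    apply: (wk_cat (wk1 ga)); apply: (wk_cat (seg_wkr c' 0 i)).
    apply: (wk_cat (wk1 (_ : G _ x))); first by rewrite adjC.
    apply: (wk_cat (wk1 (_ : G _ (w p0)))) => //.
    apply: (@wk_cat _ _ _ _ (w i.+1)).
      by have := seg_wkr c' i.+1 (p0 - i.+1); rewrite subnKC.
    apply: (wk_cat (wk1 (_ : G _ (w p0.+1)))); first by rewrite adjC.
    by have := seg_wk c' p0.+1 (N.-1 - p0.+1); rewrite subnKC //; nlia.
  apply/permP => P; rewrite /s !count_cat !count_rev.
  rewrite (@iota_split 0 i) ?(@iota_split _ (p0 - i) (N - i)); try nlia.
  rewrite add0n subnKC; last by nlia.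
  have -> : N - i - (p0 - i) = (N.-1 - p0.+1).+2 by nlia.
  have -> : p0 - i = (p0 - i.+1).+1 by nlia.
  rewrite !map_cat !count_cat /= -!/(seg _ _ _); nlia.
- pose s := [:: w i] ++ (rev (seg w p0.+2 (i - p0.+2)) ++ ([:: x] ++ ([:: w N.-2] ++ (rev (seg w i.+1 (N.-2 - i.+1)) ++
     ([:: w p0.+1] ++ (rev (seg w 0 p0.+1) ++ [:: w N.-1])))))).
  apply: (fin s).
    apply: (wk_cat (wk1 ga)).
    apply: (@wk_cat _ _ _ _ (w p0.+2)).
      by have := seg_wkr c' p0.+2 (i - p0.+2); rewrite subnKC.
    apply: (wk_cat (wk1 (_ : G _ x))); first by rewrite adjC.
    apply: (wk_cat (wk1 (_ : G _ (w N.-2)))) => //.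
    apply: (@wk_cat _ _ _ _ (w i.+1)).
      by have := seg_wkr c' i.+1 (N.-2 - i.+1); rewrite subnKC //; nlia.
    apply: (wk_cat (wk1 (_ : G _ (w p0.+1)))); first by rewrite adjC.
    apply: (wk_cat (seg_wkr c' 0 p0.+1)); apply: wk1.
    have := lcG c' N.-1; rewrite prednK; last by nlia.
    by have := lcP c' 0; rewrite add0n => ->; rewrite adjC.
  apply/permP => P; rewrite /s !count_cat !count_rev.
  rewrite (@iota_split 0 p0.+1) ?(@iota_split _ (i - p0.+1) (N - p0.+1)); try nlia.
  rewrite add0n subnKC; last by nlia.
  have -> : N - p0.+1 - (i - p0.+1) = (N.-2 - i.+1).+1 + 2 by nlia.
  have -> : i - p0.+1 = (i - p0.+2).+1 by nlia.
  rewrite iotaD !map_cat !count_cat /= -!/(seg _ _ _).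
  have -> : i + (N.-2 - i.+1).+1 = N.-2 by nlia.
  have -> : N.-2.+1 = N.-1 by nlia.
  nlia.
Qed.

End Twin.

(** * Averaging *)

Section Averages.
Variables (T : finType) (G : sgraph T).

(** A weighted mean with weights [P] and total weight [p]: some index of positive weight does not
    exceed it. *)
Lemma pigeon (P f : nat -> nat) N M p : \sum_(k < N) P k = p -> 0 < p ->
  \sum_(k < N) P k * f k <= M -> exists k, 0 < P k /\ p * f k <= M.
Proof.
move=> sp p0 le; case: (boolP [exists k : 'I_N, (0 < P k) && (p * f k <= M)]).
  by case/existsP=> k /andP[]; exists k.
move=> /existsPn h; exfalso.
have : \sum_(k < N) P k * (M.+1) <= \sum_(k < N) p * (P k * f k).
  apply: leq_sum => k _; have := h k; rewrite negb_and -!ltnNge.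
  by case/orP=> [|lt]; [rewrite ltnS leqn0 => /eqP->|rewrite mulnCA leq_mul2l lt orbT].
rewrite -big_distrl -big_distrr /= sp leq_pmul2l // => h'.
by have := leq_trans h' le; rewrite ltnn.
Qed.

(** At most one vertex of [B] has degree below (2n - 3)/6. Pairing it with a second vertex makes up
    its deficit, and every other vertex meets the bound alone. *)
Lemma indep_deg_sum n (B : {set T}) : 1 < #|B| ->
  {in B &, forall b b', b != b' -> 2 * n <= 3 * (deg G b + deg G b') + 3} ->
  #|B| * (2 * n) <= 6 * (\sum_(b in B) deg G b) + 3 * #|B|.
Proof.
move=> B2 h.
have gen (A : {set T}) : {in A, forall b, 2 * n <= 6 * deg G b + 3} ->
    #|A| * (2 * n) <= 6 * (\sum_(b in A) deg G b) + 3 * #|A|.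
  move=> hA; have : \sum_(b in A) 2 * n <= \sum_(b in A) (6 * deg G b + 3) by apply: leq_sum.
  have -> : \sum_(b in A) (6 * deg G b + 3) = 6 * (\sum_(b in A) deg G b) + 3 * #|A|.
    by rewrite big_split sum_nat_const big_distrr /= [_ * 3]mulnC.
  by rewrite sum_nat_const.
case: (boolP [exists b in B, 6 * deg G b + 3 < 2 * n]) => [/exists_inP[b bB lt]|]; last first.
  by move=> /exists_inPn hB; apply: gen => b /hB; rewrite -leqNgt.
have eB := cardsD1 b B; rewrite bB in eB.
have /card_gt0P[b2 b2B] : 0 < #|B :\ b| by lia.
have eB2 := cardsD1 b2 (B :\ b); rewrite b2B in eB2.
have [b2b b2B'] : b2 != b /\ b2 \in B by move: b2B; rewrite !inE => /andP[].
rewrite (big_setD1 b bB) (big_setD1 b2 b2B) /=.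
have h1 : 2 * n <= 3 * (deg G b + deg G b2) + 3 by apply: h; rewrite // eq_sym.
have h2 := gen (B :\ b :\ b2).
have {}h2 : #|B :\ b :\ b2| * (2 * n) <= 6 * (\sum_(i in B :\ b :\ b2) deg G i) + 3 * #|B :\ b :\ b2|.
  apply: h2 => a; rewrite !inE => /and3P[_ ab aB].
  by have := h b a bB aB; rewrite eq_sym => /(_ ab); lia.
move: eB eB2 h1 h2; move: #|B| #|B :\ b| #|_| (\sum_(_ in _) _) (deg G b) (deg G b2) => a1 a2 a3 a4 a5 a6.
by clear; move=> -> -> h1 h2; nia.
Qed.

End Averages.

(** * Every longest cycle has an independent complement *)

Section Dominating.
Variables (T : finType) (G : sgraph T).
Implicit Types (x y z : T) (s p q : seq T) (A B : {set T}) (v : nat -> T).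
Variable n : nat.
Hypothesis n13 : 13 <= n.
Hypothesis Tn : #|T| = n.
Hypothesis k2 : k_connected 2 G.
Hypothesis sig : forall u w, u != w -> ~~ G u w -> 2 * n <= 3 * (deg G u + deg G w) + 3.
Hypothesis nj : ~ has_spanning_jellyfish G.

Lemma missed_outside v N k : lcyc G v N -> exists2 x, x \notin cset v N & ~~ G (v k) x.
Proof.
move=> c; case: (boolP [exists x, (x \notin cset v N) && ~~ G (v k) x]).
  by case/existsP=> x /andP[]; exists x.
move=> /existsPn h; exfalso; apply: nj.
apply: (jellyfish_of_cycle (lcyc_seq c) (v := v k)); first by have := mem_cset c k; rewrite inE.
by move=> x xs; have := h x; rewrite inE xs negbK.
Qed.

Definition outdeg v N := \sum_(x in ~: cset v N) deg G x.

Lemma max_outdeg : exists v N, lcyc G v N /\ forall v', lcyc G v' N -> outdeg v' N <= outdeg v N.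
Proof.
have [v0 [N c0]] := exists_lcyc (exists_ucyc k2).
pose P m := [exists s : N.-tuple T, ucyc G s && (\sum_(x in ~: [set x in s]) deg G x == m)].
have Pv v : lcyc G v N -> P (outdeg v N).
  move=> c; have sz : size (seg v 0 N) == N by rewrite size_seg.
  by apply/existsP; exists (Tuple sz); rewrite (lcyc_seq c) /=.
have ub m : P m -> m <= \sum_x deg G x.
  case/existsP=> s /andP[_ /eqP<-]; rewrite [X in _ <= X](bigID (fun x => x \in ~: [set x in s])) /=.
  exact: leq_addr.
case: (ex_maxnP (ex_intro P _ (Pv _ c0)) ub) => m /existsP[s /andP[us /eqP es]] mM.
have [s' us'|v c eC] := lcyc_of_seq us; first by rewrite size_tuple; apply: (lcM c0).
rewrite size_tuple in c eC.
exists v, N; split=> // v' c'.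
have -> : outdeg v N = m.
  rewrite -es; apply: eq_bigl => x; rewrite !inE -(eC x) inE //.
by apply/mM/Pv.
Qed.

Hypothesis Dh : forall v N, lcyc G v N -> forall x y, x \notin cset v N -> y \notin cset v N -> ~~ G x y.

Lemma deg_outside v N x : lcyc G v N -> x \notin cset v N -> deg G x = sumd G v N x.
Proof. by move=> c xo; apply: deg_sumd => // y yo; apply: (Dh c). Qed.

Lemma card_out v N : lcyc G v N -> #|~: cset v N| + N = n.
Proof. by move=> c; rewrite -[N in _ + N](card_cset c) addnC cardsC Tn. Qed.

Definition consec v N x y := \sum_(k < N) (G x (v k) && G y (v k.+1) : nat).

Lemma succ_pair1 v N x y : lcyc G v N -> x \notin cset v N -> y \notin cset v N -> x != y ->
  consec v N x y <= 1.
Proof.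
move=> c xo yo xy; apply: (sum_le1 (P := fun k => G x (v k) && G y (v k.+1))) => i j iN jN.
move=> /andP[g1 g2] /andP[g3 g4]; apply: (v_inj c) => //.
exact: succ_pair c xo yo xy g1 g2 g3 g4.
Qed.

(** No cycle vertex sees all outside vertices. With at most three of these, counting their
    neighbours along the cycle edges contradicts the degree condition. *)
Lemma out_ge4 v N : lcyc G v N -> 4 <= #|~: cset v N|.
Proof.
move=> c; rewrite leqNgt; apply/negP => r3; have cr := card_out c.
set X := ~: cset v N in r3 cr.
have inX x : (x \in X) = (x \notin cset v N) by rewrite in_setC.
clearbody X.
have: #|X| \in [:: 0; 1; 2; 3] by rewrite !inE; move: r3; case: #|X| => [|[|[|[|?]]]].
case: (posnP #|X|) => [/eqP|X0].
  by rewrite cards_eq0 => /eqP X0 _; have [x] := missed_outside 0 c; rewrite -inX X0 inE.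
rewrite !inE => /or4P[/eqP e|/cards1P[x X1]|/cards2P[x [y [xy X2]]]|/eqP X3].
- by rewrite e in X0.
- have [k kx] : exists k, G x (v k).
    have : 0 < sumd G v N x.
      by rewrite -(deg_outside c) -?inX ?X1 ?set11 //; apply: ltnW; apply: deg_ge2.
    exact: sumd_gt0.
  by have [x'] := missed_outside k c; rewrite -inX X1 => /set1P->; rewrite adjC kx.
- have xo : x \notin cset v N by rewrite -inX X2 !inE eqxx.
  have yo : y \notin cset v N by rewrite -inX X2 !inE eqxx orbT.
  have nc k : ~~ (G x (v k) && G y (v k)).
    have [z] := missed_outside k c; rewrite -inX X2 adjC => /set2P[]-> /negPf->; by rewrite ?andbF.
  have s1 := succ_pair1 c xo yo xy.
  have s2 := succ_pair1 c yo xo (_ : y != x).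
  rewrite eq_sym xy in s2; move/(_ isT): s2 => s2.
  (* The ends of a cycle edge have a, b <= 1 neighbours among x and y, so [a + b <= 1 + a * b] from
     [(1 - a) * (1 - b) >= 0]. By [insert_no] the product counts only pairs of distinct vertices. *)
  have le : \sum_(k < N) (G x (v k) + G y (v k) + (G x (v k.+1) + G y (v k.+1))) <=
     \sum_(k < N) (1 + (G x (v k) && G y (v k.+1)) + (G y (v k) && G x (v k.+1))).
    apply: (sum_leD (f := fun k => G x (v k) + G y (v k) + (G x (v k.+1) + G y (v k.+1)))
      (g := fun k => 1 + (G x (v k) && G y (v k.+1)) + (G y (v k) && G x (v k.+1)))) => k _.
    have := nc k; have := nc k.+1; have := insert_no c xo (k := k); have := insert_no c yo (k := k).
    by case: (G x (v k)); case: (G y (v k)); case: (G x (v k.+1)); case: (G y (v k.+1)) => //= [/(_ isT)|_ /(_ isT)].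
  rewrite !big_split /= sum_const1 in le.
  rewrite !(sumd_S _ c) in le.
  have := sig xy (Dh c xo yo); rewrite (deg_outside c xo) (deg_outside c yo).
  have := cards2 x y; rewrite -X2 xy => /= cX.
  have {}le : sumd G v N x + sumd G v N y + (sumd G v N x + sumd G v N y) <= N + consec v N x y + consec v N y x := le.
  lia.
- have /card_gt0P[x xX] := X0.
  have e1 := cardsD1 x X; rewrite xX X3 in e1.
  have /cards2P[y [z [yz X2]]] : #|X :\ x| == 2 by apply/eqP; lia.
  have : y \in X :\ x by rewrite X2 !inE eqxx.
  have : z \in X :\ x by rewrite X2 !inE eqxx orbT.
  rewrite !inE => /andP[zx zX] /andP[yx yX].
  have xo : x \notin cset v N by rewrite -inX.
  have yo : y \notin cset v N by rewrite -inX.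
  have zo : z \notin cset v N by rewrite -inX.
  have Xe : X = [set x; y; z] by rewrite -setUA -X2 setD1K.
  have nc k : ~~ [&& G x (v k), G y (v k) & G z (v k)].
    have [a] := missed_outside k c; rewrite -inX Xe adjC !inE -orbA => /or3P[]/eqP-> /negPf->; by rewrite ?andbF.
  have xy : x != y by rewrite eq_sym.
  have xz : x != z by rewrite eq_sym.
  have zy : z != y by rewrite eq_sym.
  have s1 := succ_pair1 c xo yo xy. have s2 := succ_pair1 c yo xo yx.
  have s3 := succ_pair1 c xo zo xz. have s4 := succ_pair1 c zo xo zx.
  have s5 := succ_pair1 c yo zo yz. have s6 := succ_pair1 c zo yo zy.
  pose P a b k : nat := G a (v k) && G b (v k.+1).
  (* Now a, b <= 2, and [(2 - a) * (2 - b) >= 0] gives [2 * (a + b) <= 4 + a * b]. The neighbour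
     sets at both ends are disjoint by [insert_no], so the product counts ordered pairs of distinct
     outside vertices. *)
  have le : \sum_(k < N) (2 * (G x (v k) + G y (v k) + G z (v k) + (G x (v k.+1) + G y (v k.+1) + G z (v k.+1)))) <=
     \sum_(k < N) (4 + (P x y k + P y x k + P x z k + P z x k + P y z k + P z y k)).
    apply: (sum_leD (f := fun k => 2 * (G x (v k) + G y (v k) + G z (v k) + (G x (v k.+1) + G y (v k.+1) + G z (v k.+1))))
      (g := fun k => 4 + (P x y k + P y x k + P x z k + P z x k + P y z k + P z y k))) => k _.
    have := nc k; have := nc k.+1; have := insert_no c xo (k := k); have := insert_no c yo (k := k).
    have := insert_no c zo (k := k); rewrite /P.
    case: (G x (v k)); case: (G y (v k)); case: (G z (v k)); case: (G x (v k.+1)); case: (G y (v k.+1)); case: (G z (v k.+1)) => //= a b c'; try (by move: (a isT)); try (by move: (b isT)); by move: (c' isT).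
  rewrite -big_distrr /= !big_split /= sum_nat_const card_ord in le.
  rewrite !(sumd_S _ c) in le.
  have := sig xy (Dh c xo yo); have := sig xz (Dh c xo zo); have := sig yz (Dh c yo zo).
  rewrite (deg_outside c xo) (deg_outside c yo) (deg_outside c zo).
  have {}le : 2 * (sumd G v N x + sumd G v N y + sumd G v N z + (sumd G v N x + sumd G v N y + sumd G v N z))
    <= N * 4 + (consec v N x y + consec v N y x + consec v N x z + consec v N z x + consec v N y z + consec v N z y) := le.
  move: le s1 s2 s3 s4 s5 s6 cr X3; move: (consec v N x y) (consec v N y x) (consec v N x z) (consec v N z x) (consec v N y z) (consec v N z y).
  move: (sumd G v N x) (sumd G v N y) (sumd G v N z) #|X|; clear -n13; lia.
Qed.

(** Seen from the origin [v k.+1], a neighbour of [x] one or two places before a neighbour of [x']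
    yields a longer cycle, so three events at [j], [j + 1] and [j + 2] exclude one another. *)
Lemma consec_deg v N x x' k : lcyc G v N -> x \notin cset v N -> x' \notin cset v N ->
  G x (v k) -> G x' (v k.+1) -> deg G x + 2 * deg G x' <= N + 2.
Proof.
move=> c xo xo' g g'.
have xx' : x != x'.
  by apply/eqP => e; have := insert_no c xo g; rewrite e g'.
have N2 := lc2 c.
have eN := v_pred k c.
pose w j := v (j + k.+1).
have w0 : w 0 = v k.+1 by [].
have wP j : w (j + N) = w j by rewrite /w addnAC (lcP c).
have cA i : 0 < i -> i < N -> G x' (w i) -> G x (w i.-1) -> false.
  move=> i0 iN h1 h2.
  have := @reroute_crossing_at _ _ v N k.+1 i.-1 i (N.-1 - i) [:: x] [:: x'] c; rewrite subnKC; last by nlia.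
  move=> h; suff: 2 <= i - i.-1 - 1 + (N.-1 - N.-1) by nlia.
  apply: h; [nlia|nlia| | |]; last by move=> z; rewrite !inE => /eqP->.
    by apply: opath_vertex; rewrite // ?eN // adjC.
  by apply: opath_vertex; rewrite // adjC.
(* This crossing skips one cycle vertex but gains both [x] and [x']. *)
have cB i : 1 < i -> i < N -> G x' (w i) -> G x (w i.-2) -> false.
  move=> i0 iN h1 h2.
  have := @reroute_crossing_at _ _ v N k.+1 i.-2 i (N.-1 - i) [:: x] [:: x'] c; rewrite subnKC; last by nlia.
  move=> h; suff: 2 <= i - i.-2 - 1 + (N.-1 - N.-1) by nlia.
  apply: h; [nlia|nlia| | |]; last by move=> z; rewrite !inE => /eqP->.
    by apply: opath_vertex; rewrite // ?eN // adjC.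
  by apply: opath_vertex; rewrite // adjC.
have cI j : G x' (w j) -> ~~ G x' (w j.+1) by apply: (insert_no c).
have h0 : G x' (w 0) by [].
have h1 : ~~ G x' (w 1) by apply: cI.
(* Only at the last two indices do [j + 1] or [j + 2] wrap around to the origin; there one more is
   allowed. *)
have le : \sum_(j < N) (G x (w j) + G x' (w j.+1) + G x' (w j.+2)) <=
          \sum_(j < N) (1 + (j == N.-1 :> nat) + (j == N.-2 :> nat)).
  apply: (sum_leD (f := fun j => G x (w j) + G x' (w j.+1) + G x' (w j.+2))
          (g := fun j => 1 + (j == N.-1 :> nat) + (j == N.-2 :> nat))) => j jN.
  case: (ltnP j N.-2) => jN2.
    have := cA j.+1 _ _; have := cB j.+2 _ _; have := cI j.+1.
    move=> a1 a2 a3.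
    have {}a2 : G x' (w j.+2) -> G x (w j) -> false by apply: a2 => //; nlia.
    have {}a3 : G x' (w j.+1) -> G x (w j) -> false by apply: a3 => //; nlia.
    case: (G x (w j)) a2 a3; case: (G x' (w j.+1)) a1; case: (G x' (w j.+2)) => //= a1 a2 a3; try nlia;
    by [move: (a1 isT)|move: (a2 isT isT)|move: (a3 isT isT)].
  case: (ltngtP j N.-2) jN2 => // [jN2 _|->].
    have -> : j = N.-1 by nlia.
    rewrite eqxx; have -> : N.-1.+1 = N by nlia.
    have -> : w N.+1 = w 1 by rewrite -[N.+1]add1n wP.
    by rewrite (negPf h1); case: (G x _); case: (G x' _); nlia.
  have e1 : w N.-2.+2 = w 0 by rewrite -(wP 0); congr w; nlia.
  have a1 := cI N.-2.+1; rewrite e1 h0 in a1.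
  have -> : G x' (w N.-2.+1) = false by apply/negP => /a1.
  rewrite ?eqxx; case: (G x _); case: (G x' _); nlia.
rewrite !big_split /= sum_const1 in le.
have c' := lcyc_shift k.+1 c.
have e2 : \sum_(j < N) (G x' (w j.+2) : nat) = sumd G w N x'.
  by rewrite -(sumd_shift x' 2 c'); apply: eq_bigr => j _; rewrite addn2.
rewrite (sumd_S x' c') e2 in le.
have d1 : sumd G w N x' = deg G x' by rewrite (deg_outside c xo') -(sumd_shift x' k.+1 c).
have d2 : sumd G w N x = deg G x by rewrite (deg_outside c xo) -(sumd_shift x k.+1 c).
have s1 : \sum_(j < N) (j == N.-1 :> nat) <= 1.
  by apply: (sum_le1 (P := fun j => j == N.-1)) => i j _ _ /eqP-> /eqP->.
have s2 : \sum_(j < N) (j == N.-2 :> nat) <= 1.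
  by apply: (sum_le1 (P := fun j => j == N.-2)) => i j _ _ /eqP-> /eqP->.
rewrite -d1 -d2.
have {}le : sumd G w N x + sumd G w N x' + sumd G w N x' <= N + \sum_(j < N) (j == N.-1 :> nat) + \sum_(j < N) (j == N.-2 :> nat) := le.
clear - le s1 s2; nlia.
Qed.

Lemma nbrs_nonconsec v N x x' k : lcyc G v N -> x \notin cset v N -> x' \notin cset v N ->
  G x (v k) -> ~~ G x' (v k.+1).
Proof.
move=> c xo xo' g; apply/negP => g'.
have xx' : x != x'.
  by apply/eqP => e; have := insert_no c xo g; rewrite e g'.
have h1 := consec_deg c xo xo' g g'.
have [k' e] := rev_at k 1 c; have c' := lcyc_rev c.
have h2 : deg G x' + 2 * deg G x <= N + 2.
  apply: (@consec_deg _ N x' x k' c'); rewrite ?(cset_rev c) //.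
    by have := e 0; rewrite addn0 subn0 addn1 => -> .
  by have := e 1; rewrite addn1 addnK => ->.
(* The two bounds add up to 3(d + d') <= 2N + 4, while the degree condition with n >= N + 4 requires
   at least 2N + 5. *)
have := sig xx' (Dh c xo xo'); have := out_ge4 c; have := card_out c; clear -h1 h2; lia.
Qed.

(* A vertex of [zset] can be exchanged with an outside vertex, giving another
   longest cycle; so what holds for outside vertices extends to it. *)
Definition zset v N := [set y | [exists x, [exists k : 'I_N,
  [&& x \notin cset v N, y == v k.+1, G x (v k) & G x (v k.+2)]]]].

Lemma zsetP v N y : reflect (exists x k, [/\ k < N, x \notin cset v N, y = v k.+1, G x (v k) & G x (v k.+2)])
  (y \in zset v N).
Proof.
rewrite inE; apply: (iffP existsP) => [[x /existsP[k /and4P[h1 /eqP h2 h3 h4]]]|[x [k [kN h1 h2 h3 h4]]]].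
  by exists x, k.
by exists x; apply/existsP; exists (Ordinal kN); rewrite h1 h2 eqxx h3 h4.
Qed.

Lemma zset_cset v N y : lcyc G v N -> y \in zset v N -> y \in cset v N.
Proof. by move=> c /zsetP[x [k [_ _ -> _ _]]]; apply: mem_cset c _. Qed.

Lemma out_zset v N x y : lcyc G v N -> x \notin cset v N -> y \in zset v N -> ~~ G x y.
Proof. by move=> c xo /zsetP[x0 [k [_ x0o -> g _]]]; apply: (nbrs_nonconsec c x0o xo g). Qed.

Lemma exchE v y x k : v k != y -> exchange v y x k = v k.
Proof. by rewrite /exchange => /negPf->. Qed.

Lemma exch_out v N i x z : lcyc G v N -> x \notin cset v N -> G x (v i) -> G x (v i.+2) ->
  (z \notin cset (exchange v (v i.+1) x) N) = (z != x) && ((z \notin cset v N) || (z == v i.+1)).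
Proof.
move=> c xo g1 g2; rewrite (exchange_cset c xo g1 g2) in_setU1 in_setD1 negb_or negb_and negbK orbC.
by rewrite orbC [_ || (_ \notin _)]orbC.
Qed.

(** If a vertex [x0] other than [x] makes [y] exchangeable, exchanging [y] with [x0] puts both [x]
    and [y] outside. Otherwise a crossing through [x] and along the edge from [y] to [v k.+1]
    inserts [x] without loss. *)
Lemma zset_out1 v N x y k : lcyc G v N -> x \notin cset v N -> y \in zset v N ->
  G x (v k) -> ~~ G y (v k.+1).
Proof.
move=> c xo yz gx; apply/negP => gy; have xy := out_zset c xo yz.
have /zsetP[x0 [k0 [k0N x0o ey g1 g2]]] := yz; rewrite ey in gy xy.
have N2 := lc2 c.
have ne1 : v k != v k0.+1 by apply/eqP => e; rewrite -e gx in xy.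
have ne2 : v k.+1 != v k0.+1 by apply/eqP => e; rewrite -e adjxx in gy.
case: (x =P x0) => [xx0|/eqP xx0]; last first.
  have c' := exchange_lcyc c x0o g1 g2.
  have xo' : x \notin cset (exchange v (v k0.+1) x0) N by rewrite exch_out // xx0 xo.
  have yo' : v k0.+1 \notin cset (exchange v (v k0.+1) x0) N.
    rewrite exch_out // eqxx orbT andbT; apply/eqP => e; by move: x0o; rewrite -e (mem_cset c).
  by have := nbrs_nonconsec c' xo' yo' (k := k); rewrite !exchE // => /(_ gx); rewrite gy.
rewrite -xx0 in g1 g2 x0o.
have [i iN e] := pos_from k0.+1 k c.
have e0 := e 0; have e1 := e 1; rewrite !addn0 !addn1 in e0 e1.
have iN1 : i < N.-1.
  suff : i <> N.-1 by nlia.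
  by move=> e'; case/eqP: ne2; rewrite e1 e' -addnS (v_pred _ c) ?(lcP c).
have := @reroute_crossing_at _ _ v N k0.+1 i i.+1 (N.-1 - i.+1) [:: x] [::] c (ltnSn _).
have -> : i.+1 + (N.-1 - i.+1) = N.-1 by nlia.
move=> h; have : 1 <= i.+1 - i - 1 + (N.-1 - N.-1); last by nlia.
apply: h; [nlia| | |by []].
  by apply: opath_vertex; rewrite // ?(v_pred _ c) // adjC -e0.
by apply: opath_edge; rewrite addSn -e1 adjC.
Qed.

Lemma zset_out2 v N x y k : lcyc G v N -> x \notin cset v N -> y \in zset v N ->
  G y (v k) -> ~~ G x (v k.+1).
Proof.
move=> c xo yz gy; apply/negP => gx; have xy := out_zset c xo yz.
have /zsetP[x0 [k0 [k0N x0o ey g1 g2]]] := yz; rewrite ey in gy xy.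
have N2 := lc2 c.
have ne1 : v k.+1 != v k0.+1 by apply/eqP => e; rewrite -e gx in xy.
have ne2 : v k != v k0.+1 by apply/eqP => e; rewrite -e adjxx in gy.
case: (x =P x0) => [xx0|/eqP xx0]; last first.
  have c' := exchange_lcyc c x0o g1 g2.
  have xo' : x \notin cset (exchange v (v k0.+1) x0) N by rewrite exch_out // xx0 xo.
  have yo' : v k0.+1 \notin cset (exchange v (v k0.+1) x0) N.
    rewrite exch_out // eqxx orbT andbT; apply/eqP => e; by move: x0o; rewrite -e (mem_cset c).
  by have := nbrs_nonconsec c' yo' xo' (k := k); rewrite !exchE // => /(_ gy); rewrite gx.
rewrite -xx0 in g1 g2 x0o.
have [i iN e] := pos_from k0.+2 k c.
have e0 := e 0; have e1 := e 1; rewrite !addn0 !addn1 in e0 e1.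
have iN1 : i < N.-1.
  suff : i <> N.-1 by nlia.
  by move=> e'; case/eqP: ne2; rewrite e0 e' (v_pred _ c).
have := @reroute_crossing_at _ _ v N k0.+2 i i.+1 (N.-1 - i.+1) [::] [:: x] c (ltnSn _).
have -> : i.+1 + (N.-1 - i.+1) = N.-1 by nlia.
move=> h; have : 1 <= i.+1 - i - 1 + (N.-1 - N.-1); last by nlia.
apply: h; [nlia| | |by []].
  by apply: opath_edge; rewrite (v_pred _ c) -e0 adjC.
by apply: opath_vertex; rewrite // addSn -e1 adjC.
Qed.

Lemma zset_indep v N y y' : lcyc G v N -> y \in zset v N -> y' \in zset v N -> ~~ G y y'.
Proof.
move=> c yz /zsetP[x [k [_ xo -> g1 _]]]; exact: (zset_out1 c xo yz g1).
Qed.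

(** Exchanges put [y] and [y'] outside, unless two different vertices depend on the same outside
    vertex; that case is [twin_swap]. *)
Lemma zset_nonconsec v N y y' k : lcyc G v N -> y \in zset v N -> y' \in zset v N ->
  G y (v k) -> ~~ G y' (v k.+1).
Proof.
move=> c yz yz' gy; apply/negP => gy'.
have /zsetP[x0 [k0 [k0N x0o ey g1 g2]]] := yz.
have /zsetP[x1 [k1 [k1N x1o ey' g3 g4]]] := yz'.
have iyy' := zset_indep c yz yz'.
have ne1 : v k != y by apply: contraTneq gy => ->; rewrite adjxx.
have ne2 : v k.+1 != y' by apply: contraTneq gy' => ->; rewrite adjxx.
have ne3 : v k != y' by apply: contraTneq gy => ->.
have ne4 : v k.+1 != y by apply: contraTneq gy' => ->; rewrite adjC.
have c' := exchange_lcyc c x0o g1 g2.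
have x0y : y != x0 by apply: contraNneq x0o => <-; apply: zset_cset yz.
have yo' : y \notin cset (exchange v y x0) N.
  by rewrite ey exch_out // -ey eqxx orbT andbT.
rewrite -ey in c'.
case: (y =P y') => [e|/eqP yy'].
  rewrite -e in gy'.
  by have := nbrs_nonconsec c' yo' yo' (k := k); rewrite !exchE // => /(_ gy); rewrite gy'.
case: (x1 =P x0) => [e|/eqP xx].
  rewrite e in g3 g4; rewrite ey ey' in yy' gy gy' ne3 ne4.
  exact: (twin_swap c x0o g1 g2 g3 g4 yy' gy gy' ne3 ne4).
have x1o' : x1 \notin cset (exchange v y x0) N by rewrite ey exch_out // xx x1o.
have x1y := out_zset c x1o yz.
have e1 : exchange v y x0 k1 = v k1 by apply: exchE; apply: contraTneq g3 => ->.
have e2 : exchange v y x0 k1.+2 = v k1.+2 by apply: exchE; apply: contraTneq g4 => ->.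
have e3 : exchange v y x0 k1.+1 = y' by rewrite exchE -ey' // eq_sym.
rewrite -e1 in g3; rewrite -e2 in g4.
have c'' := exchange_lcyc c' x1o' g3 g4; rewrite e3 in c''.
have x1y' : y' != x1 by apply: contraNneq x1o => <-; apply: zset_cset yz'.
have o1 : y \notin cset (exchange (exchange v y x0) y' x1) N.
  rewrite -e3 exch_out // yo' /= andbT; apply: contraNneq x1o => <-; exact: zset_cset yz.
have o2 : y' \notin cset (exchange (exchange v y x0) y' x1) N.
  by rewrite -e3 exch_out // eqxx orbT andbT e3.
have := nbrs_nonconsec c'' o1 o2 (k := k); rewrite !exchE ?exchE // => /(_ gy).
by rewrite gy'.
Qed.

Definition bset v N := ~: cset v N :|: zset v N.

Lemma bset_nonconsec v N b b' k : lcyc G v N -> b \in bset v N -> b' \in bset v N ->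
  G b (v k) -> ~~ G b' (v k.+1).
Proof.
move=> c; rewrite !in_setU !in_setC => /orP[] h1 /orP[] h2.
- exact: (nbrs_nonconsec c h1 h2).
- exact: (zset_out1 c h1 h2).
- exact: (zset_out2 c h2 h1).
- exact: (zset_nonconsec c h1 h2).
Qed.

Lemma bset_indep v N b b' : lcyc G v N -> b \in bset v N -> b' \in bset v N -> ~~ G b b'.
Proof.
move=> c; rewrite !in_setU !in_setC => /orP[] h1 /orP[] h2.
- exact: (Dh c).
- exact: (out_zset c).
- by rewrite adjC; apply: (out_zset c).
- exact: (zset_indep c).
Qed.

Lemma bset_deg v N b : lcyc G v N -> b \in bset v N -> deg G b = sumd G v N b.
Proof.
move=> c bB; apply: (deg_sumd c) => y yo; apply: (bset_indep c) => //.
by rewrite in_setU in_setC yo.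
Qed.

(* Exchanging an outside non-neighbour of [w] with a cycle neighbour of [w]
   keeps [w] on the cycle; in the end [w] is the centre of a jellyfish. *)
Lemma greedy m v N w : lcyc G v N -> w \in cset v N ->
  #|[set x in ~: cset v N | ~~ G w x]| <= m ->
  (forall x, x \notin cset v N -> ~~ G w x ->
     #|[set x in ~: cset v N | ~~ G w x]| <= #|[set y in cset v N | G w y &
        [exists k : 'I_N, [&& y == v k.+1, G x (v k) & G x (v k.+2)]]]|) -> False.
Proof.
elim: m v => [|m IH] v c wC.
  rewrite leqn0 cards_eq0 => /eqP h0 _; apply: nj.
  apply: (jellyfish_of_cycle (lcyc_seq c) (v := w)); first by move: wC; rewrite inE.
  move=> x xo; apply: contraT => gwx.
  suff : x \in set0 by rewrite inE.
  by rewrite -h0 !inE xo gwx.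
move=> le hx.
case: (set_0Vmem [set x in ~: cset v N | ~~ G w x]) => [h0|[x]].
  by apply: (IH v c wC); rewrite h0 cards0 // => x _ _.
rewrite inE in_setC => /andP[xo gwx].
have X0 : 0 < #|[set x in ~: cset v N | ~~ G w x]|.
  by apply/card_gt0P; exists x; rewrite inE in_setC xo.
have /card_gt0P[y] := leq_trans X0 (hx x xo gwx).
rewrite inE => /and3P[yC gwy /existsP[k /and3P[/eqP ey g1 g2]]].
have c' := exchange_lcyc c xo g1 g2; rewrite -ey in c'.
have yx : y != x by apply: contraNneq xo => <-.
have out' z : (z \notin cset (exchange v y x) N) = (z != x) && ((z \notin cset v N) || (z == y)).
  by rewrite ey exch_out.
have eX : [set z in ~: cset (exchange v y x) N | ~~ G w z] = [set z in ~: cset v N | ~~ G w z] :\ x.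
  apply/setP => z; rewrite !inE -![z \in seg _ _ _](in_set (fun a => a \in seg _ _ _)) out'.
  case: (z =P y) => [->|]; last by rewrite orbF andbA.
  by rewrite gwy !andbF.
have cX : #|[set z in ~: cset v N | ~~ G w z]| = #|[set z in ~: cset (exchange v y x) N | ~~ G w z]|.+1.
  by rewrite eX (cardsD1 x [set z in ~: cset v N | ~~ G w z]) inE in_setC xo gwx.
have wy : w != y by apply: contraTneq gwy => ->; rewrite adjxx.
apply: (IH (exchange v y x) c').
- by rewrite -[_ \in _]negbK out' negb_and negb_or !negbK wC wy orbT.
- by move: le; rewrite cX.
move=> z zo gwz.
have [zx zo' zy] : [/\ z != x, z \notin cset v N & ~~ G z y].
  move: zo; rewrite out' => /andP[-> /orP[zo|/eqP e]]; last by rewrite e gwy in gwz.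
  by split=> //; rewrite ey; apply: (nbrs_nonconsec c xo zo g1).
(* The exchange costs [z] at most the one candidate [y], and the number of non-neighbours also drops
   by one. *)
have := hx z zo' gwz; rewrite cX => h.
rewrite -ltnS; apply: leq_trans h _.
rewrite (cardsD1 y) -add1n; apply: leq_add; first by case: (_ \in _).
apply: subset_leq_card; apply/subsetP => a.
rewrite !inE => /andP[ay /and3P[aC gwa /existsP[j /and3P[/eqP ea ga gb]]]].
rewrite gwa /=; apply/andP; split.
  rewrite -[_ \in seg _ _ _](in_set (fun a => a \in seg _ _ _)) -[_ \in _]negbK out' negb_and negb_or !negbK.
  by rewrite inE aC ay orbT.
apply/existsP; exists j; rewrite !exchE ?ea ?eqxx ?ga ?gb //; try by rewrite -ea.
- by apply: contraTneq gb => ->.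
- by apply: contraTneq ga => ->.
Qed.

(** * Averaging non-neighbours over the attached cycle vertices *)

Section Fixed.
Variables (v : nat -> T) (N : nat).
Hypothesis c : lcyc G v N.
Hypothesis cmax : forall v', lcyc G v' N -> outdeg v' N <= outdeg v N.

Let B := bset v N.
Let X := ~: cset v N.
Let U k := [exists b in B, G b (v k)].
Let u := \sum_(k < N) (U k : nat).
Let f k := #|[set b in B | ~~ G (v k) b]|.

Let UP k b : b \in B -> G b (v k) -> U k.
Proof. by move=> bB g; apply/exists_inP; exists b. Qed.

Let U_non k : U k -> ~~ U k.+1.
Proof.
case/exists_inP=> b bB g; apply/negP => /exists_inP[b' bB' g'].
by have := bset_nonconsec c bB bB' g; rewrite g'.
Qed.

Let U_per k : U (k + N) = U k. Proof. by rewrite /U (lcP c). Qed.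

Let u_shift m : \sum_(k < N) (U (k + m) : nat) = u.
Proof. by apply: (sum_shift (f := fun k => (U k : nat))) => k; rewrite U_per. Qed.

Let u2 : 2 * u <= N.
Proof.
have : \sum_(k < N) ((U k : nat) + U (k + 1)) <= \sum_(k < N) 1.
  by apply: leq_sum => k _; rewrite addn1; have := @U_non k; case: (U k) => [/(_ isT)/negPf->|_] //; case: (U _).
by rewrite big_split /= u_shift sum_const1 -/u; lia.
Qed.

Let w := \sum_(k < N) (U k && U (k + 2) : nat).

(** As [U] has no consecutive members, three consecutive vertices contain at most one of them, up to
    the pairs at distance two counted by [w]. *)
Let u3 : 3 * u <= N + w.
Proof.
have : \sum_(k < N) ((U k : nat) + U (k + 1) + U (k + 2)) <= \sum_(k < N) (1 + (U k && U (k + 2))).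
  apply: leq_sum => k _; rewrite addn1 addn2; have := @U_non k.+1; have := @U_non k.
  case: (U k) => [/(_ isT)/negPf-> _|_]; first by case: (U _).
  by case: (U k.+1) => [/(_ isT)/negPf->|_] //; case: (U _).
by rewrite !big_split /= !u_shift sum_const1 -/u -/w; lia.
Qed.

Let degB b : b \in B -> deg G b = \sum_(k < N) (G b (v k) : nat).
Proof. by move=> bB; apply: (bset_deg c bB). Qed.

Let deg_u b : b \in B -> deg G b <= u.
Proof.
move=> bB; rewrite (degB bB); apply: leq_sum => k _.
by case g: (G b (v k)) => //; rewrite (UP bB g).
Qed.

Let XB x : x \in X -> x \in B. Proof. by rewrite in_setU => ->. Qed.

Let cardB : #|B| <= #|X| + u.
Proof.
apply: leq_trans (leq_card_setU _ _) _; rewrite leq_add2l.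
have -> : u = #|[set k : 'I_N | U k]|.
  rewrite /u -sum1_card big_mkcond /= [RHS]big_mkcond /=.
  by apply: eq_bigr => k _; rewrite inE; case: (U k).
apply: leq_trans (leq_imset_card (fun k : 'I_N => v k.+1) _).
apply: subset_leq_card; apply/subsetP => y /zsetP[x [k [kN xo -> g1 _]]].
apply/imsetP; exists (Ordinal kN) => //; rewrite inE; apply: (UP (b := x)) => //.
by apply: XB; rewrite in_setC.
Qed.

Let weighted (P : nat -> bool) : \sum_(k < N) P k * f k =
  \sum_(b in B) \sum_(k < N) (P k && ~~ G b (v k) : nat).
Proof.
rewrite exchange_big /=; apply: eq_bigr => k _.
rewrite /f -sum1_card big_distrr /= big_mkcond [RHS]big_mkcond /=.
apply: eq_bigr => b _; rewrite inE adjC; case: (b \in B) => //=.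
by case: (P k); case: (G b _).
Qed.

Let missing b : b \in B -> \sum_(k < N) (U k && ~~ G b (v k) : nat) + deg G b = u.
Proof.
move=> bB; rewrite (degB bB) -big_split /=; apply: eq_bigr => k _.
by case g: (G b (v k)); rewrite ?(UP bB g) // andbT addn0.
Qed.

(** Each member of [U] missed by [x] spoils at most two of the [w] pairs, so by [u3] at least 2d(x)
    + u - N vertices can be exchanged with [x]. Those not adjacent to [v k] are themselves counted
    in [f k]; the others are numerous enough for [greedy]. *)
Let finish k : (forall x, x \in X -> ~~ G (v k) x -> f k + N <= u + 2 * deg G x) -> False.
Proof.
move=> h; apply: (greedy c (mem_cset c k) (leqnn _)) => x xo gx.
have xX : x \in X by rewrite in_setC.
have {}h := h x xX gx.
set S := [set y in cset v N | _ & _].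
pose S0 := [set y | [exists j : 'I_N, [&& y == v j.+1, G x (v j) & G x (v j.+2)]]].
have S0z : S0 \subset zset v N.
  apply/subsetP => y; rewrite inE => /existsP[j /and3P[/eqP-> g1 g2]].
  by apply/zsetP; exists x, j.
have cz : w <= #|S0| + 2 * (u - deg G x).
  have e1 : \sum_(j < N) (G x (v j) && G x (v (j + 2)) : nat) <= #|S0|.
    have inj : {in [set j : 'I_N | G x (v j) && G x (v (j + 2))] &, injective (fun j : 'I_N => v j.+1)}.
      move=> i j _ _ /(lcI c)/eqP; rewrite -[i.+1]addn1 -[j.+1]addn1 eqn_modDr !modn_small // => /eqP.
      exact: val_inj.
    apply: leq_trans (_ : _ <= #|[set j : 'I_N | G x (v j) && G x (v (j + 2))]|) _.
      rewrite -sum1_card [X in _ <= X]big_mkcond /=; apply: leq_sum => j _.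
      by rewrite inE; case: (_ && _).
    rewrite -(card_in_imset inj); apply: subset_leq_card; apply/subsetP => y /imsetP[j].
    by rewrite !inE addn2 => /andP[g1 g2] ->; apply/existsP; exists j; rewrite eqxx g1 g2.
  have m1 := missing (XB xX).
  have m2 : \sum_(j < N) (U (j + 2) && ~~ G x (v (j + 2)) : nat) = \sum_(j < N) (U j && ~~ G x (v j) : nat).
    by apply: (sum_shift (f := fun j => (U j && ~~ G x (v j) : nat))) => j; rewrite U_per (lcP c).
  have : w <= \sum_(j < N) ((G x (v j) && G x (v (j + 2))) + (U j && ~~ G x (v j)) +
          (U (j + 2) && ~~ G x (v (j + 2)))).
    apply: leq_sum => j _; case: (U j) => //=; case: (U (j + 2)) => //=.
    by case: (G x (v j)); case: (G x _).
  rewrite !big_split /= m2; move: e1 m1; clear.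
  move: (\sum_(j < N) (U j && _)) (\sum_(j < N) (G x (v j) && _)) => a b; lia.
have fk : f k = #|[set x in X | ~~ G (v k) x]| + #|[set y in zset v N | ~~ G (v k) y]|.
  rewrite /f /B /bset -cardsUI [X in _ = _ + X](_ : _ = 0).
    by rewrite addn0; apply: eq_card => y; rewrite !inE andb_orl.
  apply/eqP; rewrite cards_eq0; apply/eqP/setP => y; rewrite in_setI in_set in_setC.
  rewrite [y \in [set _ in zset _ _ | _]]in_set in_set0.
  case yz: (y \in zset v N); last by rewrite andbF.
  by rewrite (zset_cset c yz).
have sS : #|S0| <= #|S| + #|[set y in zset v N | ~~ G (v k) y]|.
  apply: leq_trans (leq_card_setU _ _); apply: subset_leq_card; apply/subsetP => y yS.
  have yz := subsetP S0z _ yS; rewrite in_setU [y \in [set _ in zset _ _ | _]]in_set yz /=.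
  case: (boolP (G (v k) y)) => gy /=; last by rewrite orbT.
  by rewrite orbF /S in_set (zset_cset c yz) gy /=; move: yS; rewrite inE.
have := deg_u (XB xX); have := u3; rewrite -/X.
move: fk sS cz h; clear; move: #|S| #|S0| #|[set x in _ | _]| #|_| => *; lia.
Qed.

Lemma dominating_false : False.
Proof.
have r4 := out_ge4 c; have cN := card_out c; rewrite -/X in r4 cN.
have N2 := lc2 c.
have B2 : 1 < #|B|.
  apply: leq_trans (_ : #|X| <= _); first by apply: leq_trans r4.
  by apply: subset_leq_card; apply/subsetP => x; apply: XB.
have sigB : {in B &, forall b b', b != b' -> 2 * n <= 3 * (deg G b + deg G b') + 3}.
  by move=> b b' bB bB' ne; apply: sig => //; apply: (bset_indep c bB bB').
have sB := indep_deg_sum B2 sigB.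
(* If all outside degrees reach (2n - 3)/6, the mean of [f] over [U] is small enough. Otherwise the
   mean is taken over the neighbours of a vertex [x1] of low degree. *)
case: (boolP [exists x in X, 6 * deg G x + 3 < 2 * n]); last first.
  move=> /exists_inPn hX.
  have hX' x : x \in X -> 2 * n <= 6 * deg G x + 3 by move=> /hX; rewrite -leqNgt.
  have /card_gt0P[x0 x0X] : 0 < #|X| by apply: leq_trans r4.
  have u0 : 2 * n <= 6 * u + 3.
    by apply: leq_trans (hX' _ x0X) _; rewrite leq_add2r leq_mul2l /= deg_u // XB.
  have eM : \sum_(k < N) U k * f k + \sum_(b in B) deg G b = #|B| * u.
    by rewrite weighted -big_split /= -sum_nat_const; apply: eq_bigr => b; apply: missing.
  have up : 0 < u by move: u0 n13; clear; lia.
  have [k [_ le]] := pigeon (P := fun k => (U k : nat)) (erefl u) up (leqnn (\sum_(k < N) U k * f k)).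
  apply: (finish (k := k)) => x xX _; have hx := hX' x xX.
  have uN := u2; have cB := cardB.
  move: (\sum_(k < N) U k * f k) (\sum_(b in B) deg G b) (f k) #|X| #|B| eM le sB hx u0 uN cB up r4 cN n13.
  move: (deg G x) u; clear => d u' M S fk r b eM le sB hx u0 uN cB up r4 cN n13.
  rewrite leqNgt; apply/negP => lt.
  have h1 : 6 * (u' * fk) <= (r + u') * (6 * u' + 3 - 2 * n).
    apply: leq_trans (_ : b * (6 * u' + 3 - 2 * n) <= _); last by rewrite leq_mul2r cB orbT.
    nia.
  have h2 : 3 * u' + 2 * n < 3 * fk + 3 * N + 3 by lia.
  nia.
move=> /exists_inP[x1 x1X lowx].
have x1o : x1 \notin cset v N by rewrite -in_setC.
(* By [cmax]: the vertex [v k.+1] is not adjacent to [x1], hence has larger degree, and exchanging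
   the two would raise the degree sum outside. *)
have zx k : G x1 (v k) -> ~~ G x1 (v (k + 2)).
  move=> g1; rewrite addn2; apply/negP => g2.
  have c' := exchange_lcyc c x1o g1 g2.
  have := cmax c'; rewrite /outdeg.
  have x1y : x1 != v k.+1 by apply: contraNneq x1o => ->; apply: (mem_cset c).
  have ny : ~~ G x1 (v k.+1) by apply: (insert_no c x1o g1).
  have e : ~: cset (exchange v (v k.+1) x1) N = v k.+1 |: X :\ x1.
    apply/setP => z; rewrite in_setC (exch_out z c x1o g1 g2) in_setU1 in_setD1 in_setC.
    case: (z =P v k.+1) => [->|_]; last by rewrite orbF.
    by rewrite orbT eq_sym x1y.
  have yn : v k.+1 \notin X :\ x1 by rewrite in_setD1 in_setC (mem_cset c) andbF.
  rewrite e big_setU1 //= [X in _ <= X](big_setD1 x1) //= leq_add2r.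
  by have := sig x1y ny; lia.
(* The events [U (k + 1)], [G x1 (v k)] and [G x1 (v (k + 2))] exclude each other, by [U_non] and
   [zx]. *)
have d1N : u + 2 * deg G x1 <= N.
  have : \sum_(k < N) ((U (k + 1) : nat) + G x1 (v k) + G x1 (v (k + 2))) <= \sum_(k < N) 1.
    apply: leq_sum => k _; rewrite addn1.
    have h k' : G x1 (v k') -> U k' by apply: UP; apply: XB.
    have := @U_non k; have := @U_non k.+1; have := h k; have := h (k + 2); have := @zx k.
    rewrite addn2; case: (G x1 (v k)) => [/(_ isT)/negPf-> _ /(_ isT)-> _ /(_ isT)/negPf-> //|_].
    case: (G x1 _) => [/(_ isT)-> _|_ _ _ _]; last by case: (U _).
    by case: (U k.+1) => // /(_ isT).
  have e2 : \sum_(k < N) (G x1 (v (k + 2)) : nat) = deg G x1.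
    by rewrite (sumd_shift x1 2 c) (degB (XB x1X)).
  by rewrite !big_split /= u_shift e2 -(degB (XB x1X)) sum_const1; lia.
have d1p : 0 < deg G x1 by apply: ltnW; apply: deg_ge2.
have hd b : b \in B -> b != x1 -> 2 * n <= 3 * (deg G x1 + deg G b) + 3.
  by move=> bB ne; apply: sigB => //; [exact: XB|rewrite eq_sym].
(* The vertex [x1] contributes nothing to [f] on its own neighbours, so only [B :\ x1] counts. *)
have eM : \sum_(k < N) G x1 (v k) * f k + \sum_(b in B :\ x1) deg G b <= #|B :\ x1| * u.
  rewrite (weighted (fun k => G x1 (v k))) (big_setD1 x1) ?XB //= [X in X + _ + _]big1; last first.
    by move=> k _; case: (G x1 _).
  rewrite add0n -big_split /= -sum_nat_const; apply: leq_sum => b /setD1P[_ bB].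
  rewrite -(missing bB) leq_add2r; apply: leq_sum => k _.
  by case g: (G x1 (v k)) => //=; rewrite (UP (XB x1X) g).
have sB1 : #|B :\ x1| * (2 * n) <= 3 * (\sum_(b in B :\ x1) deg G b) + #|B :\ x1| * (3 * deg G x1 + 3).
  have : \sum_(b in B :\ x1) (2 * n) <= \sum_(b in B :\ x1) (3 * deg G b + (3 * deg G x1 + 3)).
    apply: leq_sum => b /setD1P[ne bB]; have := hd b bB ne; lia.
  have -> : \sum_(b in B :\ x1) (3 * deg G b + (3 * deg G x1 + 3)) =
      3 * (\sum_(b in B :\ x1) deg G b) + #|B :\ x1| * (3 * deg G x1 + 3).
    by rewrite big_split sum_nat_const big_distrr.
  by rewrite sum_nat_const.
have eB := cardsD1 x1 B; rewrite XB // in eB.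
have /card_gt0P[b0 b0B] : 0 < #|B :\ x1| by lia.
have u0 : 2 * n <= 3 * deg G x1 + 3 * u + 3.
  move: b0B => /setD1P[ne bB]; have := hd b0 bB ne; have := deg_u bB; clear; lia.
have [k [gk le]] := pigeon (P := fun k => (G x1 (v k) : nat)) (esym (degB (XB x1X))) d1p (leqnn (\sum_(k < N) G x1 (v k) * f k)).
apply: (finish (k := k)) => x xX gx.
have xx1 : x != x1 by apply: contraNneq gx => ->; rewrite adjC; case: (G x1 _) gk.
have hx := hd x (XB xX) xx1.
have uN := u2; have cB := cardB.
move: (\sum_(k < N) G x1 (v k) * f k) (\sum_(b in B :\ x1) deg G b) (f k) #|X| #|B| #|B :\ x1| eM le sB1 hx u0 uN cB eB d1p d1N lowx r4 cN n13.
move: (deg G x1) (deg G x) u; clear => d1 d u' M S fk r b b1 eM le sB hx u0 uN cB eB d1p d1N low r4 cN n13.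
rewrite leqNgt; apply/negP => lt.
have [a ea] : exists a, 3 * u' + 3 * d1 + 3 = 2 * n + a by exists (3 * u' + 3 * d1 + 3 - 2 * n); lia.
have h1 : 3 * (d1 * fk) <= (r - 1 + u') * a.
  apply: leq_trans (_ : b1 * a <= _); last by rewrite leq_mul2r; apply/orP; right; lia.
  nia.
have h2 : 4 * a + 12 * r - 17 <= 3 * fk by lia.
have h3 : r - 1 + u' <= 4 * d1 by lia.
nia.
Qed.

End Fixed.

End Dominating.

(** * Components outside a longest cycle *)

Section Components.
Variables (T : finType) (G : sgraph T).
Implicit Types (x y z : T) (s p q : seq T) (A B S H : {set T}) (v : nat -> T).

Lemma cardsU_disj A B : (forall z, z \in A -> z \notin B) -> #|A :|: B| = #|A| + #|B|.
Proof.
move=> h; rewrite cardsU (_ : A :&: B = set0) ?cards0 ?subn0 //.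
apply/setP => z; rewrite in_setI in_set0; apply/negP => /andP[/h zA zB].
by rewrite zB in zA.
Qed.

Definition compo S x := [set y | connect [rel u w in S | G u w] x y].

Lemma comp_refl S x : x \in compo S x.
Proof. by rewrite inE connect0. Qed.

Lemma comp_sub S x : x \in S -> compo S x \subset S.
Proof.
move=> xS; apply/subsetP => y; rewrite inE => /connectP[p pp ->].
by case/lastP: p pp => // p z; rewrite rcons_path last_rcons => /andP[_ /andP[/andP[]]].
Qed.

Lemma comp_closed S x y z : x \in S -> y \in compo S x -> G y z -> z \in S -> z \in compo S x.
Proof.
move=> xS yC g zS; have yS := subsetP (comp_sub xS) _ yC.
by move: yC; rewrite !inE => /connect_trans; apply; apply: connect1; rewrite /= yS zS.
Qed.

Definition connected_in H := forall y z, y \in H -> z \in H ->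
  exists p, [/\ path G y p, last y p = z, uniq (y :: p) & {subset y :: p <= H}].

Lemma comp_connected S x : x \in S -> connected_in (compo S x).
Proof.
move=> xS y z yC zC.
have sym : connect_sym [rel u w in S | G u w].
  apply: sym_connect_sym => a b /=; rewrite adjC; by case: (a \in S); case: (b \in S).
have : connect [rel u w in S | G u w] y z.
  apply: (@connect_trans _ _ x); last by move: zC; rewrite inE.
  by rewrite sym; move: yC; rewrite inE.
case/connectP=> p0 pp0; case: (shortenP pp0) => p pp up _ ez.
exists p; split=> //; first by apply: sub_path pp => a b /andP[].
move=> a; rewrite inE => /orP[/eqP->//|/splitPr ap].
case: ap pp {up ez} => p1 p2 pp; rewrite inE.
move: yC; rewrite inE => /connect_trans; apply; apply/connectP; exists (rcons p1 a).
  by move: pp; rewrite cat_path rcons_path /= => /andP[-> /andP[->]].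
by rewrite last_rcons.
Qed.

(** A component of the graph minus the cycle, given by its properties so that it carries over to
    shifted and reversed cycles. *)
Record hcomp v N H := Hcomp {
  hc_out : {in H, forall h, h \notin cset v N};
  hc_closed : forall h z, h \in H -> G h z -> z \notin H -> z \in cset v N;
  hc_conn : connected_in H }.

Lemma comp_hcomp v N x : x \notin cset v N -> hcomp v N (compo (~: cset v N) x).
Proof.
move=> xo; have xS : x \in ~: cset v N by rewrite in_setC.
split; last exact: comp_connected.
  by move=> h /(subsetP (comp_sub xS)); rewrite in_setC.
move=> h z hH g; apply: contraR => zo; apply: (comp_closed xS hH g).
by rewrite in_setC.
Qed.

Lemma hcomp_shift v N H m : lcyc G v N -> hcomp v N H -> hcomp (fun k => v (k + m)) N H.
Proof. by move=> c [h1 h2 h3]; split; rewrite ?(cset_shift m c). Qed.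

Lemma hcomp_rev v N H : lcyc G v N -> hcomp v N H -> hcomp (fun k => v (k * N.-1)) N H.
Proof. by move=> c [h1 h2 h3]; split; rewrite ?(cset_rev c). Qed.

Definition att H x := [exists h in H, G h x].

Lemma attP H x : reflect (exists2 h, h \in H & G h x) (att H x).
Proof. exact: exists_inP. Qed.

Definition hpath H a q b := [/\ path G a (rcons q b), uniq q & {subset q <= H}].

Lemma conn_hpath H a b h h' : connected_in H -> h \in H -> h' \in H -> G h a -> G h' b ->
  exists q, [/\ hpath H a q b, 0 < size q & (h != h' -> 1 < size q)].
Proof.
move=> hc hH hH' g g'; have [p [pp lp up sp]] := hc _ _ hH hH'.
exists (h :: p); split=> //.
  by split=> //; rewrite /= adjC g rcons_path pp lp g'.
by case: p lp {pp up sp} => //= -> /eqP.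
Qed.

Lemma hpath_opath v N H a q b : hcomp v N H -> hpath H a q b -> opath G v N a q b.
Proof.
move=> hc [pp uq sq]; rewrite /opath pp uq; apply/allP => x /sq; exact: (hc_out hc).
Qed.

Lemma hpath_rev H a q b : hpath H a q b -> hpath H b (rev q) a.
Proof.
case=> p u s; split; rewrite ?rev_uniq //; last by move=> x; rewrite mem_rev => /s.
have /wk_rev : wk G a (rcons q b) b by rewrite /wk p last_rcons eqxx.
by rewrite belast_rcons rev_cons => /andP[].
Qed.

Section Attached.
Variables (v : nat -> T) (N : nat) (H : {set T}).
Hypothesis c : lcyc G v N.
Hypothesis hc : hcomp v N H.
Local Notation A k := (att H (v k)).

Lemma att_gap k o q : 0 < o -> o < N -> hpath H (v k) q (v (k + o)) -> size q < o.
Proof.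
move=> o0 oN /(hpath_opath hc) qp.
have := @reroute_chord_at _ _ v N (k + o) (N - o) q c.
have -> : N - o + (k + o) = k + N by nlia.
have lt : N - o < N by nlia.
by rewrite (lcP c) => h; have := h lt qp; nlia.
Qed.

Lemma att_nonconsec k : A k -> ~~ A k.+1.
Proof.
case/attP=> h hH g; apply/negP => /attP[h' hH' g'].
have [q [qp q0 _]] := conn_hpath (hc_conn hc) hH hH' g g'.
have N2 := lc2 c; have := @att_gap k 1 q isT (ltnW N2).
by rewrite addn1 => /(_ qp); lia.
Qed.

(** The crossing skips the [o1] vertices after [v k] and the [o2] vertices after [v (k + d)]. Zero
    offsets give the statements about successors of attachments. *)
Lemma att_cross k d o1 o2 q q2 : o1 < d -> d + o2 < N ->
  hpath H (v k) q (v (k + d)) -> opath G v N (v (k + o1).+1) q2 (v (k + d + o2).+1) ->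
  {in q2, forall x, x \notin H} -> size q + size q2 <= o1 + o2.
Proof.
move=> od dN qp q2p dis; have N0 := lcN0 c.
have := @reroute_crossing_at _ _ v N (k + o1).+1 (d.-1 - o1) (d - o1 + o2) (N.-1 - d - o2) (rev q) (rev q2) c.
have -> : d - o1 + o2 + (N.-1 - d - o2) + (k + o1).+1 = k + N by nlia.
have -> : d.-1 - o1 + (k + o1).+1 = k + d by nlia.
have -> : d - o1 + o2 + (k + o1).+1 = (k + d + o2).+1 by nlia.
rewrite (lcP c) !size_rev => h.
have : size q + size q2 <= d - o1 + o2 - (d.-1 - o1) - 1 + (N.-1 - (d - o1 + o2 + (N.-1 - d - o2))); last by nlia.
apply: h; [nlia|nlia| | |].
- exact: opath_rev (hpath_opath hc qp).
- exact: opath_rev q2p.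
case: qp => _ _ qH x; rewrite !mem_rev => /qH xH; apply/negP => /dis; by rewrite xH.
Qed.

Lemma att_ne k l : A k -> A l -> v k != v l ->
  exists2 d, 0 < d < N & forall m, v (l + m) = v (k + d + m).
Proof.
move=> _ _ ne; have [d dN e] := pos_from k l c; exists d => [|m]; last by rewrite e [d + k]addnC.
rewrite dN andbT lt0n; apply: contraNneq ne => d0; have := e 0.
by rewrite d0 !addn0 add0n => ->.
Qed.

Lemma succ_nonadj k l : A k -> A l -> v k != v l -> ~~ G (v k.+1) (v l.+1).
Proof.
move=> Ak Al ne; have [d /andP[d0 dN] e] := att_ne Ak Al ne.
case/attP: Ak => h hH g; case/attP: Al => h' hH' g'; apply/negP => g1.
have [q [qp q0 _]] := conn_hpath (hc_conn hc) hH hH' g g'.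
have e0 := e 0; have e1 := e 1; rewrite !addn0 !addn1 in e0 e1; rewrite e0 in qp.
have := @att_cross k d 0 0 q [::] d0; rewrite !addn0 => /(_ dN qp).
rewrite -e1 => /(_ (opath_edge _ _ g1)) h0.
have : size q <= 0; last by nlia.
by apply: h0.
Qed.

Lemma succ_out k l x : A k -> A l -> v k != v l -> x \notin cset v N -> x \notin H ->
  G x (v k.+1) -> ~~ G x (v l.+1).
Proof.
move=> Ak Al ne xo xH gk; have [d /andP[d0 dN] e] := att_ne Ak Al ne.
case/attP: Ak => h hH g; case/attP: Al => h' hH' g'; apply/negP => gl.
have [q [qp q0 _]] := conn_hpath (hc_conn hc) hH hH' g g'.
have e0 := e 0; have e1 := e 1; rewrite !addn0 !addn1 in e0 e1; rewrite e0 in qp.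
have := @att_cross k d 0 0 q [:: x] d0; rewrite !addn0 -e1 => /(_ dN qp) h0.
have : size q + 1 <= 0; last by nlia.
apply: h0; first by apply: opath_vertex; rewrite // adjC.
by move=> z; rewrite inE => /eqP->.
Qed.

Lemma att_succ_H k h : A k -> h \in H -> ~~ G h (v k.+1).
Proof. by move=> Ak hH; apply: contra (att_nonconsec Ak) => g; apply/attP; exists h. Qed.

Definition natt := \sum_(k < N) (A k : nat).

Lemma A_per k : A (k + N) = A k. Proof. by rewrite (lcP c). Qed.

Lemma natt_shift m : \sum_(k < N) (A (k + m) : nat) = natt.
Proof. by apply: (sum_shift (f := fun k => (A k : nat))) => k; rewrite A_per. Qed.

Lemma deg_H h : h \in H -> deg G h = #|[set z in H | G h z]| + sumd G v N h.
Proof.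
move=> hH; rewrite (deg_split G h H); congr (_ + _); rewrite (sumd_card h c).
apply: eq_card => z; rewrite in_set [in RHS]in_set in_setC; case g: (G h z); rewrite ?andbF ?andbT //.
apply/idP/idP => [zH|zC]; first exact: (hc_closed hc hH g zH).
by apply/negP => /(hc_out hc); rewrite zC.
Qed.

Lemma sumd_att h : h \in H -> sumd G v N h <= natt.
Proof.
move=> hH; apply: leq_sum => k _; case g: (G h (v k)) => //.
by rewrite (_ : A k) //; apply/attP; exists h.
Qed.

Lemma deg_H_ub h : h \in H -> deg G h < #|H| + natt.
Proof.
move=> hH; rewrite (deg_H hH); rewrite -addSn; apply: leq_add (sumd_att hH).
rewrite [X in _ < X](cardsD1 h) hH add1n ltnS; apply: subset_leq_card; apply/subsetP => z.
by rewrite !inE; case: eqP => [->|]; rewrite ?adjxx ?andbF //= => _ /andP[].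
Qed.

End Attached.

End Components.

(** * Degree sum of the successors of two attachments *)

Section Cross.
Variables (T : finType) (G : sgraph T).
Implicit Types (x y z : T) (s p q : seq T) (A B S : {set T}).
Variables (v : nat -> T) (N m : nat) (H : {set T}) (q : seq T).
Hypothesis c : lcyc G v N.
Hypothesis hc : hcomp G v N H.
Hypothesis m0 : 0 < m.
Hypothesis mN : m < N.
Hypothesis qp : hpath G H (v N.-1) q (v m.-1).
Local Notation A k := (att G H (v k)).
Hypothesis Ai : A N.-1.
Hypothesis Aj : A m.-1.

Let vN : v N = v 0. Proof. by have := lcP c 0; rewrite add0n. Qed.

Let vij : v N.-1 != v m.-1.
Proof. by apply/eqP => /(v_inj c); have := lc2 c; nlia. Qed.

Lemma cross_nonadj : ~~ G (v 0) (v m).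
Proof.
have := succ_nonadj c hc Ai Aj vij; rewrite !prednK ?vN //.
by have := lc2 c; nlia.
Qed.

(** Otherwise [reroute_parallel] inserts [q] at the price of fewer than [size q] vertices. *)
Lemma crossA (z z' : nat) : z < z' -> z' < m -> z' - z <= size q -> G (v 0) (v z') -> ~~ G (v m) (v z).
Proof.
move=> zz zm sq g; apply/negP => g'.
have := reroute_parallel c zz zm mN (hpath_opath hc qp); rewrite adjC g adjC g' => /(_ isT isT).
nlia.
Qed.

Lemma crossB (z z' : nat) : m <= z -> z < z' -> z' < N -> z' - z <= size q -> G (v m) (v z') -> ~~ G (v 0) (v z).
Proof.
move=> mz zz zN sq g; apply/negP => g'.
have c' := lcyc_shift m c.
have o : opath G (fun k => v (k + m)) N (v (N.-1 + m)) (rev q) (v ((N - m).-1 + m)).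
  rewrite (opath_shift _ _ _ _ c).
  have -> : N.-1 + m = m.-1 + N by nlia.
  have -> : (N - m).-1 + m = N.-1 by nlia.
  by rewrite (lcP c); apply: opath_rev (hpath_opath hc qp).
have := @reroute_parallel _ _ _ _ c' (N - m) (z - m) (z' - m) (rev q) _ _ _ o _ _.
rewrite size_rev !subnK ?(ltnW mN) ?(leq_trans mz (ltnW zz)) // vN => h.
have : size q <= z' - m - (z - m) - 1 by apply: h; rewrite ?add0n 1?adjC //; nlia.
nlia.
Qed.

(* Charges each edge from [v 0] or [v m] to the cycle to one of the two cycle
   edges at its other end, such that two charges to the same cycle edge would
   yield a longer cycle. *)
Definition crossF k := if k < m then G (v 0) (v k.+1) + G (v m) (v k) else G (v m) (v k.+1) + G (v 0) (v k).

Hypothesis q0 : 0 < size q.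

Lemma crossF_le k : k < N -> crossF k <= 1.
Proof.
move=> kN; rewrite /crossF; case: ltnP => km.
  case g: (G (v 0) (v k.+1)); last by case: (G _ _).
  case: (ltngtP k.+1 m) => [lt||e]; [|nlia|by move: g cross_nonadj; rewrite e => ->].
  by rewrite (negPf (crossA (ltnSn k) lt _ g)) //; nlia.
case g: (G (v m) (v k.+1)); last by case: (G _ _).
case: (ltngtP k.+1 N) => [lt||e]; [|nlia|].
  by rewrite (negPf (crossB km (ltnSn k) lt _ g)) //; nlia.
by move: g cross_nonadj; rewrite e vN adjC => ->.
Qed.

Let sum_tele (g : nat -> nat) a b : a <= b -> g a = g b -> \sum_(a <= k < b) g k.+1 = \sum_(a <= k < b) g k.
Proof.
move=> ab e; case: (ltngtP a b) ab => // [lt _|<- _]; last by rewrite !big_geq.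
case: b lt e => // b; rewrite ltnS => lt e.
by rewrite big_nat_recr // [RHS]big_nat_recl //= e addnC.
Qed.

(** On each of the two arcs the shift by one changes no sum, as [v 0] and [v m] are adjacent neither
    to themselves nor to each other. *)
Lemma sum_crossF : \sum_(k < N) crossF k = sumd G v N (v 0) + sumd G v N (v m).
Proof.
have nz := cross_nonadj.
rewrite /sumd -!(big_mkord xpredT (fun k => (G _ (v k) : nat))) -(big_mkord xpredT crossF).
rewrite !(@big_cat_nat _ _ _ m 0 N) //=; try exact: ltnW.
have -> : \sum_(0 <= i < m) crossF i = \sum_(0 <= i < m) G (v 0) (v i.+1) + \sum_(0 <= i < m) G (v m) (v i).
  by rewrite -big_split /=; apply: eq_big_nat => i /andP[_ im]; rewrite /crossF im.
have -> : \sum_(m <= i < N) crossF i = \sum_(m <= i < N) G (v m) (v i.+1) + \sum_(m <= i < N) G (v 0) (v i).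
  by rewrite -big_split /=; apply: eq_big_nat => i /andP[im _]; rewrite /crossF ltnNge im.
rewrite (sum_tele (g := fun i => (G (v 0) (v i) : nat))) ?adjxx ?(negPf nz) //.
rewrite (sum_tele (g := fun i => (G (v m) (v i) : nat))) ?adjxx ?vN ?[G (v m) (v 0)]adjC ?(negPf nz) //; last exact: ltnW.
nlia.
Qed.

Let in_setI1' x z : (z \in [set z in ~: cset v N | G x z]) = (z \notin cset v N) && G x z.
Proof. by rewrite in_set in_setC. Qed.

(** The outside neighbours of [v 0], those of [v m], the set [H] and the cycle are pairwise
    disjoint. *)
Lemma cross_out : #|[set z in ~: cset v N | G (v 0) z]| + #|[set z in ~: cset v N | G (v m) z]| + #|H| + N <= #|T|.
Proof.
have e1 : v N.-1.+1 = v 0 by rewrite prednK ?vN //; nlia.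
have e2 : v m.-1.+1 = v m by rewrite prednK.
rewrite -cardsU_disj; last first.
  move=> z; rewrite !in_setI1' => /andP[zo g]; rewrite negb_and; apply/orP; right.
  apply/negP => g'; case: (boolP (z \in H)) => zH; first by have := att_succ_H c hc Ai zH; rewrite e1 adjC g.
  by have := succ_out c hc Ai Aj vij zo zH; rewrite e1 e2 adjC g adjC g' => /(_ isT).
rewrite -[X in _ + X <= _](card_cset c) -addnA -cardsU_disj; last by move=> z; apply: (hc_out hc).
rewrite -cardsU_disj ?max_card // => z.
rewrite in_setU !in_setI1' in_setU => zz.
have zo : z \notin cset v N by case/orP: zz => /andP[].
rewrite (negPf zo) orbF; apply/negP => zH; case/orP: zz => /andP[_ g].
  by have := att_succ_H c hc Ai zH; rewrite e1 adjC g.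
by have := att_succ_H c hc Aj zH; rewrite e2 adjC g.
Qed.

Lemma cross_deg n : #|T| = n -> deg G (v 0) + deg G (v m) + #|H| + N <= n + \sum_(k < N) crossF k.
Proof.
move=> <-; have := cross_out; rewrite sum_crossF !(deg_split G _ (cset v N)) -!(sumd_card _ c).
move: (sumd G v N (v 0)) (sumd G v N (v m)) #|[set z in ~: _ | G (v 0) z]| #|[set z in ~: _ | G (v m) z]|.
by clear => a b e f; nlia.
Qed.

(** Each attachment besides the two given ones leaves a cycle edge without charge, at its own index
    or at the next. The second alternative compares vertices at distance two, hence the two vertices
    in [q]. *)
Lemma cross_save : 1 < size q -> \sum_(k < N) crossF k + natt G v N H <= N + 2.
Proof.
move=> q1.
pose A' k := [&& A k, k != N.-1 & k != m.-1].
have AF k : k < N -> A' k -> crossF k = 0 \/ (crossF k = 1 /\ crossF k.+1 = 0).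
  move=> kN /and3P[Ak k1 k2].
  have n1 : ~~ G (v k.+1) (v 0).
    have := succ_nonadj c hc Ak Ai _; rewrite prednK ?vN //; last by nlia.
    by apply; apply: contraNneq k1 => /(v_inj c kN) ->; rewrite ?prednK //; nlia.
  have n2 : ~~ G (v k.+1) (v m).
    have := succ_nonadj c hc Ak Aj _; rewrite prednK //.
    by apply; apply: contraNneq k2 => /(v_inj c kN) ->; rewrite ?prednK //; nlia.
  rewrite adjC in n1; rewrite adjC in n2.
  rewrite /crossF; case: (ltnP k m) => km.
    have km1 : k.+1 < m by move/eqP: k2; nlia.
    rewrite km1 (negPf n1) (negPf n2) addn0 add0n.
    case g: (G (v m) (v k)); last by left.
    right; split=> //.
    case g2: (G (v 0) (v k.+2)) => //.
    case: (ltngtP k.+2 m) => [lt||e]; [|nlia|by move: g2 cross_nonadj; rewrite e => ->].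
    by have := crossA (ltnW (ltnSn k.+1)) lt _ g2; rewrite g => h; have := h (ltac:(nlia)).
  have -> : (k.+1 < m) = false by nlia.
  rewrite (negPf n1) (negPf n2) addn0 add0n.
  case g: (G (v 0) (v k)); last by left.
  right; split=> //.
  case g2: (G (v m) (v k.+2)) => //.
  have kN1 : k.+1 < N by move/eqP: k1; nlia.
  case: (ltngtP k.+2 N) => [lt||e]; [|nlia|by move: g2 cross_nonadj; rewrite e vN adjC => ->].
  by have := crossB km (ltnW (ltnSn k.+1)) lt _ g2; rewrite g => h; have := h (ltac:(nlia)).
(* [phi] marks the attachments whose saving occurs only at the next index, and [psi] marks that
   index. *)
pose phi k := A' k && (crossF k == 1).
pose psi k := if k is k'.+1 then phi k' else false.
have le : \sum_(k < N) (crossF k + A' k + psi k) <= \sum_(k < N) (1 + phi k).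
  apply: leq_sum => k _; have kN := ltn_ord k.
  have := crossF_le kN; rewrite /phi; case AK: (A' k) => /=.
    (* Attachments are never consecutive, so no saving is claimed twice. *)
    have -> : psi k = false.
      case: (nat_of_ord k) AK => // k' /and3P[Ak _ _]; rewrite /psi /phi; case Ak': (A' k') => //.
      by move: Ak' Ak => /and3P[Ak' _ _]; rewrite (negPf (att_nonconsec c hc Ak')).
    by case: (crossF k) => [|[|]].
  case: (nat_of_ord k) kN => [|k'] kN; rewrite /psi /=; first by lia.
  rewrite /phi; case AK': (A' k') => /=; last by lia.
  by case: (AF k' (ltnW kN) AK') => [->|[-> ->]]; lia.
rewrite !big_split /= sum_const1 in le.
have e1 : \sum_(k < N) psi k = \sum_(k < N) phi k.
  case: N (lcN0 c) @A' @phi @psi mN {AF le} => // N' _ A' phi psi _.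
  rewrite big_ord_recl [RHS]big_ord_recr /= add0n [X in _ + X](_ : _ = 0) ?addn0 //.
  by rewrite /phi /A' /= eqxx andbF.
have e2 : natt G v N H <= \sum_(k < N) (A' k) + 2.
  have : natt G v N H <= \sum_(k < N) (A' k + (k == N.-1 :> nat) + (k == m.-1 :> nat)).
    apply: leq_sum => k _; rewrite /A'; case: (A k) => //=.
    by case: (nat_of_ord k == N.-1); case: (nat_of_ord k == m.-1).
  rewrite !big_split /=.
  have s1 : \sum_(k < N) (k == N.-1 :> nat) <= 1.
    by apply: (sum_le1 (P := fun j => j == N.-1)) => i j _ _ /eqP-> /eqP->.
  have s2 : \sum_(k < N) (k == m.-1 :> nat) <= 1.
    by apply: (sum_le1 (P := fun j => j == m.-1)) => i j _ _ /eqP-> /eqP->.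
  move: s1 s2; clear; move: (\sum_(k < N) (k == N.-1 :> nat)) (\sum_(k < N) (k == m.-1 :> nat)) (natt _ _ _ _) (\sum_(k < N) A' k).
  by move=> a b d e; nlia.
move: le e2; rewrite e1; clear.
move: (\sum_(k < N) crossF k) (natt _ _ _ _) (\sum_(k < N) A' k) (\sum_(k < N) phi k) => a b d e; nlia.
Qed.

End Cross.

(** * Longest paths through a connected set *)

Section MaxPath.
Variables (T : finType) (G : sgraph T).
Implicit Types (x y z : T) (s p q o : seq T) (A B S : {set T}).

Definition degin (F : {set T}) y := #|[set z in F | G y z]|.

Section Path.
Variables (K : {set T}) (a b : T) (q : seq T).
Hypothesis aK : a \notin K.
Hypothesis bK : b \notin K.
Hypothesis ab : a != b.
Hypothesis qp : hpath G K a q b.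
Hypothesis qmax : forall q', hpath G K a q' b -> size q' <= size q.

Let L := size q.
(** The default value [b] serves as the last vertex: index [size q + 1] is the end of the path. *)
Definition pw i := nth b (a :: q) i.
Local Notation w := pw.
Let O := K :\: [set x in q].

Let w0 : w 0 = a. Proof. by []. Qed.
Let wL : w L.+1 = b. Proof. by rewrite /w nth_default. Qed.
Let wS i : w i.+1 = nth b q i. Proof. by []. Qed.

Let wq i : 0 < i -> i <= L -> w i \in q.
Proof. by case: i => // i _ iL; rewrite wS mem_nth. Qed.

Let wG i : i <= L -> G (w i) (w i.+1).
Proof.
case: qp => pp _ _ iL; have /(pathP b)/(_ i) := pp; rewrite size_rcons ltnS => /(_ iL).
have e j : nth b (rcons q b) j = nth b q j.
  by rewrite nth_rcons; case: ltngtP => // [lt|->]; rewrite nth_default // ltnW.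
by rewrite e; case: i {iL} => [|i] //=; rewrite e.
Qed.

Let wK i : 0 < i -> i <= L -> w i \in K.
Proof. by move=> i0 iL; case: qp => _ _; apply; apply: wq. Qed.

Let w_inj i j : i <= L.+1 -> j <= L.+1 -> w i = w j -> i = j.
Proof.
have uq : uniq q by case: qp.
wlog ij : i j / i <= j => [h iL jL e|].
  by case: (leqP i j) => ij; [apply: h|apply/esym/h => //; apply: ltnW].
move=> iL jL e; case: (ltngtP i j) ij => // lt _; exfalso.
case: (ltngtP j L.+1) jL => // [jL _|ej _].
  have jK : w j \in q by apply: wq; nlia.
  case: (posnP i) => [i0|i0].
    by move: aK; rewrite -w0 -i0 e => /negP; apply; apply: wK; nlia.
  case: i lt i0 iL e => // i; case: j jL jK => // j jL _ lt _ iL /eqP.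
  by rewrite !wS (nth_uniq b (_ : i < L) (_ : j < L) uq) => [/eqP||]; nlia.
rewrite ej wL in e; case: (posnP i) => [i0|i0]; first by move: ab; rewrite -e i0 w0 eqxx.
by move: bK; rewrite -e => /negP; apply; apply: wK; nlia.
Qed.

Let seg_w i m : i + m <= L.+1 -> wk G (w i) (seg w i.+1 m) (w (i + m)).
Proof.
elim: m i => [|m IH] i im; first by rewrite /wk /= addn0 eqxx.
rewrite segS -cat1s -addSnnS; apply: wk_cat (IH _ _); last by nlia.
by apply/wk1/wG; nlia.
Qed.

Let segr_w i m : i + m <= L.+1 -> wk G (w (i + m)) (rev (seg w i m)) (w i).
Proof.
move=> im; have := wk_rev (seg_w im); congr wk; congr rev.
by elim: m i {im} => // m IH i; rewrite segS /= IH.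
Qed.

(** The analogue of [reroute] for a longest path with fixed ends. *)
Let lin_reroute s ix o : wk G a (rcons s b) b -> perm_eq s (map w ix ++ o) ->
  uniq ix -> {in ix, forall i, 0 < i <= L} -> uniq o -> {subset o <= O} ->
  size ix + size o <= L.
Proof.
move=> ws ps ui ai uo so.
rewrite -(size_map w ix) -size_cat -(perm_size ps); apply: qmax; split.
- by case/andP: ws.
- rewrite (perm_uniq ps) cat_uniq uo andbT map_inj_in_uniq ?ui.
    apply/hasPn => z /so; rewrite !inE => /andP[zq _]; apply: contra zq => /mapP[i /ai /andP[i0 iL] ->].
    exact: wq.
  by move=> i j /ai /andP[_ iL] /ai /andP[_ jL]; apply: w_inj; nlia.
move=> z; rewrite (perm_mem ps) mem_cat => /orP[/mapP[i /ai /andP[i0 iL] ->]|/so].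
  exact: wK.
by rewrite inE => /andP[].
Qed.

Lemma max_gap i j o : i < j -> j <= L.+1 -> hpath G O (w i) o (w j) -> size o < j - i.
Proof.
move=> ij jL [po uo so].
have ws : wk G a (rcons (seg w 1 i ++ o ++ seg w j (L.+1 - j)) b) b.
  rewrite -wL -!cats1 -!catA.
  have -> : seg w j (L.+1 - j) ++ [:: w L.+1] = w j :: seg w j.+1 (L.+1 - j).
    by rewrite -segS segSr subnKC // cats1.
  rewrite -cat_rcons; apply: (@wk_cat _ _ _ _ (w i)); first by rewrite -w0; apply: seg_w; nlia.
  apply: (@wk_cat _ _ _ _ (w j)); first by rewrite /wk po last_rcons eqxx.
  by have := @seg_w j (L.+1 - j); rewrite subnKC // => h; apply: h; nlia.
have ps : perm_eq (seg w 1 i ++ o ++ seg w j (L.+1 - j)) (map w (iota 1 i ++ iota j (L.+1 - j)) ++ o).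
  by rewrite map_cat -!/(seg _ _ _) -catA perm_cat2l perm_catC.
have := lin_reroute ws ps _ _ uo so; rewrite size_cat !size_iota => h.
suff : i + (L.+1 - j) + size o <= L by nlia.
apply: h.
  by rewrite cat_uniq !iota_uniq andbT andTb; apply/hasPn => l; rewrite !mem_iota; nlia.
by move=> l; rewrite mem_cat !mem_iota; nlia.
Qed.

(** Otherwise the path goes to [w i], along [o] to [w j], backwards to [w i.+1] and over the edge to
    [w j.+1]; it keeps all vertices and gains [o]. *)
Lemma max_cross i j o : i < j -> j <= L -> hpath G O (w i) o (w j) -> 0 < size o ->
  ~~ G (w i.+1) (w j.+1).
Proof.
move=> ij jL [po uo so] o0; apply/negP => g.
have es : rcons (seg w 1 i ++ o ++ rev (seg w i.+1 (j - i)) ++ seg w j.+1 (L - j)) b =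
    seg w 1 i ++ (rcons o (w j) ++ (rev (seg w i.+1 (j - i.+1)) ++ ([:: w j.+1] ++ seg w j.+2 (L - j)))).
  have -> : j - i = (j - i.+1).+1 by nlia.
  rewrite segSr rev_rcons; have -> : i.+1 + (j - i.+1) = j by nlia.
  rewrite -wL -!cats1 -!catA; congr (_ ++ (_ ++ (_ :: (_ ++ _)))).
  by rewrite cat1s -segS segSr addSn subnKC // cats1.
have ws : wk G a (rcons (seg w 1 i ++ o ++ rev (seg w i.+1 (j - i)) ++ seg w j.+1 (L - j)) b) b.
  rewrite es; apply: (@wk_cat _ _ _ _ (w i)); first by rewrite -w0; apply: seg_w; nlia.
  apply: (@wk_cat _ _ _ _ (w j)); first by rewrite /wk po last_rcons eqxx.
  apply: (@wk_cat _ _ _ _ (w i.+1)).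
    by have := @segr_w i.+1 (j - i.+1); rewrite subnKC // => h; apply: h; nlia.
  apply: (wk_cat (wk1 g)); rewrite -wL.
  by have := @seg_w j.+1 (L - j); rewrite addSn subnKC // => h; apply: h.
have ps : perm_eq (seg w 1 i ++ o ++ rev (seg w i.+1 (j - i)) ++ seg w j.+1 (L - j))
    (map w (iota 1 i ++ iota i.+1 (j - i) ++ iota j.+1 (L - j)) ++ o).
  apply/permP => P; rewrite !map_cat -!/(seg _ _ _) !count_cat count_rev.
  by move: (count P _) (count P _) (count P _) (count P _); clear => x y z t; nlia.
have := lin_reroute ws ps _ _ uo so; rewrite !size_cat !size_iota => h.
suff : i + (j - i + (L - j)) + size o <= L by nlia.
apply: h.
  by rewrite !cat_uniq !iota_uniq !andbT !andTb; apply/andP; split; apply/hasPn => l; rewrite ?mem_cat !mem_iota; nlia.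
by move=> l; rewrite !mem_cat !mem_iota; nlia.
Qed.

Section Rest.
Variable x0 : T.
Hypothesis x0O : x0 \in O.
Let Q := compo G O x0.
Local Notation B i := (att G Q (w i)).
Let Qc : connected_in G Q. Proof. exact: comp_connected. Qed.
Let QO : {subset Q <= O}. Proof. exact/subsetP/comp_sub. Qed.

Let hpathQ y s z : hpath G Q y s z -> hpath G O y s z.
Proof. by case=> h1 h2 h3; split=> // t /h3 /QO. Qed.

Lemma rest_nonconsec i : i <= L -> B i -> ~~ B i.+1.
Proof.
move=> iL /attP[h hQ g]; apply/negP => /attP[h' hQ' g'].
have [s [sp s0 _]] := conn_hpath Qc hQ hQ' g g'.
by have := max_gap (ltnSn i) _ (hpathQ sp); rewrite ltnS => /(_ iL); nlia.
Qed.

Lemma rest_succ i j : i <= L -> j <= L -> i != j -> B i -> B j -> ~~ G (w i.+1) (w j.+1).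
Proof.
wlog ij : i j / i < j => [h iL jL ne Bi Bj|].
  by case: (ltngtP i j) ne => // lt _; [|rewrite adjC]; apply: h; rewrite ?(gtn_eqF lt) // 1?eq_sym ?(gtn_eqF lt).
move=> iL jL _ /attP[h hQ g] /attP[h' hQ' g'].
have [s [sp s0 _]] := conn_hpath Qc hQ hQ' g g'.
exact: max_cross ij jL (hpathQ sp) s0.
Qed.

Let F := a |: (b |: K).
Definition natq := \sum_(i < L.+2) (B i : nat).

Definition rest_nbhd x := (Q :\ x) :|: [set w (val i) | i : 'I_L.+2 & B (val i)].

Lemma rest_nbhdP x : x \in Q -> [set z in F | G x z] \subset rest_nbhd x.
Proof.
move=> xQ; apply/subsetP => z; rewrite inE => /andP[zF g]; rewrite in_setU in_setD1.
case: (boolP (z \in Q)) => zQ.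
  by rewrite andbT; apply/orP; left; apply: contraTneq g => ->; rewrite adjxx.
have mk i : i <= L.+1 -> w i = z -> z \in [set w (val i) | i : 'I_L.+2 & B (val i)].
  move=> iL ez; apply/imsetP; exists (Ordinal (iL : i < L.+2)) => //=.
  by rewrite inE /= ez; apply/attP; exists x.
rewrite andbF orFb; move: zF; rewrite !inE => /or3P[/eqP ez|/eqP ez|zK].
- by apply: (mk 0).
- by apply: (mk L.+1); rewrite // wL.
have zq : z \in q.
  apply: contraNT zQ => zq; apply: (comp_closed x0O xQ g).
  by rewrite !inE zq zK.
apply: (mk (index z q).+1); first by rewrite ltnS; apply: ltnW; rewrite /L index_mem.
by rewrite wS nth_index.
Qed.

Lemma card_rest_nbhd x : x \in Q -> #|rest_nbhd x| < #|Q| + natq.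
Proof.
move=> xQ; apply: leq_ltn_trans (leq_card_setU _ _) _.
rewrite [#|Q|](cardsD1 x) xQ add1n addSn ltnS leq_add2l.
apply: leq_trans (leq_imset_card _ _) _.
rewrite /natq -sum1_card big_mkcond /=; apply: leq_sum => i _.
by rewrite inE; case: (att _ _ _).
Qed.

Lemma degin_rest x : x \in Q -> degin F x < #|Q| + natq.
Proof.
by move=> xQ; apply: leq_ltn_trans (card_rest_nbhd xQ); apply/subset_leq_card/rest_nbhdP.
Qed.

(** The equality case of [degin_rest]: the neighbourhood fills its upper bound [rest_nbhd x]. *)
Lemma degin_rest_eq x : x \in Q -> #|Q| + natq <= degin F x + 1 ->
  (forall y, y \in Q -> y != x -> G x y) /\ (forall i, i <= L.+1 -> B i -> G x (w i)).
Proof.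
move=> xQ le; have e : [set z in F | G x z] = rest_nbhd x.
  apply/eqP; rewrite eqEcard (rest_nbhdP xQ) /=.
  by have := card_rest_nbhd xQ; move: le; rewrite /degin addn1 => le lt; rewrite -ltnS (leq_trans lt le).
split=> [y yQ yx|i iL Bi].
  have : y \in rest_nbhd x by rewrite in_setU in_setD1 yx yQ.
  by rewrite -e inE => /andP[].
have : w i \in rest_nbhd x.
  by rewrite in_setU; apply/orP; right; apply/imsetP; exists (Ordinal (iL : i < L.+2)); rewrite ?inE.
by rewrite -e inE => /andP[].
Qed.

(** The successor of an attachment of [Q] misses [Q] and the successors of all attachments. The end
    [b] has no successor on the path, hence the term [B L.+1]. *)
Lemma degin_succ i0 : B i0 -> i0 < L -> degin F (w i0.+1) + #|Q| + natq <= #|K| + 2 + B L.+1.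
Proof.
move=> Bi iL.
pose S := [set w (val i).+1 | i : 'I_L.+1 & B (val i)].
have cS : #|S| + B L.+1 = natq.
  rewrite /natq big_ord_recr /= card_in_imset.
    congr (_ + _); rewrite -sum1_card big_mkcond /=; apply: eq_bigr => i _.
    by rewrite inE; case: (att _ _ _).
  move=> i j _ _ e; apply: val_inj.
  by case: (w_inj (ltn_ord i : (val i).+1 <= L.+1) (ltn_ord j : (val j).+1 <= L.+1) e).
have wF i : i <= L.+1 -> w i \in F.
  rewrite !inE; case: i => [|i] iL'; first by rewrite eqxx.
  move: iL'; rewrite ltnS leq_eqVlt => /orP[/eqP->|lt]; first by rewrite wL eqxx orbT.
  by rewrite wK ?orbT.
have SF : S \subset F.
  by apply/subsetP => z /imsetP[i _ ->]; apply: wF; have := ltn_ord i.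
have QF : Q \subset F.
  by apply/subsetP => z /QO; rewrite !inE => /andP[_ ->]; rewrite !orbT.
have cF : #|F| = #|K| + 2.
  by rewrite !cardsU1 !inE (negPf aK) (negPf bK) (negPf ab) /=; nlia.
have d1 : #|S :|: Q| = #|S| + #|Q|.
  apply: cardsU_disj => z /imsetP[i + ->]; rewrite inE => Bi'; apply/negP => /QO.
  rewrite !inE => /andP[nq wk']; have := ltn_ord i; rewrite ltnS => iL'.
  case: (ltngtP (val i) L) iL' => // [lt|e] _; first by rewrite wq in nq.
  by move: wk'; rewrite e wL (negPf bK).
have d2 : [set z in F | G (w i0.+1) z] :&: (S :|: Q) = set0.
  apply/setP => z; rewrite in_set0 in_setI in_setU inE; apply/negP => /andP[/andP[_ g]] /orP[].
    case/imsetP=> j + ez; rewrite inE => Bj; rewrite ez in g.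
    have jL : val j <= L by have := ltn_ord j.
    case: (altP (i0 =P val j)) => [e|ne]; first by rewrite e adjxx in g.
    by have := rest_succ (ltnW iL) jL ne Bi Bj; rewrite g.
  move=> zQ; have := rest_nonconsec (ltnW iL) Bi => /negP; apply; apply/attP.
  by exists z; rewrite // adjC.
have : #|[set z in F | G (w i0.+1) z] :|: (S :|: Q)| <= #|F|.
  by apply: subset_leq_card; rewrite !subUset SF QF andbT andbT; apply/subsetP => z; rewrite inE => /andP[].
rewrite cardsU d2 cards0 subn0 d1 cF -/(degin F (w i0.+1)) -cS.
move: (degin _ _) #|S| #|Q| #|K| => d1' d2' d3 d4; clear; case: (B _) => /=; nlia.
Qed.

(** Adding [degin_rest] and [degin_succ] cancels [#|Q|] and [natq]. With two attachments, the first
    one has its successor inside [q]. *)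
Lemma rest_sum x i j : x \in Q -> i < j -> j <= L.+1 -> B i -> B j ->
  exists2 u, u \in q & degin F x + degin F u <= #|K| + 1 + B L.+1.
Proof.
move=> xQ ij jL Bi Bj.
have iL : i < L.
  case: (ltngtP i.+1 j) ij => // [lt _|e _]; first by nlia.
  by have := rest_nonconsec (_ : i <= L) Bi; rewrite e Bj => h; have := h ltac:(nlia).
exists (w i.+1); first by apply: wq.
have := degin_rest xQ; have := degin_succ Bi iL.
move: (degin F x) (degin F _) #|Q| #|K| natq (nat_of_bool (B L.+1)) => a1 a2 a3 a4 a5 a6; clear; nlia.
Qed.

End Rest.
End Path.
End MaxPath.

(** * Degree conditions that make longest paths spanning *)

Section Links.
Variables (T : finType) (G : sgraph T).
Implicit Types (x y z : T) (s p q o : seq T) (A B S H K : {set T}) (v : nat -> T).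

Lemma hpath_size K a q b : hpath G K a q b -> size q <= #|K|.
Proof.
case=> _ uq sq; rewrite -(card_uniqP uq); apply: subset_leq_card; apply/subsetP; exact: sq.
Qed.

Lemma longest_hpath K a b : (exists2 q, hpath G K a q b & 0 < size q) ->
  exists q, [/\ hpath G K a q b, 0 < size q & forall q', hpath G K a q' b -> size q' <= size q].
Proof.
move=> [q0 q0p q00].
pose hp q := [&& path G a (rcons q b), uniq q & all (fun x => x \in K) q].
have hpP q : reflect (hpath G K a q b) (hp q).
  apply: (iffP and3P) => [[h1 h2 /allP h3]|[h1 h2 h3]]; first by split.
  by split=> //; apply/allP.
pose P m := [exists q : m.-tuple T, hp q].
have Pq q : hpath G K a q b -> P (size q).
  by move=> h; apply/existsP; exists (in_tuple q); apply/hpP.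
have ub m : P m -> m <= #|K|.
  by case/existsP=> q /hpP/hpath_size; rewrite size_tuple.
case: (ex_maxnP (ex_intro P _ (Pq _ q0p)) ub) => m /existsP[q /hpP qp] mM.
exists q; split=> //; rewrite size_tuple; last by move=> q' /Pq /mM.
exact: leq_trans q00 (mM _ (Pq _ q0p)).
Qed.

Lemma pw_rev a b q i : i <= (size q).+1 -> pw b a (rev q) i = pw a b q ((size q).+1 - i).
Proof.
rewrite /pw; case: i => [_|i iq]; first by rewrite subn0 /= nth_default.
rewrite subSS /=; move: iq; rewrite ltnS leq_eqVlt => /orP[/eqP ->|lt].
  by rewrite subnn /= nth_default // size_rev.
rewrite nth_rev //.
have -> : size q - i = (size q - i.+1).+1 by nlia.
by rewrite /= (set_nth_default b) //; nlia.
Qed.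

Lemma two_of_sum (P : nat -> bool) m : 1 < \sum_(i < m) (P i : nat) ->
  exists i j, [/\ i < j, j < m, P i & P j].
Proof.
move=> h; have : 1 < #|[set i : 'I_m | P i]|.
  apply: leq_trans h _; rewrite -sum1_card [X in _ <= X]big_mkcond /=; apply: leq_sum => i _.
  by rewrite inE; case: (P i).
case/card_gt1P=> i [j []]; rewrite !inE -val_eqE => Pi Pj; rewrite neq_ltn => /orP[ij|ij].
  by exists i, j; rewrite ij ltn_ord.
by exists j, i; rewrite ij ltn_ord.
Qed.

Section Max.
Variables (K : {set T}) (a b : T) (q : seq T).
Hypothesis aK : a \notin K.
Hypothesis bK : b \notin K.
Hypothesis ab : a != b.
Hypothesis qp : hpath G K a q b.
Hypothesis q0 : 0 < size q.
Hypothesis qmax : forall q', hpath G K a q' b -> size q' <= size q.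
Hypothesis Kc : connected_in G K.
Let O := K :\: [set x in q].
Let F := a |: (b |: K).

Lemma rev_max q' : hpath G K b q' a -> size q' <= size (rev q).
Proof. by move=> /hpath_rev/qmax; rewrite !size_rev. Qed.

Lemma inner_att x : x \in O -> exists2 i, 0 < i <= size q & att G (compo G O x) (pw a b q i).
Proof.
move=> xO; have xK : x \in K by move: xO; rewrite inE => /andP[].
have qK : {subset q <= K} by case: qp.
have [z zq] : exists z, z \in q by case: (q) q0 => // z q' _; exists z; exact: mem_head.
have [p [pp lp _ sp]] := Kc xK (qK z zq).
suff [y yq Ay] : exists2 y, y \in q & att G (compo G O x) y.
  exists (index y q).+1; first by rewrite index_mem.
  by rewrite /pw /= nth_index.
case: (boolP [exists y in q, att G (compo G O x) y]) => [/existsP[y /andP[yq Ay]]|]; first by exists y.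
rewrite negb_exists => /forallP no; exfalso.
have cl p1 x1 : x1 \in compo G O x -> path G x1 p1 -> {subset p1 <= K} -> last x1 p1 \in compo G O x.
  elim: p1 x1 => //= y p1 IH x1 x1Q /andP[g pp1] sp1.
  have yK : y \in K by apply: sp1; exact: mem_head.
  apply: IH => // [|u up]; last by apply: sp1; rewrite inE up orbT.
  apply: (comp_closed xO x1Q g); rewrite !inE yK andbT.
  apply/negP => yq; have /negP := no y; apply; rewrite yq.
  by apply/attP; exists x1.
have := cl p x (comp_refl G O x) pp; rewrite lp => h.
suff /h /(subsetP (comp_sub G xO)) : {subset p <= K} by rewrite !inE zq.
by move=> y yp; apply: sp; rewrite inE yp orbT.
Qed.

End Max.

(** Reading the path from [b] moves the correction term to the end [a]. *)
Lemma rest_sum_rev K a b q x i j : a \notin K -> b \notin K -> a != b ->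
  hpath G K a q b -> (forall q', hpath G K a q' b -> size q' <= size q) ->
  x \in K :\: [set x in q] -> i < j -> j <= (size q).+1 ->
  att G (compo G (K :\: [set x in q]) x) (pw a b q i) ->
  att G (compo G (K :\: [set x in q]) x) (pw a b q j) ->
  exists2 u, u \in q & degin G (a |: (b |: K)) x + degin G (a |: (b |: K)) u <=
    #|K| + 1 + att G (compo G (K :\: [set x in q]) x) (pw a b q 0).
Proof.
move=> aK bK ab qp qmax xO ij jL Bi Bj.
have eO : [set x in rev q] = [set x in q] by apply/setP => z; rewrite !inE mem_rev.
set Q := compo _ _ x in Bi Bj *.
have ba : b != a by rewrite eq_sym.
have rmax := @rev_max _ _ _ _ qmax.
have rxO : x \in K :\: [set x in rev q] by rewrite eO.
have := @rest_sum _ _ K b a (rev q) bK aK ba (hpath_rev qp) rmax x rxO x ((size q).+1 - j) ((size q).+1 - i).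
rewrite eO size_rev -/Q !pw_rev ?leq_subr // !subKn //; try by nlia.
rewrite subnn => /(_ (comp_refl _ _ _)) h.
have {h} [||u' u'q] := h _ _ Bj Bi; [by nlia|by nlia|].
by rewrite setUCA; rewrite mem_rev in u'q; exists u'.
Qed.

(** One direction is free of the correction unless both ends are attached. Then an inner attachment,
    consecutive to neither end, forces [2 < size q]. *)
Lemma hp_main K a b q x i j : a \notin K -> b \notin K -> a != b ->
  hpath G K a q b -> 0 < size q -> (forall q', hpath G K a q' b -> size q' <= size q) ->
  connected_in G K -> x \in K :\: [set x in q] -> i < j -> j <= (size q).+1 ->
  att G (compo G (K :\: [set x in q]) x) (pw a b q i) ->
  att G (compo G (K :\: [set x in q]) x) (pw a b q j) ->
  exists2 u, u \in q & (degin G (a |: (b |: K)) x + degin G (a |: (b |: K)) u <= #|K| + 1)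
    || ((2 < size q) && (degin G (a |: (b |: K)) x + degin G (a |: (b |: K)) u <= #|K| + 2)).
Proof.
move=> aK bK ab qp q0 qmax Kc xO ij jL Bi Bj.
have [u uq] := rest_sum aK bK ab qp qmax xO (comp_refl _ _ _) ij jL Bi Bj.
have [u' u'q] := rest_sum_rev aK bK ab qp qmax xO ij jL Bi Bj.
set Q := compo _ _ x in Bi Bj *.
case Ba : (att G Q (pw a b q 0)); last by rewrite addn0 => h _; exists u' => //; rewrite h.
case Bb : (att G Q (pw a b q (size q).+1)); last by rewrite addn0 => _ h; exists u => //; rewrite h.
move=> _ h; exists u => //.
have [k /andP[k0 kL] Bk] := inner_att qp q0 Kc xO.
have h1 := rest_nonconsec aK bK ab qp qmax xO (leq0n _) Ba.
have h2 := rest_nonconsec aK bK ab qp qmax xO kL Bk.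
have -> : 2 < size q; last by rewrite andTb addn1 addn1 addn2 in h *; rewrite h orbT.
have k1 : k != 1 by apply: contraNneq h1 => <-.
have k3 : k != size q by apply: contraNneq h2 => ->.
by move: k0 kL k1 k3; clear; lia.
Qed.

(** [m] bounds the deficit from the maximal degree [#|K| + 1]. If the path misses [x], the component
    of [x] in the rest either has two attachments, and the degree sum of [hp_main] makes [K] small,
    or at most one, and then nearly all of [K] lies off the path. *)
Lemma link_gen K a b m : a \notin K -> b \notin K -> a != b -> att G K a -> att G K b ->
  connected_in G K ->
  (forall h, h \in K -> #|K| + 1 <= degin G (a |: (b |: K)) h + m) ->
  exists q, [/\ hpath G K a q b, forall q', hpath G K a q' b -> size q' <= size q &
    [|| size q == #|K|, #|K| < 2 * m, (2 < size q) && (#|K| <= 2 * m) | size q < m]].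
Proof.
move=> aK bK ab /attP[h hK ga] /attP[h' hK' gb] Kc dm.
have [|q [qp q0 qmax]] := @longest_hpath K a b.
  by have [q [qp q0 _]] := conn_hpath Kc hK hK' ga gb; exists q.
exists q; split=> //.
have qK : {subset q <= K} by case: qp.
have uq : uniq q by case: qp.
have cO : #|K :\: [set x in q]| + size q = #|K|.
  rewrite cardsD (setIidPr _); last by apply/subsetP => z; rewrite inE => /qK.
  by rewrite cardsE (card_uniqP uq) subnK // (hpath_size qp).
case: (set_0Vmem (K :\: [set x in q])) => [e0|[x xO]].
  by rewrite -cO e0 cards0 eqxx.
have xK : x \in K by move: xO; rewrite inE => /andP[].
have cQ : #|compo G (K :\: [set x in q]) x| <= #|K :\: [set x in q]| by apply/subset_leq_card/comp_sub.
have h1 := degin_rest a b xO (comp_refl G _ x).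
have h2 := dm x xK.
case: (ltnP 1 (natq G K a b q x)) => [gt|le].
  have [i [j [ij jL Bi Bj]]] := @two_of_sum (fun i => att G (compo G (K :\: [set x in q]) x) (pw a b q i)) _ gt.
  have [u uq'] := hp_main aK bK ab qp q0 qmax Kc xO ij jL Bi Bj.
  have := dm u (qK u uq').
  move: h2; move: (degin _ _ _) (degin _ _ _) #|K| (size q) => d1 d2 d3 d4; clear; nlia.
move: q0 h1 h2 cQ cO le; move: (degin _ _ _) #|compo _ _ _| #|_ :\: _| #|K| (natq _ _ _ _ _ _) (size q); clear => *; nlia.
Qed.

End Links.

(** * Gaps between attachments, and missing neighbours *)

Section Gaps.
Variables (T : finType) (G : sgraph T).
Implicit Types (x y z : T) (s p q : seq T) (A B S H K : {set T}).

Lemma window_sum (P : nat -> bool) (w : nat -> nat) N W : (forall k, P (k + N) = P k) ->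
  (forall k, w (k + N) = w k) -> (forall k, w k <= W) ->
  (forall k o, P k -> 0 < o <= w k -> ~~ P (k + o)) -> \sum_(k < N) P k * (w k).+1 <= N.
Proof.
move=> PN wN wW h.
have -> : \sum_(k < N) P k * (w k).+1 = \sum_(o < W.+1) \sum_(k < N) (P k && (o <= w k)).
  rewrite exchange_big /=; apply: eq_bigr => k _.
  case: (P k); last by rewrite big1 // mul0n.
  rewrite mul1n -[LHS](card_ord (w k).+1) -sum1_card.
  rewrite (big_ord_widen W.+1 (fun=> 1)) ?ltnS // big_mkcond /=.
  by apply: eq_bigr => o _; rewrite ltnS; case: leqP.
(* The shift by [W - o] fixes the position [k + W] and asks for the window containing it at offset
   [o]. Windows are disjoint, so at most one offset qualifies. *)
have -> : \sum_(o < W.+1) \sum_(k < N) (P k && (o <= w k)) =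
    \sum_(o < W.+1) \sum_(k < N) (P (k + (W - o)) && (o <= w (k + (W - o)))).
  apply: eq_bigr => o _; rewrite -(sum_shift (f := fun k => (P k && (o <= w k) : nat)) (N := N) (W - o)) //.
  by move=> k; rewrite PN wN.
rewrite exchange_big /= -[X in _ <= X]sum_const1; apply: leq_sum => k _.
apply: (sum_le1 (P := fun o => P (k + (W - o)) && (o <= w (k + (W - o))))) => i j.
wlog ij : i j / i < j => [th iW jW Pi Pj|iW jW /andP[Pi _] /andP[Pj wj]].
  by case: (ltngtP i j) => // lt; [apply: th|apply/esym/th].
have := h _ (j - i) Pj; have -> : k + (W - j) + (j - i) = k + (W - i) by nlia.
by rewrite Pi => th; have := th ltac:(nlia).
Qed.

Section Fixed.
Variables (v : nat -> T) (N : nat) (H : {set T}).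
Hypothesis c : lcyc G v N.
Hypothesis hc : hcomp G v N H.
Local Notation A k := (att G H (v k)).
Local Notation t := (natt G v N H).

(** Of the neighbours of [h], only the other [t - 2] attachments can lie outside this set. *)
Lemma deg_deginH h k l : h \in H -> A k -> A l -> v k != v l ->
  deg G h + 2 <= degin G (v k |: (v l |: H)) h + t.
Proof.
move=> hH Ak Al kl; rewrite (deg_split G h (v k |: (v l |: H))) -/(degin _ _ h) -addnA leq_add2l.
rewrite /natt (sum_cset (att G H) c) [X in _ <= X](cardsD1 (v k)) in_set (mem_cset c) Ak.
rewrite [X in _ <= _ + X](cardsD1 (v l)) in_setD1 in_set (mem_cset c) Al eq_sym kl /= addnC addnA leq_add2l.
apply: subset_leq_card; apply/subsetP => z; rewrite in_set in_setC !in_setU !in_set1 !negb_or.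
move=> /andP[/and3P[zk zl zH] g]; rewrite !in_setD1 zk zl in_set (hc_closed hc hH g zH) /=.
by apply/attP; exists h.
Qed.

(* [m] bounds the number of non-neighbours each vertex of [H] has in [H] and among the attachments. *)
Lemma att_link m k l : A k -> A l -> v k != v l ->
  (forall h, h \in H -> #|H| + t <= deg G h + 1 + m) ->
  exists q, [/\ hpath G H (v k) q (v l), forall q', hpath G H (v k) q' (v l) -> size q' <= size q &
    [|| size q == #|H|, #|H| < 2 * m, (2 < size q) && (#|H| <= 2 * m) | size q < m]].
Proof.
move=> Ak Al kl dm.
have vH i : v i \notin H by apply/negP => /(hc_out hc); rewrite (mem_cset c).
apply: link_gen => //; first exact: (hc_conn hc).
move=> h hH; have := dm h hH; have := deg_deginH hH Ak Al kl.
move: (degin _ _ _) (deg _ _) #|H| t; clear => *; nlia.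
Qed.

Lemma gap_sum (w : nat -> nat) : (forall k, w (k + N) = w k) -> (forall k, A k -> w k < N) ->
  (forall k o, A k -> 0 < o <= w k -> A (k + o) -> exists2 q, hpath G H (v k) q (v (k + o)) & w k <= size q) ->
  \sum_(k < N) A k * (w k).+1 <= N.
Proof.
move=> wN wlt wq.
pose w' k := if A k then w k else 0.
have -> : \sum_(k < N) A k * (w k).+1 = \sum_(k < N) A k * (w' k).+1.
  by apply: eq_bigr => k _; rewrite /w'; case: (A k).
apply: (@window_sum (fun k => A k) w' N N) => [k|k|k|k o Ak]; rewrite /w' ?(lcP c) ?wN ?Ak //.
  by case: ifP => // /wlt/ltnW.
move=> ow; apply/negP => Ao; have [q qp qw] := wq _ _ Ak ow Ao.
have /andP[o0 ow'] := ow.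
by have := att_gap c hc o0 (leq_ltn_trans ow' (wlt _ Ak)) qp; nlia.
Qed.

Lemma gap_const w : 1 < t -> (forall k l, A k -> A l -> v k != v l ->
    exists2 q, hpath G H (v k) q (v l) & w <= size q) -> t * w.+1 <= N.
Proof.
move=> t2 lk.
have kN k : A k -> w < N.
  move=> Ak; case: (boolP [exists l : 'I_N, A l && (v k != v l)]) => [/existsP[l /andP[Al kl]]|].
    have [d /andP[d0 dN] e] := att_ne c Ak Al kl; have e0 := e 0; rewrite !addn0 in e0.
    by have [q] := lk k l Ak Al kl; rewrite e0 => /(att_gap c hc d0 dN); nlia.
  rewrite negb_exists => /forallP al; exfalso.
  have : t <= 1; last by nlia.
  have := @sum_le1 (fun k => A k) N; rewrite -/(natt G v N H); apply=> i j iN jN Ai Aj.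
  have := al (Ordinal iN); have := al (Ordinal jN); rewrite /= Ai Aj /= !negbK => /eqP e1 /eqP e2.
  by apply: (v_inj c iN jN); rewrite -e1 -e2.
have := @gap_sum (fun=> w); rewrite -big_distrl /=; apply=> // k o Ak /andP[o0 ow] Ao.
apply: lk => //; apply: (v_neq k c); rewrite o0; exact: leq_ltn_trans ow (kN k Ak).
Qed.

(** For a vertex of [H], [miss] and [missH] together measure the distance from the maximal degree
    [#|H| + t - 1]. *)
Definition miss x := \sum_(k < N) (A k && ~~ G x (v k) : nat).
Definition missH h := #|[set z in H | (z != h) && ~~ G h z]|.

Lemma deg_miss h : h \in H -> deg G h + miss h + missH h + 1 = #|H| + t.
Proof.
move=> hH; rewrite (deg_H c hc hH).
have -> : t = sumd G v N h + miss h.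
  rewrite /natt -big_split /=; apply: eq_bigr => k _; case g: (G h (v k)) => /=.
    by rewrite andbF addn0 (_ : A k) //; apply/attP; exists h.
  by rewrite andbT.
have -> : #|H| = #|[set z in H | G h z]| + missH h + 1; last by move: #|[set _ in _ | _]| (sumd _ _ _ _) => a b; nlia.
rewrite (cardsD1 h) hH addnC; congr (_ + _).
rewrite -(cardsID [set z | G h z]); congr (_ + _); apply: eq_card => z; rewrite !inE; last by rewrite andbCA andbA [_ && (z \in H)]andbC.
by case: eqP => [->|_] /=; rewrite ?adjxx ?andbF // andbC.
Qed.

Lemma sumd_miss x : sumd G v N x + miss x = t + \sum_(k < N) (G x (v k) && ~~ A k : nat).
Proof.
rewrite /sumd /miss /natt -!big_split /=; apply: eq_bigr => k _.
by case: (A k); case: (G _ _).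
Qed.

Lemma miss0 x k : miss x = 0 -> A k -> G x (v k).
Proof.
move=> m0 Ak; have kN : k %% N < N by rewrite ltn_mod (lcN0 c).
apply/negPn/negP => ng; move/eqP: m0; rewrite /miss (bigD1 (Ordinal kN)) //= !(v_mod c) Ak ng.
by rewrite add1n.
Qed.

End Fixed.
End Gaps.

Section Complete.
Variables (T : finType) (G : sgraph T).
Implicit Types (x y z : T) (s p q : seq T) (A B S H K : {set T}).

Lemma complete_path s x : (forall y z, y \in x :: s -> z \in x :: s -> y != z -> G y z) ->
  uniq (x :: s) -> path G x s.
Proof.
elim: s x => //= y s IH x h /and3P[xn yn us]; rewrite h ?inE ?eqxx ?orbT //=; last first.
  by move: xn; rewrite inE negb_or => /andP[].
apply: IH => [u w us' ws|]; last by rewrite /= yn.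
by apply: h; rewrite inE ?us' ?ws orbT.
Qed.

Lemma complete_hpath H a b h h' : (forall y z, y \in H -> z \in H -> y != z -> G y z) ->
  h \in H -> h' \in H -> h != h' -> G h a -> G h' b ->
  exists2 q, hpath G H a q b & size q = #|H|.
Proof.
move=> cH hH hH' hh ga gb; pose r := enum (H :\ h :\ h').
have rP z : (z \in r) = [&& z != h', z != h & z \in H] by rewrite mem_enum !inE.
have uq : uniq (h :: rcons r h').
  by rewrite /= mem_rcons inE negb_or hh rcons_uniq !rP !eqxx enum_uniq andbF.
have sq : {subset h :: rcons r h' <= H}.
  by move=> z; rewrite inE mem_rcons inE rP => /or3P[/eqP->|/eqP->|/and3P[]].
exists (h :: rcons r h').
  split=> //; rewrite /= adjC ga rcons_path last_rcons gb andbT.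
  by apply: complete_path => // y z /sq yH /sq zH; apply: cH.
rewrite /= size_rcons -cardE [RHS](cardsD1 h) hH (cardsD1 h' (H :\ h)) in_setD1 hH' eq_sym hh.
by rewrite !add1n.
Qed.

Lemma third_att v N H x y : lcyc G v N -> 2 < natt G v N H -> exists m, [/\ att G H (v m), v m != x & v m != y].
Proof.
move=> c t3; rewrite /natt (sum_cset (att G H) c) in t3.
set S := [set _ in _ | _] in t3.
have [z] : exists z, z \in S :\ x :\ y.
  apply/set0Pn; rewrite -card_gt0; have := cardsD1 x S; have := cardsD1 y (S :\ x).
  by case: (_ \in _); case: (_ \in _) => /=; nlia.
rewrite !in_setD1 in_set => /and4P[zy zx /csetP[m _ e] Az].
by exists m; rewrite -e.
Qed.

End Complete.

(** * Arithmetic of the counting arguments *)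

Lemma sum_tight (f : nat -> nat) N : (forall k, k < N -> f k <= 1) -> \sum_(k < N) f k = N ->
  forall k, k < N -> f k = 1.
Proof.
move=> f1 sf k kN; apply/eqP; rewrite eqn_leq f1 //= lt0n; apply/eqP => f0.
have : \sum_(j < N) (f j + (j == k :> nat)) <= N.
  rewrite -[X in _ <= X]sum_const1; apply: leq_sum => j _; case: eqP => [->|_]; first by rewrite f0.
  by rewrite addn0 f1.
rewrite big_split /= sf (bigD1 (Ordinal kN)) //= eqxx; nlia.
Qed.

(** Here [s] and [t] belong to [H], [y] counts the vertices outside the cycle and [H], [d] and [m]
    are the degree and the missed attachments of one of these, [e] is the degree of a vertex of [H],
    and [B] comes from [miss_bound]. It follows that the [y] vertices together miss fewer than [t]
    attachments. *)
Lemma outer_arith n s t N y m B d e : 13 <= n -> s + N + y = n -> 0 < y -> 1 < t -> 1 < s ->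
  t * s.+1 <= N -> d + m <= t + B + 2 -> 3 * t + (2 < s) * t + 2 * B <= N ->
  2 * n <= 3 * (d + e) + 3 -> e + 1 <= s + t -> y * m < t.
Proof.
move=> n13 cn y0 t2 s2 gN b1 b2 b3 ub.
case: (ltnP 2 s) b2 => [s3|s3'] b2; rewrite ?mul1n ?mul0n in b2.
  have : 2 * s.+1 + (t - 2) * 4 <= N.
    by apply: leq_trans gN; rewrite -{2}(subnKC t2) mulnDl leq_add2l leq_mul2l; nlia.
  move=> gN'; have : 4 * y + 6 * m + 4 * (t - 2) <= 10 by nlia.
  by case: m {b1} => [|[|m]]; rewrite ?muln0 ?muln1; nlia.
have es : s = 2 by nlia.
rewrite es in cn gN ub.
have h1 : 6 * m + 4 * y <= 16 by nlia.
have h2 : t = 2 -> 6 * m + 3 * y <= 11 by nlia.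
case: m b1 h1 h2 => [|[|[|m]]] b1 h1 h2; rewrite ?muln0 ?muln1; nlia.
Qed.

(** The same numbers when [e] is one below its maximum. In the second outcome the vertex is adjacent
    to every other cycle vertex, which is refuted separately. *)
Lemma outer_arith1 n s t N y m B d e : 13 <= n -> s + N + y = n -> 0 < y -> 1 < t -> 1 < s ->
  t * s.+1 <= N -> d + m <= t + B + 2 -> 3 * t + (2 < s) * t + 2 * B <= N ->
  2 * n <= 3 * (d + e) + 3 -> e + 2 = s + t -> n <= 3 * (s + t) ->
  (s = 2 /\ y * m + 2 < t) \/ [/\ t = 2, 2 < s, N = 2 * s + 2 & s < d].
Proof.
move=> n13 cn y0 t2 s2 gN b1 b2 b3 ub nle.
case: (ltnP 2 s) b2 => [s3|s3'] b2; rewrite ?mul1n ?mul0n in b2.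
  have : 2 * s.+1 + (t - 2) * 4 <= N.
    by apply: leq_trans gN; rewrite -{2}(subnKC t2) mulnDl leq_add2l leq_mul2l; nlia.
  by move=> gN'; right; split=> //; nlia.
left; have es : s = 2 by nlia.
rewrite es in cn gN ub nle; split=> //.
have h1 : 6 * m + 4 * y + N <= 10 + 3 * t by nlia.
case: m b1 h1 => [|[|m]] b1 h1; rewrite ?muln0 ?muln1; nlia.
Qed.

Lemma count_between a b N : b <= N -> b - a.+1 <= \sum_(k < N) (a < k < b : nat).
Proof.
move=> bN; case: (ltnP a b) => [ab|]; last by rewrite -subn_eq0 => /eqP; nlia.
rewrite -(big_mkord xpredT (fun k => (a < k < b : nat))).
rewrite (big_cat_nat (leq0n a.+1) (leq_trans ab bN)) (big_cat_nat ab bN) /=.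
have -> : \sum_(a.+1 <= i < b) (a < i < b) = \sum_(a.+1 <= i < b) 1.
  by apply: eq_big_nat => i ->.
by rewrite sum_nat_const_nat; nlia.
Qed.

(** Each marked index owns the [g] positions after it; they are disjoint and stay below [M + g]. *)
Lemma spread_sum (P : nat -> bool) M g :
  (forall i j, i < j -> j < M -> P i -> P j -> g <= j - i) -> g * \sum_(i < M) (P i : nat) <= M + g.
Proof.
move=> h; apply: (@leq_trans (\sum_(k < M + g) \sum_(i < M) (P i && (i < k < i + g.+1)))).
  rewrite exchange_big /= big_distrr /=; apply: leq_sum => i _; case: (P i); last by rewrite muln0.
  rewrite muln1; apply: leq_trans (count_between i (_ : i + g.+1 <= M + g)); first by clear; lia.
  by rewrite addnS -addSn leq_add2r.
rewrite -[X in _ <= X]sum_const1; apply: leq_sum => k _.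
apply: (@sum_le1 (fun i => P i && (i < k < i + g.+1))) => i j.
wlog ij : i j / i < j => [th iM jM Pi Pj|iM jM /andP[Pi /andP[ik ki]] /andP[Pj /andP[jk kj]]].
  by case: (ltngtP i j) => // lt'; [apply: th|apply/esym/th].
by have := h i j ij jM Pi Pj; nlia.
Qed.

(** * A longest cycle leaves no component with two vertices *)

Section Nontrivial.
Variables (T : finType) (G : sgraph T).
Implicit Types (x y z : T) (p q : seq T) (A B S H K : {set T}).
Variable n : nat.
Hypothesis n13 : 13 <= n.
Hypothesis Tn : #|T| = n.
Hypothesis k2 : k_connected 2 G.
Hypothesis sig : forall u w, u != w -> ~~ G u w -> 2 * n <= 3 * (deg G u + deg G w) + 3.
Hypothesis nj : ~ has_spanning_jellyfish G.

(** Two disjoint edges between [H] and the cycle. If an edge at [h1] and one avoiding [h1] end in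
    the same cycle vertex, a third edge avoiding that vertex is disjoint from one of them. *)
Lemma two_reps v N H : lcyc G v N -> hcomp G v N H -> 1 < #|H| ->
  exists k d h h', [/\ 0 < d < N, h != h', h \in H /\ h' \in H, G h (v k) & G h' (v (k + d))].
Proof.
move=> c hc s2; have N2 := lc2 c.
have vH k : v k \notin H by apply/negP => /(hc_out hc); rewrite (mem_cset c).
have mk k l h h' : h \in H -> h' \in H -> h != h' -> G h (v k) -> G h' (v l) -> v k != v l ->
    exists k d h h', [/\ 0 < d < N, h != h', h \in H /\ h' \in H, G h (v k) & G h' (v (k + d))].
  move=> hH hH' hh g g' kl.
  have Ak : att G H (v k) by apply/attP; exists h.
  have Al : att G H (v l) by apply/attP; exists h'.
  have [d dd e] := att_ne c Ak Al kl.
  by exists k, d, h, h'; have := e 0; rewrite !addn0 => <-.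
have nk k : v k.+1 != v k.
  by apply/eqP => e; have := lcG c k; rewrite e adjxx.
have Hv x k : x \in H -> x != v k by move=> xH; apply: contraTneq xH => ->.
have [a [b [aH bH ab]]] := card_gt1P s2.
have [h1 [z1 [h1H _ z1H _ g1]]] := cut_edge k2 aH (Hv a 0 aH) (vH 1) (nk 0).
have /csetP[k _ ek] := hc_closed hc h1H g1 z1H; rewrite {}ek in g1.
have [x xH xh] : exists2 x, x \in H & x != h1.
  by case: (altP (b =P h1)) => [e|]; [exists a => //; rewrite -e|exists b].
have vh j : v j != h1 by rewrite eq_sym Hv.
have [h2 [z2 [h2H h21 z2H _ g2]]] := cut_edge k2 xH xh (vH 0) (vh 0).
have /csetP[l _ el] := hc_closed hc h2H g2 z2H; rewrite {}el in g2.
case: (altP (v k =P v l)) => [e|ne]; last by apply: (mk _ _ _ _ h1H h2H _ g1 g2 ne); rewrite eq_sym.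
rewrite -e in g2.
have [h3 [z3 [h3H _ z3H z3k g3]]] := cut_edge k2 h1H (Hv _ k h1H) (vH k.+1) (nk k).
have /csetP[j _ ej] := hc_closed hc h3H g3 z3H; rewrite {}ej in g3 z3k.
rewrite eq_sym in z3k.
case: (altP (h3 =P h1)) => [e3|ne3]; last by apply: (mk _ _ _ _ h1H h3H _ g1 g3 z3k); rewrite eq_sym.
by rewrite e3 in g3; apply: (mk _ _ _ _ h2H h1H h21 g2 g3 z3k).
Qed.

Lemma natt_ge2 v N H k d : lcyc G v N -> 0 < d < N -> att G H (v k) -> att G H (v (k + d)) ->
  1 < natt G v N H.
Proof.
move=> c /andP[d0 dN] h1 h2; rewrite -(natt_shift H c k).
have N2 := lc2 c.
have -> : 2 = \sum_(j < N) ((j == 0 :> nat) + (j == d :> nat)).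
  have N0 : 0 < N by nlia.
  rewrite big_split /= (bigD1 (Ordinal N0)) //= big1; last by move=> j; rewrite -val_eqE /= => /negPf->.
  by rewrite (bigD1 (Ordinal dN)) //= eqxx big1 // => j; rewrite -val_eqE /= => /negPf->.
apply: leq_sum => j _; case: eqP => [->|_].
  by rewrite add0n h1; case: eqP d0 => // <-.
by case: eqP => [->|] //; rewrite [d + k]addnC h2.
Qed.

(** * Degrees in a component with at least two vertices *)

Section Fixed.
Variables (v : nat -> T) (N : nat) (H : {set T}).
Hypothesis c : lcyc G v N.
Hypothesis hc : hcomp G v N H.
Hypothesis s2 : 1 < #|H|.
Let t := natt G v N H.

Definition far u := forall h, h \in H -> u != h /\ ~~ G u h.

Lemma att_succ_far k : att G H (v k) -> far (v k.+1).
Proof.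
move=> Ak h hH; split; last by rewrite adjC; apply: (att_succ_H c hc Ak).
by apply: contraTneq hH => <-; apply/negP => /(hc_out hc); rewrite (mem_cset c).
Qed.

(** The successors of the two attachments from [two_reps], whose link has two vertices of [H], as
    [cross_save] requires. *)
Lemma far_pair : exists u w, [/\ far u, far w, u != w, ~~ G u w & deg G u + deg G w + #|H| + t <= n + 2].
Proof.
have [k [d [h [h' [dN hh [hH hH'] g g']]]]] := two_reps c hc s2.
have /andP[d0 dN'] := dN.
have [q [qp q0 /(_ hh) q1]] := conn_hpath (hc_conn hc) hH hH' g g'.
have Ak : att G H (v k) by apply/attP; exists h.
have Al : att G H (v (k + d)) by apply/attP; exists h'.
have c' := lcyc_shift k.+1 c; have hc' := hcomp_shift k.+1 c hc.
have e1 : v (N.-1 + k.+1) = v k by apply: v_pred c.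
have e2 : v (d.-1 + k.+1) = v (k + d) by congr v; nlia.
exists (v k.+1), (v (k + d).+1); split; [exact: att_succ_far|exact: att_succ_far| | |].
- apply/eqP => /(lcI c)/eqP; rewrite -addSn -[X in X == _ %[mod _]]addn0 eqn_modDl mod0n modn_small //.
  by rewrite eq_sym => /eqP e; rewrite e in d0.
- have := cross_nonadj c' hc' d0 dN' (_ : att G H (v (N.-1 + k.+1))) (_ : att G H (v (d.-1 + k.+1))).
  rewrite e1 e2 => /(_ Ak Al).
  by rewrite add0n [d + k.+1]addnS [d + k]addnC.
have Ak' : att G H (v (N.-1 + k.+1)) by rewrite e1.
have Al' : att G H (v (d.-1 + k.+1)) by rewrite e2.
have qp' : hpath G H (v (N.-1 + k.+1)) q (v (d.-1 + k.+1)) by rewrite e1 e2.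
have le1 := cross_deg c' hc' d0 dN' Ak' Al' q0 Tn.
have le2 := cross_save c' hc' d0 dN' qp' Ak' Al' q0 q1.
have e3 : natt G (fun k0 => v (k0 + k.+1)) N H = t by apply: (natt_shift H c k.+1).
rewrite e3 in le2.
rewrite add0n in le1; have e4 : d + k.+1 = (k + d).+1 by nlia.
rewrite e4 in le1; move: le1 le2; clear.
move: (\sum_(_ < _) _) (deg G _) (deg G _) t #|H| => a b d' e f; nlia.
Qed.

Lemma deg_lb1 h : h \in H -> n + 3 * #|H| + 3 * t <= 6 * deg G h + 12.
Proof.
move=> hH; have [u [w [fu fw _ _ le]]] := far_pair.
have [u1 u2] := fu h hH; have [w1 w2] := fw h hH.
have := sig u1 u2; have := sig w1 w2; move: le; clear.
move: (deg G u) (deg G w) (deg G h) t #|H| => a b d' e f; nlia.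
Qed.

(** The nonadjacent far pair itself obeys the degree condition, so 3(|H| + t) <= n + 9. Eliminating
    n from [deg_lb1] leaves a deficit of 7/2, rounded down to 3. *)
Lemma deg_lb2 h : h \in H -> #|H| + t <= deg G h + 3.
Proof.
move=> hH; have [u [w [fu fw uw nuw le]]] := far_pair.
have [u1 u2] := fu h hH; have [w1 w2] := fw h hH.
have := sig u1 u2; have := sig w1 w2; have := sig uw nuw; move: le; clear.
move: (deg G u) (deg G w) (deg G h) t #|H| => a b d' e f; nlia.
Qed.

Lemma deg_ub h : h \in H -> deg G h < #|H| + t.
Proof. exact: deg_H_ub. Qed.

Lemma t_ge2 : 1 < t.
Proof.
have [k [d [h [h' [dN hh [hH hH'] g g']]]]] := two_reps c hc s2.
apply: (natt_ge2 (k := k) c dN); apply/attP; [by exists h|by exists h'].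
Qed.

End Fixed.

(** * Lowering the number of missing neighbours from two to one *)

Section Fixed.
Variables (v : nat -> T) (N : nat) (H : {set T}).
Hypothesis c : lcyc G v N.
Hypothesis hc : hcomp G v N H.
Local Notation A k := (att G H (v k)).
Local Notation t := (natt G v N H).

(** By [missed_outside], each attachment contributes at least one to the sum. *)
Lemma miss_total : t <= \sum_(x in ~: cset v N) miss G v N H x.
Proof.
rewrite /miss exchange_big /=; apply: leq_sum => k _; case Ak: (A k) => //.
have [x xo ng] := missed_outside nj k c.
by rewrite (bigD1 x) ?in_setC //= adjC ng.
Qed.

Lemma card_H_out : #|H| + N + #|~: cset v N :\: H| = n.
Proof.
have HC : H \subset ~: cset v N by apply/subsetP => h /(hc_out hc); rewrite in_setC.
have := cardsC (cset v N); rewrite (card_cset c) Tn -(cardsID H (~: cset v N)) (setIidPr HC).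
by move=> <-; rewrite addnCA addnA.
Qed.

Hypothesis s2 : 1 < #|H|.

Lemma miss_deg_le2 h : h \in H -> miss G v N H h + missH G H h <= 2.
Proof.
move=> hH; have := deg_miss c hc hH; have := deg_lb2 c hc s2 hH.
move: (deg _ _) (miss _ _ _ _ _) (missH _ _ _) #|H| t; clear => *; nlia.
Qed.

Lemma link2 k l : A k -> A l -> v k != v l ->
  exists q, [/\ hpath G H (v k) q (v l), forall q', hpath G H (v k) q' (v l) -> size q' <= size q &
    [|| size q == #|H|, #|H| < 4, (2 < size q) && (#|H| <= 4) | size q < 2]].
Proof.
move=> Ak Al kl; apply: (att_link (m := 2) c hc Ak Al kl) => h hH.
by rewrite -addnA; exact: (deg_lb2 c hc s2 hH).
Qed.

Lemma two_ends k l h h' : A k -> A l -> h != h' -> h \in H -> h' \in H -> G h (v k) -> G h' (v l) ->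
  v k != v l -> exists q, [/\ hpath G H (v k) q (v l), 1 < size q &
    [|| size q == #|H|, #|H| < 4 | (2 < size q) && (#|H| <= 4)]].
Proof.
move=> Ak Al hh hH hH' g g' kl; have [q [qp qm qs]] := link2 Ak Al kl.
have [q' [qp' _ /(_ hh) q1]] := conn_hpath (hc_conn hc) hH hH' g g'.
have q1' := leq_trans q1 (qm _ qp').
by exists q; split=> //; move: qs; rewrite [size q < 2]ltnNge q1' orbF.
Qed.

(* If the attachments at [k] and [k + d] cannot be joined by a path with two
   vertices of [H], then [H] is complete, so all other gaps are long. *)
Lemma single_pair k d e h0 : 2 < #|H| -> 2 < t -> 0 < e < d -> d < N -> A k -> A (k + d) -> A (k + e) -> h0 \in H ->
  (forall h, h \in H -> G h (v k) || G h (v (k + d)) -> h = h0) ->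
  n + 6 <= 3 * (#|H| + t) -> False.
Proof.
move=> s3 t3 /andP[e0 ed] dN Ak Ad Ae h0H only nle.
have N0 := lcN0 c.
have neq i j : i < j -> j < N -> v (k + i) != v (k + j).
  move=> ij jN; rewrite -(subnKC (ltnW ij)) addnA; apply: (v_neq _ c).
  by rewrite subn_gt0 ij (leq_ltn_trans (leq_subr _ _) jN).
have Hne h : h \in H -> h != h0 -> ~~ G h (v k) /\ ~~ G h (v (k + d)).
  move=> hH hn; split; apply/negP => g; move/eqP: hn; apply; apply: only => //; rewrite g ?orbT //.
(* A vertex of [H] other than [h0] misses both given attachments, which exhausts its two possible
   missing neighbours. *)
have mis h l : h \in H -> h != h0 -> A l -> ~~ G h (v l) -> v l = v k \/ v l = v (k + d).
  move=> hH hn Al ng; have [n1 n2] := Hne _ hH hn.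
  have := miss_deg_le2 hH; rewrite /miss (sum_cset [pred x | att G H x && ~~ G h x] c).
  set S := [set _ in _ | _] => hS.
  case: (altP (v l =P v k)) => [|n3]; [by left|].
  case: (altP (v l =P v (k + d))) => [|n4]; [by right|exfalso].
  have S3 : [set v l; v k; v (k + d)] \subset S.
    by apply/subsetP => z; rewrite !in_setU !in_set1 -!orbA => /or3P[] /eqP->; rewrite in_set (mem_cset c) /= ?Al ?Ak ?Ad ?ng ?n1 ?n2.
  have := subset_leq_card S3; rewrite -setUA cardsU1 cards2 !inE negb_or n3 n4.
  by have := neq 0 d (leq_trans e0 (ltnW ed)) dN; rewrite addn0 => ->; nlia.
have cH h h' : h \in H -> h' \in H -> h != h' -> G h h'.
  wlog hn : h h' / h != h0 => [th hH hH' hh|hH hH' hh].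
    case: (altP (h =P h0)) => [e'|hn]; last exact: th.
    by rewrite adjC; apply: th; rewrite // eq_sym // -e'.
  have [n1 n2] := Hne _ hH hn.
  have := miss_deg_le2 hH; rewrite /miss (sum_cset [pred x | att G H x && ~~ G h x] c).
  set S := [set _ in _ | _].
  have S2 : [set v k; v (k + d)] \subset S.
    by apply/subsetP => z; rewrite in_setU !in_set1 => /orP[] /eqP->; rewrite in_set (mem_cset c) /= ?Ak ?Ad ?n1 ?n2.
  have := subset_leq_card S2; rewrite cards2.
  have := neq 0 d (leq_trans e0 (ltnW ed)) dN; rewrite addn0 => -> cS.
  move=> le; have : missH G H h = 0 by nlia.
  move/eqP; rewrite cards_eq0 => /eqP/setP/(_ h'); rewrite !inE hH' eq_sym hh /=.
  by move/negbT; rewrite negbK.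
have full l o : A l -> A (l + o) -> v l != v (l + o) -> ~ (v l = v k /\ v (l + o) = v (k + d)) ->
  ~ (v l = v (k + d) /\ v (l + o) = v k) -> exists2 q, hpath G H (v l) q (v (l + o)) & size q = #|H|.
  move=> Al Ao ne n1 n2.
  have main i j : A i -> A j -> v i <> v k -> v i <> v (k + d) ->
      exists h h', [/\ h != h', h \in H /\ h' \in H, G h (v i) & G h' (v j)].
    move=> Ai /attP[h' hH' g'] i1 i2.
    have [h] : exists h, h \in H :\ h0 :\ h'.
      apply/set0Pn; rewrite -card_gt0; have := cardsD1 h0 H; have := cardsD1 h' (H :\ h0).
      by rewrite h0H; case: (_ \in _) => /=; nlia.
    rewrite !in_setD1 => /and3P[hh' hh0 hH]; exists h, h'; split=> //.
    by apply/negPn/negP => ng; case: (mis h i hH hh0 Ai ng).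
  case: (altP (v l =P v k)) => [e1|/eqP e1].
    have e2 : v (l + o) <> v k by move=> e2; rewrite e1 e2 eqxx in ne.
    have e3 : v (l + o) <> v (k + d) by move=> e3; apply: n1.
    have [h [h' [hh [hH hH'] g g']]] := main _ _ Ao Al e2 e3.
    by rewrite eq_sym in hh; apply: complete_hpath hH' hH hh g' g.
  case: (altP (v l =P v (k + d))) => [e2|/eqP e2]; last first.
    by have [h [h' [hh [hH hH'] g g']]] := main _ _ Al Ao e1 e2; apply: complete_hpath hH hH' hh g g'.
  have e3 : v (l + o) <> v (k + d) by move=> e3; rewrite e2 e3 eqxx in ne.
  have e4 : v (l + o) <> v k by move=> e4; apply: n2.
  have [h [h' [hh [hH hH'] g g']]] := main _ _ Ao Al e4 e3.
  by rewrite eq_sym in hh; apply: complete_hpath hH' hH hh g' g.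
have eN := ltn_trans ed dN.
(* The third attachment keeps [v (k + d)] out of the window of length [#|H|] after [v k]. *)
have se : #|H| < e.
  have ke : v (k + e) <> v k by apply/eqP; rewrite eq_sym; have := neq 0 e e0 eN; rewrite addn0.
  have kd : v (k + e) <> v (k + d) by apply/eqP/neq.
  have ke' : v k != v (k + e) by apply/eqP => /esym.
  have [||q qp qs] := full k e Ak Ae ke'; [by case|by case|].
  by rewrite -qs; apply: (att_gap c hc e0 eN qp).
(* The attachment after [v (k + d)] may be [v k], for which no long link is available; there only
   non-consecutiveness is used. *)
pose w l := if v l == v (k + d) then 1 else #|H|.
have := gap_sum c hc (w := w) _ _ _.
have le : t * #|H|.+1 <= \sum_(l < N) A l * (w l).+1 + (#|H| - 1).
  rewrite /natt big_distrl /=.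
  apply: (@leq_trans (\sum_(l < N) (A l * (w l).+1 + (v l == v (k + d)) * (#|H| - 1)))).
    apply: leq_sum => l _; rewrite /w; case: (A l) => //; case: eqP => _; nlia.
  rewrite big_split leq_add2l -big_distrl /= -[X in _ <= X]mul1n leq_mul2r; apply/orP; right.
  by apply: (@sum_le1 (fun l => v l == v (k + d))) => i j iN jN /eqP e1 /eqP e2; apply: (v_inj c iN jN); rewrite e1.
move=> gs; have {gs} : \sum_(l < N) A l * (w l).+1 <= N.
  apply: gs => [l|l _|l o Al ow Ao]; rewrite /w ?(lcP c) //; first by case: eqP => _; nlia.
  move: ow; rewrite /w; case: eqP => [e1|/eqP ne] /andP[o0 ow].
    have o1 : o = 1 by nlia.
    by move: Ao; rewrite o1 addn1 (negPf (att_nonconsec c hc Al)).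
  have [|||q qp qs] := full l o Al Ao.
  - by apply: (v_neq l c); rewrite o0; nlia.
  - case=> e1 e2; have oN : o < N by nlia.
    have e3 := lcI c e1; have /eqP := lcI c e2.
    rewrite -modnDml e3 modnDml eqn_modDl !modn_small //; nlia.
  - by case=> e1; rewrite e1 eqxx in ne.
  by exists q; rewrite ?qs.
have := card_H_out; move: le t3 s3 nle; clear; move: (\sum_(l < N) _) #|H| t #|_ :\: _|; clear; nia.
Qed.

Lemma nattS m : \sum_(k < N) A (m + k) = t.
Proof. by rewrite -[RHS](natt_shift H c m); apply: eq_bigr => k _; rewrite addnC. Qed.

(** If two attachments are at distance two, no path through both vertices of [H] links them, so one
    of the two vertices misses both. Each misses at most two attachments, hence at most two such
    pairs exist and 3t <= N + 2. Then nothing else lies outside, and at most four missed attachments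
    face [t >= 5]. *)
Lemma pair_tight : #|H| = 2 -> 2 < t -> n + 6 <= 3 * (#|H| + t) -> False.
Proof.
move=> s2' t3 nle; have N0 := lcN0 c.
have N9 : 3 * 3 <= n by nlia.
have /cards2P[h1 [h2 [h12 eH]]] : #|H| == 2 by rewrite s2'.
have h1H : h1 \in H by rewrite eH !inE eqxx.
have h2H : h2 \in H by rewrite eH !inE eqxx orbT.
have t5 : 4 < t by nlia.
pose M h k := A k && ~~ G h (v k).
have tN : 2 * t <= N.
  have := @window_sum (fun k => A k) (fun=> 1) N 1 _ _ _ _; rewrite -big_distrl /= mulnC.
  apply=> [k|k|k|k o Ak]; rewrite ?(lcP c) //.
  case/andP=> o0 o1; have -> : o = 1 by nlia.
  by rewrite addn1 (att_nonconsec c hc Ak).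
have M1 h : h \in H -> \sum_(k < N) (M h k && M h k.+2) <= 1.
  move=> hH; have := miss_deg_le2 hH; rewrite /miss (sum_cset [pred x | att G H x && ~~ G h x] c).
  set S := [set _ in _ | _] => hS.
  have MS k : M h k -> v k \in S by move=> Mk; rewrite in_set (mem_cset c); exact: Mk.
  have cS : #|S| <= 2 by nlia.
  apply: (@sum_le1 (fun k => M h k && M h k.+2)) => i j iN jN /andP[a1 a2] /andP[b1 b2].
  apply/eqP/negPn/negP => ij.
  have nv : v i != v j by apply: contra ij => /eqP/(v_inj c iN jN)->.
  have ne2 k : v k != v k.+2 by rewrite -addn2; apply: (v_neq k c); rewrite (lc2 c).
  have sub x y z : x \in S -> y \in S -> z \in S -> x != y -> x != z -> y = z.
    move=> xS yS zS xy xz; apply/eqP/negPn/negP => yz.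
    have : [set x; y; z] \subset S by apply/subsetP => u; rewrite !in_setU !in_set1 -orbA => /or3P[] /eqP->.
    by move/subset_leq_card; rewrite -setUA cardsU1 cards2 !inE negb_or xy xz yz; nlia.
  have e1 := sub _ _ _ (MS _ a1) (MS _ b1) (MS _ a2) nv (ne2 i).
  have nv' : v j != v i by rewrite eq_sym.
  have e2 := sub _ _ _ (MS _ b1) (MS _ a1) (MS _ b2) nv' (ne2 j).
  (* The two pairs would coincide crosswise, so 4 would vanish modulo [N], but N >= 10. *)
  have /eqP := lcI c e1; rewrite -addn2 => f1.
  have /eqP := lcI c e2; rewrite -addn2 -modnDml (eqP f1) modnDml -addnA -{1}[i]addn0.
  by rewrite eqn_modDl mod0n modn_small; nlia.
have E k : A k && A k.+2 -> M h1 k && M h1 k.+2 \/ M h2 k && M h2 k.+2.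
  case/andP=> Ak Ak2.
  have ne2 : v k != v k.+2 by rewrite -addn2; apply: (v_neq k c); rewrite (lc2 c).
  have no h h' : h != h' -> h \in H -> h' \in H -> G h (v k) -> G h' (v k.+2) -> False.
    move=> hh hH hH' g g'; have [q [qp q1 _]] := two_ends Ak Ak2 hh hH hH' g g' ne2.
    rewrite -addn2 in qp; have := att_gap c hc _ _ qp; move=> th.
    by have := th isT (lc2 c); nlia.
  rewrite /M Ak Ak2 /=.
  case g1: (G h1 (v k)); case g2: (G h1 (v k.+2)); case g3: (G h2 (v k)); case g4: (G h2 (v k.+2)) => /=;
    try (by left); try (by right); exfalso;
    try (by apply: (no h1 h2)); try (by apply: (no h2 h1) => //; rewrite eq_sym);
    try (by move: (Ak) => /attP[h]; rewrite eH !inE => /orP[] /eqP->; rewrite ?g1 ?g3);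
    by move: (Ak2) => /attP[h]; rewrite eH !inE => /orP[] /eqP->; rewrite ?g2 ?g4.
have EE : \sum_(k < N) (A k && A k.+2) <= 2.
  apply: leq_trans (leq_add (M1 _ h1H) (M1 _ h2H)); rewrite -big_split /=.
  apply: leq_sum => k _; case Ek: (A k && A k.+2) => //.
  by case: (E k Ek) => ->; rewrite ?addn1 ?add1n.
have t3N : 3 * t <= N + 2.
  have -> : 3 * t = \sum_(k < N) (A k + A k.+1 + A k.+2).
    by rewrite !big_split /= (nattS 1) (nattS 2) -/(natt G v N H); nlia.
  apply: (@leq_trans (\sum_(k < N) (1 + (A k && A k.+2)))); last by rewrite big_split /= sum_const1 leq_add2l.
  apply: leq_sum => k _; have := @att_nonconsec _ _ _ _ _ c hc k; have := @att_nonconsec _ _ _ _ _ c hc k.+1.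
  by case: (A k); case: (A k.+1); case: (A k.+2) => // h h'; try (by have := h isT); try (by have := h' isT).
have cH := card_H_out.
have Y0 : ~: cset v N :\: H = set0.
  apply/cards0_eq; move: cH t3N nle; rewrite s2'.
  by move: #|_ :\: _| t; clear => *; nlia.
have := miss_total.
rewrite (big_setID H) /= Y0 big_set0 addn0 (setIidPr _); last first.
  by apply/subsetP => h /(hc_out hc); rewrite in_setC.
have -> : \sum_(x in H) miss G v N H x = miss G v N H h1 + miss G v N H h2.
  by rewrite {1}eH big_setU1 ?inE //= big_set1.
have := miss_deg_le2 h1H; have := miss_deg_le2 h2H; nlia.
Qed.

End Fixed.

(** Improves [deg_lb2] by one. A failure gives [n + 6 <= 3 * (#|H| + t)], which counting along the
    cycle refutes except when |H| = 3 and N = 3t; there the attachments occur exactly at every third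
    place. *)
Lemma miss_two_false v N H h : lcyc G v N -> hcomp G v N H -> 1 < #|H| -> h \in H ->
  #|H| + natt G v N H <= deg G h + 2.
Proof.
move=> c hc s2 hH; rewrite leqNgt; apply/negP => lt.
have N0 := lcN0 c.
have nle : n + 6 <= 3 * (#|H| + natt G v N H).
  have := deg_lb1 c hc s2 hH; move: lt; move: (deg _ _) #|H| (natt _ _ _ _); clear => *; nlia.
have t2 := t_ge2 c hc s2.
case: (ltnP 2 (natt G v N H)) => t3; last first.
  have [k [d [h1 [h2 [/andP[d0 dN] h12 [h1H h2H] g1 g2]]]]] := two_reps c hc s2.
  have ne : v k != v (k + d) by apply: (v_neq k c); rewrite d0.
  have A1 : att G H (v k) by apply/attP; exists h1.
  have A2 : att G H (v (k + d)) by apply/attP; exists h2.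
  have [q [qp q1]] := two_ends c hc s2 A1 A2 h12 h1H h2H g1 g2 ne.
  case: (ltnP 4 #|H|) => [s5|]; last by nlia.
  have -> : (#|H| < 4) = false by nlia.
  rewrite andbF !orbF => /eqP sq.
  have ga := att_gap c hc d0 dN qp.
  have gb : size q < N - d.
    have := @att_gap _ _ v N H c hc (k + d) (N - d) (rev q).
    rewrite -addnA subnKC ?(ltnW dN) // (lcP c) size_rev.
    by apply; [nlia|nlia|exact: hpath_rev].
  have := card_H_out c hc; move: ga gb nle t3 s5 dN; rewrite sq.
  by move: #|H| (natt _ _ _ _) #|_ :\: _|; clear => a b e; nlia.
case: (ltnP 2 #|H|) => s3; last first.
  by apply: (pair_tight c hc s2 _ t3 nle); nlia.
case: (boolP [exists k : 'I_N, [exists l : 'I_N, [&& att G H (v k), att G H (v l), v k != v l &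
    [forall h1 in H, [forall h2 in H, G h1 (v k) ==> (G h2 (v l) ==> (h1 == h2))]]]]]).
  case/existsP=> k /existsP[l /and4P[Ak Al kl /forall_inP single]].
  have sg h1 h2 : h1 \in H -> h2 \in H -> G h1 (v k) -> G h2 (v l) -> h1 = h2.
    by move=> h1H h2H g1 g2; have /forall_inP/(_ _ h2H) := single _ h1H; rewrite g1 g2 => /eqP.
  have /attP[h0 h0H g0] := Ak; have /attP[h1 h1H g1] := Al.
  have e10 := sg _ _ h0H h1H g0 g1.
  have only h2 : h2 \in H -> G h2 (v k) || G h2 (v l) -> h2 = h0.
    by move=> h2H /orP[g|g]; [rewrite e10; apply: sg|apply/esym; apply: sg].
  have [m [Am mk ml]] := third_att (H := H) (v k) (v l) c t3.
  have [d dN ed] := pos_from k l c; have [e eN ee] := pos_from k m c.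
  have ed0 := ed 0; have ee0 := ee 0; rewrite !addn0 ![_ + k]addnC in ed0 ee0.
  have d0 : 0 < d by rewrite lt0n; apply: contraNneq kl => d0; rewrite ed0 d0 addn0.
  have e0 : 0 < e by rewrite lt0n; apply: contraNneq mk => e0; rewrite ee0 e0 addn0.
  rewrite ed0 in Al ml only; rewrite ee0 in Am ml.
  case: (ltngtP e d) => [lt'|lt'|ed']; last by rewrite ed' eqxx in ml.
    by apply: (single_pair c hc s2 s3 t3 _ dN Ak Al Am h0H only nle); rewrite e0 lt'.
  have eq1 : k + d + (N - d) = k + N by nlia.
  have eq2 : k + d + (e - d) = k + e by nlia.
  have := @single_pair v N H c hc s2 (k + d) (N - d) (e - d) h0 s3 t3 _ _ Al; rewrite eq1 eq2 (lcP c).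
  apply=> //; first by apply/andP; split; nlia.
    by nlia.
  by move=> h2 h2H; rewrite orbC; apply: only.
rewrite negb_exists => /forallP nosingle.
have link k l : att G H (v k) -> att G H (v l) -> v k != v l -> exists h1 h2,
    [/\ h1 != h2, h1 \in H, h2 \in H, G h1 (v k) & G h2 (v l)].
  have := nosingle (Ordinal (ltn_pmod k N0)); rewrite negb_exists => /forallP/(_ (Ordinal (ltn_pmod l N0))).
  rewrite /= !(v_mod c) => + Ak Al kl; rewrite Ak Al kl /= => /forall_inPn[h1 h1H /forall_inPn[h2 h2H]].
  by rewrite !negb_imply => /and3P[g1 g2 h12]; exists h1, h2.
have link' w : (forall q : seq T, 1 < size q -> [|| size q == #|H|, #|H| < 4 | (2 < size q) && (#|H| <= 4)] -> w <= size q) ->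
  natt G v N H * w.+1 <= N.
  move=> hw; apply: (gap_const c hc t2) => k l Ak Al kl.
  have [h1 [h2 [h12 h1H h2H g1 g2]]] := link k l Ak Al kl.
  have [q [qp q1 qs]] := two_ends c hc s2 Ak Al h12 h1H h2H g1 g2 kl.
  by exists q; last exact: hw.
have cH := card_H_out c hc.
case: (ltnP 4 #|H|) => s5.
  have := link' #|H| _; move: t3 nle cH s5; move: {link' lt} #|H| #|_ :\: _| (natt _ _ _ _) => s y t.
  move=> t3 nle cH s5 h1; suff : t * s.+1 <= N by nia.
  by apply: h1 => q q1 /or3P[/eqP->|h4|/andP[_ h4]] //; nlia.
case: (ltnP 3 #|H|) => s4.
  have e4 : #|H| = 4 by nlia.
  have : natt G v N H * 4 <= N.
    by apply: link' => q q1; rewrite e4 => /or3P[/eqP->|//|/andP[]].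
  by move: cH nle t3; rewrite e4; move: #|_ :\: _| (natt _ _ _ _); clear => a b; nlia.
have s3' : #|H| = 3 by nlia.
have tN : natt G v N H * 3 <= N by apply: link' => q.
have eN : N = natt G v N H * 3 by move: cH nle tN; rewrite s3'; move: #|_ :\: _| (natt _ _ _ _); clear => a b; nlia.
have t4 : 3 < natt G v N H by move: cH nle n13; rewrite s3'; move: #|_ :\: _| (natt _ _ _ _); clear => a b; nlia.
have gap2 k : att G H (v k) -> ~~ att G H (v k.+2).
  move=> Ak; apply/negP => A2.
  have ne : v k != v k.+2 by rewrite -addn2; apply: (v_neq k c); rewrite (lc2 c).
  have [h1 [h2 [h12 h1H h2H g1 g2]]] := link _ _ Ak A2 ne.
  have [q [qp q1 _]] := two_ends c hc s2 Ak A2 h12 h1H h2H g1 g2 ne.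
  by move: qp; rewrite -addn2 => /(@att_gap _ _ v N H c hc k 2 q isT (lc2 c)); nlia.
(* Three consecutive vertices contain at most one attachment, and [N = 3 * t] makes it exactly
   one. *)
have A3 k : att G H (v k) -> att G H (v (k + 3)).
  move=> Ak; pose f j := att G H (v (k.+1 + j)) + att G H (v (k.+2 + j)) + att G H (v (k.+3 + j)).
  have f1 : f 0 = 1.
    apply: (@sum_tight f N) => //.
      move=> j _; have := att_nonconsec c hc (k := k.+1 + j); have := att_nonconsec c hc (k := k.+2 + j).
      have := gap2 (k.+1 + j); rewrite /f !addSn.
      case: (att G H (v (k + j).+1)); case: (att G H (v (k + j).+2)); case: (att G H (v (k + j).+3)) => // h1 h2 h3;
        try (by have := h1 isT); try (by have := h2 isT); by have := h3 isT.
    by rewrite /f !big_split /= !(nattS _ c) [RHS]eN; nlia.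
  move: f1; rewrite /f !addn0 (negPf (att_nonconsec c hc Ak)) (negPf (gap2 k Ak)) addn3.
  by case: (att _ _ _).
have no q k : hpath G H (v k) q (v (k + 3)) -> 2 < size q -> False.
  by move=> /(att_gap c hc); move=> th; have := th isT ltac:(nlia); nlia.
have p3 a h1 h2 h3 : h1 \in H -> h2 \in H -> h3 \in H -> h1 != h2 -> h1 != h3 -> h2 != h3 ->
  G h1 h2 -> G h2 h3 -> G h1 (v a) -> G h3 (v (a + 3)) -> False.
  move=> h1H h2H h3H n1 n2 n3 g1 g2 ga gb; apply: (@no [:: h1; h2; h3] a) => //; split=> /=.
  - by rewrite adjC ga g1 g2 gb.
  - by rewrite !inE negb_or n1 n2 n3.
  by move=> z; rewrite !inE => /or3P[] /eqP->.
have n3 k : v k != v (k + 3) by apply: (v_neq k c); nlia.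
(* If h1 and h3 are nonadjacent, [H] is a path h1, h2, h3. For each attachment [v k], either h1
   misses it or h3 misses [v (k + 3)]; each end misses at most one, so t <= 2. *)
case: (boolP [exists h1 in H, [exists h3 in H, (h1 != h3) && ~~ G h1 h3]]).
  case/exists_inP=> h1 h1H /exists_inP[h3 h3H /andP[n13' ng]].
  have n31 : h3 != h1 by rewrite eq_sym.
  have : #|H :\ h1 :\ h3| = 1.
    have := cardsD1 h1 H; have := cardsD1 h3 (H :\ h1); rewrite in_setD1 h1H h3H n31 s3' /=; nlia.
  move/eqP/cards1P=> [h2 e2].
  have eH z : z \in H -> [|| z == h1, z == h2 | z == h3].
    move=> zH; have /setP/(_ z) := e2; rewrite !in_setD1 in_set1 zH andbT => <-.
    by case: (z == h1) => //; case: (z == h3).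
  have : h2 \in H :\ h1 :\ h3 by rewrite e2 set11.
  rewrite !in_setD1 => /and3P[n23 n21 h2H].
  have step a b : a \in H -> b \in H -> a != b -> ~~ G a b -> exists2 y, y \in H & G a y && (y != b).
    move=> aH bH ab nab; have [[|y p] [pp lp _ sp]] := hc_conn hc aH bH.
      by move: ab; rewrite -lp /= eqxx.
    case/andP: pp => g _; exists y; first by apply: sp; rewrite !inE eqxx orbT.
    by rewrite g; apply: contraNneq nab => <-.
  have g12 : G h1 h2.
    have [y yH /andP[g yb]] := step _ _ h1H h3H n13' ng.
    by move: g yb; case/or3P: (eH y yH) => /eqP-> //; rewrite ?adjxx ?eqxx.
  have g32 : G h3 h2.
    rewrite adjC in ng; have [y yH /andP[g yb]] := step _ _ h3H h1H n31 ng.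
    by move: g yb; case/or3P: (eH y yH) => /eqP-> //; rewrite ?adjxx ?eqxx.
  have mH a b : a \in H -> b \in H -> a != b -> ~~ G a b -> miss G v N H a <= 1.
    move=> aH bH ab nab; have := miss_deg_le2 c hc s2 aH.
    have : 0 < missH G H a; last by move: (miss _ _ _ _ _) (missH _ _ _); clear => x y; nlia.
    by rewrite card_gt0; apply/set0Pn; exists b; rewrite inE bH eq_sym ab.
  have m1 := mH _ _ h1H h3H n13' ng.
  have m3 : miss G v N H h3 <= 1 by apply: (mH _ h1); rewrite // adjC.
  have : natt G v N H <= miss G v N H h1 + miss G v N H h3; last first.
    by move: m1 m3 t4; move: (miss _ _ _ _ _) (miss _ _ _ _ _) (natt _ _ _ _); clear => x y; nlia.
  rewrite /miss -[X in _ <= _ + X](sum_shift (f := fun k => (att G H (v k) && ~~ G h3 (v k) : nat)) 3); last first.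
    by move=> k; rewrite (lcP c).
  rewrite -big_split; apply: leq_sum => k _; case Ak: (att G H (v k)) => //=.
  rewrite (A3 _ Ak) /=; case g1: (G h1 (v k)) => //=; case g3: (G h3 (v (k + 3))) => //.
  by exfalso; apply: (p3 k h1 h2 h3) => //; rewrite 1?eq_sym // adjC.
rewrite negb_exists_in => /forall_inP cH'.
have cH2 h1 h3 : h1 \in H -> h3 \in H -> h1 != h3 -> G h1 h3.
  move=> h1H h3H ne; have := cH' _ h1H; rewrite negb_exists_in => /forall_inP/(_ _ h3H).
  by rewrite ne /= negbK.
have [k Ak] : exists k, att G H (v k) by have [m [Am _ _]] := third_att (H := H) (v 0) (v 0) c t3; exists m.
have [h1 [h2 [h12 h1H h2H g1 g2]]] := link _ _ Ak (A3 _ Ak) (n3 k).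
have [q qp qs] := complete_hpath cH2 h1H h2H h12 g1 g2.
by apply: (no _ _ qp); rewrite qs.
Qed.

(** * Spanning links, and outside vertices beyond H *)

Section Fixed.
Variables (v : nat -> T) (N : nat) (H : {set T}).
Hypothesis c : lcyc G v N.
Hypothesis hc : hcomp G v N H.
Hypothesis s2 : 1 < #|H|.
Local Notation A k := (att G H (v k)).
Local Notation t := (natt G v N H).
Local Notation s := #|H|.

(** For [m = 1] and |H| >= 2 every other alternative of [att_link] fails. *)
Lemma full_link k l : A k -> A l -> v k != v l -> exists2 q, hpath G H (v k) q (v l) & size q = s.
Proof.
move=> Ak Al kl.
have [h hH|q [qp qm]] := att_link (m := 1) c hc Ak Al kl.
  by rewrite -addnA; apply: (miss_two_false c hc s2).
have /attP[h hH g] := Ak; have /attP[h' hH' g'] := Al.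
have [q' [qp' q0 _]] := conn_hpath (hc_conn hc) hH hH' g g'.
have := qm _ qp'; have := hpath_size qp => le1 le2.
by case/or4P=> [/eqP e||/andP[q3 q4]|]; [exists q|nlia|nlia|nlia].
Qed.

Lemma gaps_N : t * s.+1 <= N.
Proof.
apply: (gap_const c hc (t_ge2 c hc s2)) => k l Ak Al kl.
by have [q qp qs] := full_link Ak Al kl; exists q; rewrite ?qs.
Qed.

Lemma gap_no k o : A k -> 0 < o <= s -> ~~ A (k + o).
Proof.
move=> Ak /andP[o0 os]; apply/negP => Ao.
have := t_ge2 c hc s2; have := gaps_N => h1 h2.
have oN : o < N by nia.
have ne : v k != v (k + o) by apply: (v_neq k c); rewrite o0.
have [q qp qs] := full_link Ak Ao ne.
by have := att_gap c hc o0 oN qp; nlia.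
Qed.

Section Vertex.
Variable x : T.
Hypothesis xc : x \notin cset v N.
Hypothesis xH : x \notin H.

(** Crossing a spanning link with the path through [x] gains |H| + 1 vertices and skips
    [o1 + o2]. *)
Lemma two_gaps k d o1 o2 : A k -> A (k + d) -> o1 < d -> d + o2 < N ->
  G x (v (k + o1).+1) -> G x (v (k + d + o2).+1) -> s < o1 + o2.
Proof.
move=> Ak Ad od dN g1 g2.
have [|q qp qs] := full_link Ak Ad; first by apply: (v_neq _ c); nlia.
have := att_cross c hc od dN qp (opath_vertex (v := v) (N := N) xc _ g2); rewrite adjC => /(_ g1).
by rewrite qs addn1; apply=> z; rewrite inE => /eqP->.
Qed.

Lemma near_after k l o o' : A k -> A l -> v k != v l -> 0 < o <= 2 -> 0 < o' <= 2 ->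
  G x (v (k + o)) -> G x (v (l + o')) -> False.
Proof.
move=> Ak Al kl /andP[o0 o2] /andP[p0 p2] g g'.
have [d /andP[d0 dN] e] := att_ne c Ak Al kl.
have Ad : A (k + d) by have := e 0; rewrite !addn0 => <-.
have d2 : s < d.
  by rewrite ltnNge; apply/negP => ds; have := gap_no (o := d) Ak; rewrite d0 ds Ad => /(_ isT).
have d3 : s < N - d.
  rewrite ltnNge; apply/negP => ds; have := gap_no (o := N - d) Ad.
  by rewrite ds subn_gt0 dN -addnA subnKC ?(ltnW dN) // (lcP c) Ak => /(_ isT).
have := @two_gaps k d o.-1 o'.-1 Ak Ad.
rewrite e in g'; rewrite -!addnS !prednK // => th; have := th _ _ g g'.
by move=> th'; have := th' ltac:(nlia) ltac:(nlia); nlia.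
Qed.
End Vertex.
End Fixed.

(** * Packing the neighbours of an outside vertex between the attachments *)

Section Fixed.
Variables (v : nat -> T) (N : nat) (H : {set T}).
Hypothesis c : lcyc G v N.
Hypothesis hc : hcomp G v N H.
Hypothesis s2 : 1 < #|H|.
Local Notation A k := (att G H (v k)).
Local Notation t := (natt G v N H).
Local Notation s := #|H|.
Variable x : T.
Hypothesis xc : x \notin cset v N.
Hypothesis xH : x \notin H.

Lemma near_before k l o o' : A (k + o) -> A (l + o') -> v (k + o) != v (l + o') ->
  0 < o <= 2 -> 0 < o' <= 2 -> G x (v k) -> G x (v l) -> False.
Proof.
move=> Ak Al kl oo oo' g g'.
have [k' ek] := rev_at k o c; have [l' el] := rev_at l o' c.
have ek0 := ek 0 isT; have el0 := el 0 isT; rewrite !addn0 !subn0 in ek0 el0.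
have eko := ek o (leqnn _); have elo := el o' (leqnn _); rewrite !addnK in eko elo.
have := @near_after _ N H (lcyc_rev c) (hcomp_rev c hc) s2 x _ xH k' l' o o'.
by rewrite (cset_rev c) ek0 el0 eko elo; apply.
Qed.

(* [Bf k] concerns the neighbour [v k.+2] of [x]: no attachment lies within
   distance two of it. *)
Let b k := G x (v k) && ~~ A k.
Let Bf k := b k.+2 && ~~ [|| A k, A k.+1, A k.+3 | A k.+4].

(** At most one neighbour of [x] follows an attachment within distance two and at most one precedes
    one. For different attachments this is [near_after] and [near_before]; two neighbours on the
    same side of one attachment would be consecutive. *)
Lemma few_near : \sum_(k < N) (G x (v k) && ~~ A k : nat) <= \sum_(k < N) (Bf k : nat) + 2.
Proof.
pose P k := b k.+2 && (A k || A k.+1).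
pose R k := b k.+2 && (A k.+3 || A k.+4).
have bN k : b (k + N) = b k by rewrite /b (lcP c).
have -> : \sum_(k < N) (G x (v k) && ~~ A k : nat) = \sum_(k < N) (b k.+2 : nat).
  rewrite -(sum_shift (f := fun k => (b k : nat)) (N := N) 2) => [|k]; last by rewrite bN.
  by apply: eq_bigr => k _; rewrite addn2.
apply: (@leq_trans (\sum_(k < N) (Bf k + (P k + R k)))).
  apply: leq_sum => k _; rewrite /Bf /P /R; case: (b k.+2) => //=.
  by case: (A k); case: (A k.+1); case: (A k.+3); case: (A k.+4).
rewrite !big_split /= leq_add2l.
have ins i : b i.+2 -> b i.+3 -> False.
  by move=> /andP[g _] /andP[g' _]; have := insert_no c xc g; rewrite g'.
have bS i j m : v i = v j -> b (i + m) = b (j + m) by move=> e; rewrite /b (v_shift m c e).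
have P1 : \sum_(k < N) (P k : nat) <= 1.
  apply: (@sum_le1 P) => i j iN jN Pi Pj.
  have [o [o0 Ao]] : exists o, o <= 1 /\ A (i + o).
    by case/andP: Pi => _ /orP[h|h]; [exists 0|exists 1]; rewrite ?addn0 ?addn1.
  have [o' [o0' Ao']] : exists o, o <= 1 /\ A (j + o).
    by case/andP: Pj => _ /orP[h|h]; [exists 0|exists 1]; rewrite ?addn0 ?addn1.
  have /andP[bi _] := Pi; have /andP[bj _] := Pj.
  case: (altP (v (i + o) =P v (j + o'))) => [e|ne]; last first.
    have e1 : i + o + (2 - o) = i.+2 by nlia.
    have e2 : j + o' + (2 - o') = j.+2 by nlia.
    have := near_after c hc s2 xc xH Ao Ao' ne (o := 2 - o) (o' := 2 - o').
    rewrite e1 e2; case/andP: bi => -> _; case/andP: bj => -> _ /=; move=> th.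
    by exfalso; apply: th => //; nlia.
  move: e; case: o o0 {Ao} => [|[|//]] _; case: o' o0' {Ao'} => [|[|//]] _.
  - by rewrite !addn0; apply: (v_inj c iN jN).
  - rewrite addn0 => e; have := bS _ _ 2 e; rewrite !addn2 bi !addn1 => /esym bj'.
    by have := ins _ bj bj'.
  - rewrite addn0 => e; have := bS _ _ 2 e; rewrite !addn2 bj !addn1 => bi'.
    by have := ins _ bi bi'.
  by move/(v_unshift c)/(v_inj c iN jN).
have R1 : \sum_(k < N) (R k : nat) <= 1.
  apply: (@sum_le1 R) => i j iN jN Ri Rj.
  have [o [o0 Ao]] : exists o, o <= 1 /\ A (i.+2 + o.+1).
    by case/andP: Ri => _ /orP[h|h]; [exists 0|exists 1]; rewrite ?addn1 ?addn2.
  have [o' [o0' Ao']] : exists o, o <= 1 /\ A (j.+2 + o.+1).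
    by case/andP: Rj => _ /orP[h|h]; [exists 0|exists 1]; rewrite ?addn1 ?addn2.
  have /andP[bi _] := Ri; have /andP[bj _] := Rj.
  case: (altP (v (i.+2 + o.+1) =P v (j.+2 + o'.+1))) => [e|ne]; last first.
    have := near_before Ao Ao' ne; case/andP: bi => -> _; case/andP: bj => -> _ /=; move=> th.
    by exfalso; apply: th => //; nlia.
  have {}e : v (i + o) = v (j + o').
    by apply: (v_unshift (m := 3) c); rewrite !addn3; move: e; rewrite !addnS !addSn.
  have e2 := v_shift 2 c e; rewrite !addn2 in e2.
  move: e e2; case: o o0 {Ao} => [|[|//]] _; case: o' o0' {Ao'} => [|[|//]] _; rewrite ?addn0 ?addn1 => e e2.
  - exact: (v_inj c iN jN).
  - have : b i.+2 = b j.+3 by rewrite /b e2.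
    by rewrite bi => /esym bj'; have := ins _ bj bj'.
  - have : b i.+3 = b j.+2 by rewrite /b e2.
    by rewrite bj => bi'; have := ins _ bi bi'.
  by apply: (v_inj c iN jN); apply: (v_unshift (m := 1) c); rewrite !addn1.
by move: P1 R1; move: (\sum_(k < N) (P k : nat)) (\sum_(k < N) (R k : nat)); clear; nlia.
Qed.

Lemma sumS (f : nat -> bool) m : (forall k, f (k + N) = f k) ->
  \sum_(k < N) (f (m + k) : nat) = \sum_(k < N) (f k : nat).
Proof.
move=> fN; rewrite -(sum_shift (f := fun k => (f k : nat)) (N := N) m) => [|k]; last by rewrite fN.
by apply: eq_bigr => k _; rewrite addnC.
Qed.

Let BfN k : Bf (k + N) = Bf k.
Proof. by rewrite /Bf /b -!addSn !(lcP c). Qed.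

(** Attachments are more than |H| apart, [Bf] keeps away from them, and [x] has no consecutive
    neighbours. For |H| >= 3 the window can include one more attachment. *)
Let window k : (((2 < s) && A k.+1) + A k.+2 + A k.+3 + A k.+4 + Bf k + Bf k.+1 <= 1)%N.
Proof.
have g o i : 0 < o <= s -> A i -> A (i + o) -> false.
  by move=> h Ai; rewrite (negPf (gap_no c hc s2 Ai h)).
have g1 i : A i -> A i.+1 -> false by rewrite -addn1; apply: g; rewrite (ltnW s2).
have g2 i : A i -> A i.+2 -> false by rewrite -addn2; apply: g.
have g3 i : 2 < s -> A i -> A i.+3 -> false by move=> s3; rewrite -addn3; apply: g.
have ins : Bf k -> Bf k.+1 -> false.
  by move=> /andP[/andP[h _] _] /andP[/andP[h' _] _]; have := insert_no c xc h; rewrite h'.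
have n1 : Bf k -> [&& ~~ A k.+1, ~~ A k.+2, ~~ A k.+3 & ~~ A k.+4].
  by case/andP=> /andP[_ ->]; rewrite !negb_or => /and4P[_ -> -> ->].
have n2 : Bf k.+1 -> [&& ~~ A k.+1, ~~ A k.+2, ~~ A k.+3 & ~~ A k.+4].
  by case/andP=> /andP[_ ->]; rewrite !negb_or => /and4P[-> -> -> _].
move: (g1 k.+1) (g1 k.+2) (g1 k.+3) (g2 k.+1) (g2 k.+2) (g3 k.+1) n1 n2 ins; clear.
case: (2 < s) => /=; case: (A k.+1); case: (A k.+2); case: (A k.+3); case: (A k.+4); case: (Bf k); case: (Bf k.+1) => //=;
 move=> h1 h2 h3 h4 h5 h6 h7 h8 h9; intuition.
Qed.

Lemma pack : 3 * t + (2 < s) * t + 2 * \sum_(k < N) (Bf k : nat) <= N.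
Proof.
have := sum_leD (N := N) (fun k _ => window k).
rewrite sum_const1 !big_split /= (nattS _ c 2) (nattS _ c 3) (nattS _ c 4) (sumS 1 BfN).
have -> : \sum_(k < N) ((2 < s) && A k.+1 : nat) = (2 < s) * t.
  by case: (2 < s); rewrite ?mul1n ?(nattS _ c 1) // mul0n big1.
by move: ((2 < s) * t) (\sum_(k < N) (Bf k : nat)) t; clear => a d e; lia.
Qed.

Lemma miss_bound : exists B : nat, [/\ sumd G v N x + miss G v N H x <= t + B + 2 &
  3 * t + (2 < s) * t + 2 * B <= N].
Proof.
exists (\sum_(k < N) (Bf k : nat)); split; last exact: pack.
by rewrite (sumd_miss G v N H x) -addnA leq_add2l few_near.
Qed.

End Fixed.

Lemma hcomp_meet v N H H' w x : hcomp G v N H -> hcomp G v N H' -> w \in H -> w \in H' -> x \in H' -> x \in H.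
Proof.
move=> hc hc' wH wH' xH'; have [p [pp lp _ sp]] := hc_conn hc' wH' xH'.
rewrite -lp; elim: p w wH pp sp {lp wH'} => //= y p IH w wH /andP[g pp] sp.
have yH' : y \in H' by apply: sp; rewrite !inE eqxx orbT.
apply: IH => //; last by move=> z zp; apply: sp; rewrite inE zp orbT.
by apply: contraT => yH; have := hc_closed hc wH g yH; rewrite (negPf (hc_out hc' yH')).
Qed.

Lemma nonadj_deg v N H x h : hcomp G v N H -> x \notin cset v N -> x \notin H -> h \in H ->
  2 * n <= 3 * (deg G x + deg G h) + 3.
Proof.
move=> hc xc xH hH; apply: sig; first by apply: contraNneq xH => ->.
by apply/negP => g; rewrite adjC in g; have := hc_closed hc hH g xH; rewrite (negPf xc).
Qed.

(** * The cycle and H cover all vertices *)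

Section Fixed.
Variables (v : nat -> T) (N : nat) (H : {set T}).
Hypothesis c : lcyc G v N.
Hypothesis hc : hcomp G v N H.
Hypothesis s2 : 1 < #|H|.
Local Notation A k := (att G H (v k)).
Local Notation t := (natt G v N H).
Local Notation s := #|H|.

(** The degree condition between the two components is tight: both have two vertices, attachments
    are three apart, and no vertex misses an attachment of its component. A common attachment is
    then adjacent to everything outside. *)
Lemma not_two H' : hcomp G v N H' -> 1 < #|H'| -> (forall z, z \in H -> z \notin H') -> False.
Proof.
move=> hc' s2' dis; set t' := natt G v N H'; set s' := #|H'|.
have dis' z : z \in H' -> z \notin H by move=> zH'; apply/negP => /dis; rewrite zH'.
have t2 := t_ge2 c hc s2; have t2' : 1 < t' := t_ge2 c hc' s2'.
have gN := gaps_N c hc s2.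
have gN' : t' * s'.+1 <= N := gaps_N c hc' s2'.
have cn : s + s' + N <= n.
  rewrite -Tn -(card_cset c) -(cardsU_disj dis) -cardsU_disj ?max_card // => z.
  by rewrite in_setU => /orP[/(hc_out hc)|/(hc_out hc')].
have sg h h' : h \in H -> h' \in H' -> 2 * n <= 3 * (deg G h + deg G h') + 3.
  by move=> hH hH'; apply: (nonadj_deg hc') => //; [apply: (hc_out hc)|apply: dis].
have [h0 h0H] : exists h, h \in H by apply/set0Pn; rewrite -card_gt0; exact: ltnW.
have [h1 h1H] : exists h, h \in H' by apply/set0Pn; rewrite -card_gt0; exact: ltnW.
have [es es' eN eN' en] : [/\ s = 2, s' = 2, N = 3 * t, N = 3 * t' & n = N + 4].
  have := sg _ _ h0H h1H; have := deg_ub c hc h0H; have := deg_ub c hc' h1H; rewrite -/s' -/t'.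
  move: cn gN gN' t2 t2' s2 s2'; rewrite -/s'; move: s s' t t' (deg G h0) (deg G h1).
  clear => s s' t t' d d' cn gN gN' t2 t2' s2 s2' u1 u2 sgd.
  have e1 : (t - 1) * (s - 2) + (t' - 1) * (s' - 2) <= 1.
    have f u w : 2 <= u -> 2 <= w -> u * w.+1 + 2 + w = (u - 1) * (w - 2) + 3 * u + 2 * w.
      by move=> *; nia.
    have := f t s t2 s2; have := f t' s' t2' s2'; move: gN gN' cn u1 u2 sgd.
    by move: (t * _) (t' * _) ((t - 1) * _) ((t' - 1) * _); clear => p p' r r'; lia.
  have [es|[et es]] : s = 2 \/ t = 2 /\ s = 3.
  - case: (ltngtP s 2) s2 => // [s3 _|]; [right|by left].
    by move: e1 s3 t2; clear; move: (_ * (s' - 2)) => z; nia.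
  - have [es'|[et' es']] : s' = 2 \/ t' = 2 /\ s' = 3.
      case: (ltngtP s' 2) s2' => // [s3 _|]; [right|by left].
      by move: e1 s3 t2'; clear; move: (_ * (s - 2)) => z; nia.
    + subst s s'; clear e1.
      have f1 : 2 * n <= 3 * t + 3 * t' + 9 by move: sgd u1 u2; clear; lia.
      have f2 : n = N + 4 by move: f1 gN gN' cn; clear; lia.
      have f3 : 2 * N <= 3 * t + 3 * t' + 1 by move: f1 f2; clear; lia.
      by move: f3 gN gN'; clear -f2; split=> //; lia.
    + by subst s s' t'; clear e1; exfalso; nlia.
  have es' : s' = 2 by subst s t; move: e1 s2' t2'; clear; nia.
  by subst s s' t; clear e1; exfalso; nlia.
have full h h' : h \in H -> h' \in H' -> miss G v N H h = 0 /\ miss G v N H' h' = 0.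
  move=> hH hH'; have := sg _ _ hH hH'; have := deg_miss c hc hH; have := deg_miss c hc' hH'.
  rewrite -/s' -/t' es es' en.
  move: (deg G h) (deg G h') (miss _ _ _ _ _) (miss _ _ _ _ _) (missH _ _ _) (missH _ _ _) => d d' m m' l l'.
  move: eN eN'; clear => *; nlia.
have mH h : h \in H -> miss G v N H h = 0 by move=> hH; have [] := full h h1 hH h1H.
have mH' h : h \in H' -> miss G v N H' h = 0 by move=> hH'; have [] := full h0 h h0H hH'.
(* Without a common attachment [h1] misses all of the first [t]. Then [miss_bound] has B = 0 and
   forces t <= 2, against n = 3t + 4 >= 13. *)
have [k Ak gk] : exists2 k, A k & G h1 (v k).
  have [B [b1 b2]] := miss_bound c hc s2 (hc_out hc' h1H) (dis' _ h1H).
  case: (boolP [exists k : 'I_N, A k && G h1 (v k)]) => [/existsP[k /andP[]]|]; first by exists k.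
  rewrite negb_exists => /forallP no; exfalso.
  have e : miss G v N H h1 = t.
    by apply: eq_bigr => k _; have := no k; case: (A k); case: (G _ _).
  have : sumd G v N h1 = t'.
    by rewrite -[sumd _ _ _ _]addn0 -(mH' _ h1H) (sumd_miss G v N H' h1) big1 ?addn0 // => k _;
      case g: (G h1 (v k)) => //=; rewrite (_ : att G H' (v k)) //; apply/attP; exists h1.
  by move: b1 b2; rewrite es; nlia.
have [x xo ng] := missed_outside nj k c.
have eU : H :|: H' = ~: cset v N.
  apply/eqP; rewrite eqEcard; apply/andP; split.
    by apply/subsetP => z /setUP[/(hc_out hc)|/(hc_out hc')]; rewrite in_setC.
  have := cardsC (cset v N); rewrite (card_cset c) Tn en (cardsU_disj dis) es -/s' es'.
  by move: #|~: _| => y; clear; nlia.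
have : x \in H :|: H' by rewrite eU in_setC.
move=> /setUP[xH|xH]; move: ng; rewrite adjC; first by rewrite (miss0 c (mH _ xH) Ak).
by rewrite (miss0 c (mH' _ xH)) //; apply/attP; exists h1.
Qed.

Lemma in_Y x : (x \in ~: cset v N :\: H) = (x \notin H) && (x \notin cset v N).
Proof. by rewrite in_setD in_setC. Qed.

Lemma outer_single x z : x \in ~: cset v N :\: H -> G x z -> z \in cset v N.
Proof.
rewrite in_Y => /andP[xH xc] g; apply/negPn/negP => zc.
have xO : x \in ~: cset v N by rewrite in_setC.
have hc' := comp_hcomp G xc; apply: (not_two hc').
  have zQ : z \in compo G (~: cset v N) x by apply: (comp_closed xO (comp_refl _ _ _) g); rewrite in_setC.
  apply/card_gt1P; exists x, z; split=> //; first exact: comp_refl.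
  by apply: contraTneq g => ->; rewrite adjxx.
move=> w wH; apply/negP => wQ; move/negP: xH; apply.
by apply: (hcomp_meet hc hc' wH wQ); exact: comp_refl.
Qed.

Lemma outer_bound x h : x \in ~: cset v N :\: H -> h \in H -> exists B : nat,
  [/\ deg G x + miss G v N H x <= t + B + 2, 3 * t + (2 < s) * t + 2 * B <= N &
   2 * n <= 3 * (deg G x + deg G h) + 3].
Proof.
move=> xY hH; have := xY; rewrite in_Y => /andP[xH xc].
have [B [b1 b2]] := miss_bound c hc s2 xc xH.
exists B; split=> //; last exact: (nonadj_deg hc).
rewrite (deg_sumd c) // => y yc; apply: contra yc; exact: outer_single.
Qed.

(** By [miss_total] the outside vertices together miss at least [t] attachments, which the
    arithmetic of the counts forbids if [Y] is nonempty. *)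
Lemma outer_eq0 : ~: cset v N :\: H = set0.
Proof.
apply/eqP/negPn/negP => /set0Pn[x0 x0Y].
set Y := ~: cset v N :\: H in x0Y *.
have cn : s + N + #|Y| = n := card_H_out c hc.
have y0 : 0 < #|Y| by rewrite card_gt0; apply/set0Pn; exists x0.
have t2 := t_ge2 c hc s2.
have gN := gaps_N c hc s2.
have tot : t <= \sum_(h in H) miss G v N H h + \sum_(x in Y) miss G v N H x.
  apply: leq_trans (miss_total H c) _.
  rewrite (big_setID H) /= (setIidPr _) //; by apply/subsetP => h /(hc_out hc); rewrite in_setC.
have sumY m : (forall x, x \in Y -> #|Y| * miss G v N H x <= m) -> \sum_(x in Y) miss G v N H x <= m.
  move=> h; rewrite -(leq_pmul2l y0) -{2}[#|Y|]/#|Y| big_distrr /=.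
  by rewrite -sum_nat_const; apply: leq_sum.
have ub h : h \in H -> deg G h + miss G v N H h < s + t.
  by move=> hH; have := deg_miss c hc hH; move: (deg _ _) (miss _ _ _ _ _) (missH _ _ _); clear; nlia.
case: (boolP [exists h in H, deg G h + 1 < s + t]) => [/exists_inP[h hH dh]|]; last first.
  rewrite negb_exists_in => /forall_inP full.
  have mH h : h \in H -> miss G v N H h = 0.
    by move=> hH; have := full h hH; have := ub h hH; nlia.
  have [h hH] : exists h, h \in H by apply/set0Pn; rewrite -card_gt0; exact: ltnW.
  have eH : \sum_(h in H) miss G v N H h = 0 by apply: big1.
  move: tot; rewrite eH add0n leqNgt => /negP; apply.
  apply: (@leq_ltn_trans (t - 1)); last by nlia.
  apply: sumY => x xY; have [B [b1 b2 b3]] := outer_bound xY hH.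
  have := outer_arith n13 cn y0 t2 s2 gN b1 b2 b3.
  by have := ub h hH; move: (_ * miss _ _ _ _ _) => z; nlia.
have dh2 : deg G h + 2 = s + t.
  by have := miss_two_false c hc s2 hH; nlia.
have nle : n <= 3 * (s + t).
  have := deg_lb1 c hc s2 hH; move: dh2; move: (deg _ _); clear; nlia.
have mY x : x \in Y -> s = 2 /\ #|Y| * miss G v N H x + 2 < t.
  move=> xY; have [B [b1 b2 b3]] := outer_bound xY hH.
  have [//|[et s3 eN dx]] := outer_arith1 n13 cn y0 t2 s2 gN b1 b2 b3 dh2 nle.
  exfalso; have := xY; rewrite in_Y => /andP[xH xc].
  have dxs : deg G x = sumd G v N x.
    by rewrite (deg_sumd c) // => y yc; apply: contra yc; exact: outer_single.
  have pair1 k : G x (v k) + G x (v k.+1) <= 1.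
    case g: (G x (v k)) => /=; last by case: (G _ _).
    by rewrite (negPf (insert_no c xc g)).
  (* Here the degree of [x] is at least N/2, so its neighbours alternate along the cycle and one of
     them follows every attachment within distance two, against [near_after]. *)
  have pair k : G x (v (k.+1)) + G x (v k.+2) = 1.
    pose f j := G x (v (j + k.+1)) + G x (v (j + k.+2)).
    have fle j : f j <= 1 by rewrite /f [j + k.+2]addnS; exact: pair1.
    apply: (@sum_tight f N _ _ 0 (lcN0 c)) => [j _ //|].
    have le : \sum_(j < N) f j <= N by rewrite -[X in _ <= X]sum_const1; apply: leq_sum => j _; exact: fle.
    apply/eqP; rewrite eqn_leq le /= /f big_split /= !(sumd_shift x _ c) -dxs; nlia.
  have nb k : exists2 o, 0 < o <= 2 & G x (v (k + o)).
    have := pair k; case g1: (G x (v k.+1)); first by exists 1; rewrite ?addn1.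
    by case g2: (G x (v k.+2)) => // _; exists 2; rewrite ?addn2.
  have [k [d [h1 [h2 [/andP[d0 dN] h12 [h1H h2H] g1 g2]]]]] := two_reps c hc s2.
  have [o oo go] := nb k; have [o' oo' go'] := nb (k + d).
  have Ak : A k by apply/attP; exists h1.
  have Ad : A (k + d) by apply/attP; exists h2.
  have ne : v k != v (k + d) by apply: (v_neq k c); rewrite d0.
  exact: (near_after c hc s2 xc xH Ak Ad ne oo oo' go go').
have [es mx0] := mY _ x0Y.
move: tot; rewrite leqNgt => /negP; apply.
(* The two vertices of [H] miss at most one attachment each, and those in [Y] at most t - 3
   together. *)
apply: (@leq_ltn_trans (2 + (t - 3))); last by move: mx0; clear; nlia.
apply: leq_add; last by apply: sumY => x /mY[_]; clear; nlia.
rewrite -[2 in X in _ <= X]es -sum1_card; apply: leq_sum => h' h'H.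
have := ub h' h'H; have := deg_miss c hc h'H; have := miss_two_false c hc s2 h'H.
by move: (deg _ _) (miss _ _ _ _ _) (missH _ _ _); clear; nlia.
Qed.

End Fixed.

(** * Three or more attachments *)

Section Fixed.
Variables (v : nat -> T) (N : nat) (H : {set T}).
Hypothesis c : lcyc G v N.
Hypothesis hc : hcomp G v N H.
Hypothesis s2 : 1 < #|H|.
Local Notation A k := (att G H (v k)).
Local Notation t := (natt G v N H).
Local Notation s := #|H|.

(** Crossing a spanning link with this edge would gain |H| vertices and skip only [o - 1]. *)
Lemma seg_nonadj k l o : A k -> A l -> v k != v l -> 0 < o <= s -> ~~ G (v k.+1) (v (l + o)).
Proof.
move=> Ak Al kl /andP[o0 os]; apply/negP => g.
have [d /andP[d0 dN] e] := att_ne c Ak Al kl.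
have Ad : A (k + d) by have := e 0; rewrite !addn0 => <-.
have d3 : s < N - d.
  rewrite ltnNge; apply/negP => ds; have := gap_no c hc s2 (o := N - d) Ad.
  by rewrite ds subn_gt0 dN -addnA subnKC ?(ltnW dN) // (lcP c) Ak => /(_ isT).
have kd : v k != v (k + d) by have := e 0; rewrite !addn0 => <-.
have [q qp qs] := full_link c hc s2 Ak Ad kd.
have := @att_cross _ _ v N H c hc k d 0 o.-1 q [::] d0; rewrite qs !addn0 => h.
have : s <= 0 + o.-1; last by nlia.
apply: h => //; first by nlia.
  by apply: opath_edge; rewrite -addnS prednK // -e.
Qed.

Lemma gap_end l : l < N.-1 -> A l -> A N.-1 -> l + s < N.-1.
Proof.
move=> lN Al AN; rewrite ltnNge; apply/negP => le.
have := gap_no c hc s2 (o := N.-1 - l) Al.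
by rewrite subnKC ?(ltnW lN) // AN subn_gt0 lN /=; move=> h; have := h ltac:(nlia).
Qed.

(** Neither [v 0] nor [v m] has a neighbour among the |H| vertices after another attachment. Since
    [crossF] looks at two consecutive vertices, |H| - 1 indices there carry no charge. *)
Lemma wide_save m : 0 < m -> m < N -> A N.-1 -> A m.-1 ->
  \sum_(k < N) crossF G v m k + (t - 2) * (s - 1) <= N.
Proof.
move=> m0 mN Ai Aj; have N0 := lcN0 c.
have vN : v N = v 0 by have := lcP c 0; rewrite add0n.
pose A' l := [&& A l, l != N.-1 & l != m.-1].
have gap l : l < N -> A' l -> l + s < N.
  move=> lN /and3P[Al l1 _]; have : l + s < N.-1; last by nlia.
  by apply: gap_end => //; move/eqP: l1; nlia.
have zero l o : l < N -> A' l -> 0 < o <= s -> ~~ G (v 0) (v (l + o)) /\ ~~ G (v m) (v (l + o)).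
  move=> lN /and3P[Al l1 l2] oo; split.
    have := seg_nonadj Ai Al _ oo; rewrite prednK // vN; apply.
    by apply: contraNneq l1 => /(v_inj c); move=> th; apply/eqP/esym/th; nlia.
  have := seg_nonadj Aj Al _ oo; rewrite prednK //; apply.
  by apply: contraNneq l2 => /(v_inj c); move=> th; apply/eqP/esym/th; nlia.
have q0 : exists2 q, hpath G H (v N.-1) q (v m.-1) & 0 < size q.
  have /attP[h hH g] := Ai; have /attP[h' hH' g'] := Aj.
  by have [q [qp q0 _]] := conn_hpath (hc_conn hc) hH hH' g g'; exists q.
have [q qp q1] := q0.
have tA : t <= \sum_(l < N) A' l + 2.
  have : t <= \sum_(k < N) (A' k + (k == N.-1 :> nat) + (k == m.-1 :> nat)).
    apply: leq_sum => k _; rewrite /A'; case: (A k) => //=.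
    by case: (nat_of_ord k == N.-1); case: (nat_of_ord k == m.-1).
  rewrite !big_split /=.
  have e1 : \sum_(k < N) (k == N.-1 :> nat) <= 1.
    by apply: (sum_le1 (P := fun j => j == N.-1)) => i j _ _ /eqP-> /eqP->.
  have e2 : \sum_(k < N) (k == m.-1 :> nat) <= 1.
    by apply: (sum_le1 (P := fun j => j == m.-1)) => i j _ _ /eqP-> /eqP->.
  move: e1 e2; clear; move: (\sum_(k < N) (k == N.-1 :> nat)) (\sum_(k < N) (k == m.-1 :> nat)) t (\sum_(k < N) A' k).
  by move=> a b d e; nlia.
apply: (@leq_trans (\sum_(k < N) (crossF G v m k + \sum_(l < N) (A' l && (l < k < l + s))))).
  rewrite big_split leq_add2l /= exchange_big /=.
  apply: (@leq_trans ((\sum_(l < N) A' l) * (s - 1))); first by rewrite leq_mul2r leq_subLR addnC tA orbT.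
  rewrite big_distrl /=; apply: leq_sum => l _; case Al: (A' l); last by rewrite mul0n.
  rewrite mul1n /=; apply: leq_trans (count_between l (ltnW (gap l (ltn_ord l) Al))).
  by clear; lia.
rewrite -[X in _ <= X]sum_const1; apply: leq_sum => k _.
have kN := ltn_ord k.
case: (boolP [exists l : 'I_N, A' l && (l < k < l + s)]) => [/existsP[l /andP[Al /andP[lk kl]]]|].
  have -> : crossF G v m k = 0.
    have [] := @zero l (k - l) (ltn_ord l) Al _; first by nlia.
    have [] := @zero l (k.+1 - l) (ltn_ord l) Al _; first by nlia.
    rewrite (subnKC (ltnW lk)) (subnKC (leqW (ltnW lk))) /crossF => a1 a2 a3 a4.
    by case: ifP => _; rewrite ?(negPf a1) ?(negPf a2) ?(negPf a3) ?(negPf a4).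
  rewrite add0n; apply: (@sum_le1 (fun l => A' l && (l < k < l + s))) => i j.
  wlog ij : i j / i < j => [th iN jN Pi Pj|iN jN /andP[/and3P[Ai' _ _] /andP[ik ki]] /andP[/and3P[Aj' _ _] /andP[jk kj]]].
    by case: (ltngtP i j) => // lt'; [apply: th|apply/esym/th].
  have := gap_no c hc s2 (o := j - i) Ai'.
  by rewrite subnKC ?(ltnW ij) // Aj' => th; have := th ltac:(nlia).
rewrite negb_exists => /forallP no; rewrite [X in _ + X]big1 ?addn0; last by move=> l _; rewrite (negPf (no l)).
exact: (crossF_le c hc m0 mN qp Ai Aj q1 kN).
Qed.

End Fixed.

(** Each vertex of [H] misses at most one attachment, so t <= |H|. The charge count of [wide_save]
    with N >= t(|H| + 1) reduces to (t - 2)(|H| - 2) <= 1. *)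
Lemma three_att v N H : lcyc G v N -> hcomp G v N H -> 1 < #|H| -> 2 < natt G v N H ->
  [/\ n = 15, #|H| = 3, natt G v N H = 3 & forall h, h \in H -> deg G h = 4].
Proof.
move=> c hc s2 t3; set t := natt G v N H; set s := #|H|.
have Y0 := outer_eq0 c hc s2.
have cn : s + N = n by have := card_H_out c hc; rewrite Y0 cards0 addn0.
have gN : t * s.+1 <= N := gaps_N c hc s2.
have m1 h : h \in H -> miss G v N H h + missH G H h <= 1.
  move=> hH; have := deg_miss c hc hH; have := miss_two_false c hc s2 hH.
  by move: (deg _ _) (miss _ _ _ _ _) (missH _ _ _); clear; nlia.
have tot : t <= \sum_(h in H) miss G v N H h.
  apply: leq_trans (miss_total H c) _.
  rewrite (big_setID H) /= Y0 big_set0 addn0 (setIidPr _) //.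
  by apply/subsetP => h /(hc_out hc); rewrite in_setC.
have ts : t <= s.
  by apply: leq_trans tot _; rewrite /s -sum1_card; apply: leq_sum => h /m1; nlia.
have [h hH dh] : exists2 h, h \in H & deg G h + 2 = s + t.
  case: (boolP [exists h in H, deg G h + 2 == s + t]) => [/exists_inP[h hH /eqP e]|]; first by exists h.
  rewrite negb_exists_in => /forall_inP no; exfalso.
  move: tot; rewrite big1; first by nlia.
  move=> h hH; have := no h hH; have := deg_miss c hc hH; have := miss_two_false c hc s2 hH.
  by rewrite -/s -/t; move: (deg _ _) (miss _ _ _ _ _) (missH _ _ _); clear => a b d h1 h2 /eqP; nlia.
have [k [d [h1 [h1' [dN hh [hH1 hH1'] g g']]]]] := two_reps c hc s2.
have /andP[d0 dN'] := dN.
have Ak : att G H (v k) by apply/attP; exists h1.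
have Al : att G H (v (k + d)) by apply/attP; exists h1'.
have c' := lcyc_shift k.+1 c; have hc' := hcomp_shift k.+1 c hc.
have e1 : v (N.-1 + k.+1) = v k by apply: v_pred c.
have e2 : v (d.-1 + k.+1) = v (k + d) by congr v; nlia.
have e3 : v (d + k.+1) = v (k + d).+1 by congr v; nlia.
have := wide_save c' hc' s2 d0 dN'; rewrite e1 e2 => /(_ Ak Al).
have -> : natt G (fun k0 => v (k0 + k.+1)) N H = t by apply: (natt_shift H c k.+1).
have Ak' : att G H (v (N.-1 + k.+1)) by rewrite e1.
have Al' : att G H (v (d.-1 + k.+1)) by rewrite e2.
have [q [qp q0 _]] := conn_hpath (hc_conn hc) hH1 hH1' g g'.
have qp' : hpath G H (v (N.-1 + k.+1)) q (v (d.-1 + k.+1)) by rewrite e1 e2.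
have := cross_deg c' hc' d0 dN' Ak' Al' q0 Tn; rewrite add0n e3.
have [u1 u2] := att_succ_far c hc Ak hH; have [w1 w2] := att_succ_far c hc Al hH.
have := sig u1 u2; have := sig w1 w2; rewrite -/s => a1 a2 a3 a4.
have : n + 3 * ((t - 2) * (s - 1)) <= 3 * s + 6 * t - 6.
  by move: dh a1 a2 a3 a4 cn; move: ((t - 2) * _) (\sum_(_ < _) _) (deg _ _) (deg _ _) (deg _ _); clear => *; lia.
move: s2 t3 gN cn ts; rewrite -/s -/t => s2 t3 gN cn ts le.
have [es [et en]] : s = 3 /\ (t = 3 /\ n = 15).
  have s3 : 3 <= s by exact: leq_trans ts.
  move: gN cn le; rewrite -(subnKC s3) -(subnKC t3); move: (s - 3) (t - 3); clear => b a.
  have -> : (2.+1 + a - 2) * (3 + b - 1) = a * b + 2 * a + b + 2 by nia.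
  have -> : (2.+1 + a) * (3 + b).+1 = a * b + 4 * a + 3 * b + 12 by nia.
  by move: (a * b) => ab gN cn le; have [-> ->] : a = 0 /\ b = 0; lia.
have m1H h0 : h0 \in H -> miss G v N H h0 = 1.
  move=> hH0; have := m1 h0 hH0; case m0: (miss G v N H h0) => [|m']; last by nlia.
  move=> _; exfalso; move: tot; rewrite (bigD1 h0) //= m0 add0n et leqNgt => /negP; apply.
  apply: (@leq_ltn_trans (#|H :\ h0|)); last by have := cardsD1 h0 H; rewrite hH0 -/s es; nlia.
  rewrite -sum1_card big_mkcond [X in _ <= X]big_mkcond /=; apply: leq_sum => h2 _; rewrite in_setD1 andbC.
  by case: ifP => // /andP[_ h2H]; have := m1 _ h2H; nlia.
split=> // h0 hH0; have := deg_miss c hc hH0; have := m1 h0 hH0; rewrite m1H // -/s -/t es et.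
by move: (deg _ _) (missH _ _ _); clear; nlia.
Qed.

(** * Two attachments: the two sides of the cycle *)

Section Fixed.
Variables (v : nat -> T) (N D : nat) (H : {set T}).
Hypothesis c : lcyc G v N.
Hypothesis hc : hcomp G v N H.
Hypothesis s2 : 1 < #|H|.
Hypothesis t2 : natt G v N H = 2.
Hypothesis D0 : 0 < D.
Hypothesis DN : D < N.
Local Notation A k := (att G H (v k)).
Local Notation s := #|H|.
Hypothesis A0 : A 0.
Hypothesis AD : A D.
Let K := cset v N :\ v 0 :\ v D.

Let vN : v N = v 0. Proof. by have := lcP c 0; rewrite add0n. Qed.
Let v0D : v 0 != v D. Proof. by apply: (v_neq 0 c); rewrite D0. Qed.

Let Y0 : ~: cset v N :\: H = set0. Proof. exact: (outer_eq0 c hc s2). Qed.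

Let cn : s + N = n.
Proof. by have := card_H_out c hc; rewrite Y0 cards0 addn0. Qed.

Let outH x : x \notin cset v N -> x \in H.
Proof.
move=> xc; have /setP/(_ x) := Y0; rewrite in_setD in_setC xc andbT in_set0.
by move/negbFE.
Qed.

Let full_link' k l : A k -> A l -> v k != v l -> exists2 q, hpath G H (v k) q (v l) & size q = s.
Proof. exact: (full_link c hc s2). Qed.

Let side2 : s < N - D.
Proof.
have DO : v D != v 0 by rewrite eq_sym.
have [q qp <-] := full_link' AD A0 DO; have e : D + (N - D) = N by rewrite subnKC // ltnW.
have := @att_gap _ _ v N H c hc D (N - D) q; rewrite e vN; apply=> //; first by rewrite subn_gt0.
by rewrite ltn_subrL D0 (lcN0 c).
Qed.

Let only x : x \in cset v N -> att G H x -> x = v 0 \/ x = v D.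
Proof.
move=> xC Ax; have := t2; rewrite /natt (sum_cset (att G H) c); set S := [set _ in _ | _] => cS.
case: (altP (x =P v 0)) => [|n1]; [by left|]; case: (altP (x =P v D)) => [|n2]; [by right|exfalso].
have : [set x; v 0; v D] \subset S.
  apply/subsetP => z; rewrite !in_setU !in_set1 -!orbA => /or3P[] /eqP->;
    by rewrite in_set ?xC ?(mem_cset c) ?Ax ?A0 ?AD.
by move/subset_leq_card; rewrite cS -setUA cardsU1 cards2 !inE negb_or n1 n2 v0D.
Qed.

Let inK x : (x \in K) = [&& x != v D, x != v 0 & x \in cset v N].
Proof. by rewrite !in_setD1. Qed.

Let K_nbr z w : z \in K -> G z w -> w \in cset v N.
Proof.
rewrite inK => /and3P[zD z0 zC] g; apply/negPn/negP => /outH wH.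
have [e|e] := only zC (introT (attP _ _ _) (ex_intro2 _ _ w wH (etrans (adjC _ _ _) g))).
  by rewrite e eqxx in z0.
by rewrite e eqxx in zD.
Qed.

(** Otherwise all of [H], which is everything outside, is adjacent to both attachments, against
    [miss_total]. *)
Let deg_H0 : exists2 h, h \in H & deg G h = s.
Proof.
case: (boolP [exists h in H, deg G h == s]) => [/exists_inP[h hH /eqP e]|]; first by exists h.
rewrite negb_exists_in => /forall_inP no; exfalso.
have := miss_total H c; rewrite t2 (big_setID H) /= Y0 big_set0 addn0 (setIidPr _); last first.
  by apply/subsetP => h /(hc_out hc); rewrite in_setC.
rewrite big1 // => h hH; have := no h hH; have := deg_miss c hc hH.
have := miss_two_false c hc s2 hH; rewrite t2.
by move: (deg _ _) (miss _ _ _ _ _) (missH _ _ _) #|H|; clear => a b d e h1 h2 /eqP; nlia.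
Qed.

Let n_ub : n <= 3 * s + 6.
Proof.
have [h hH dh] := deg_H0; have := deg_lb1 c hc s2 hH; rewrite dh t2.
by move: #|H|; clear; nlia.
Qed.

Let K_deg z : z \in K -> 2 * n <= 3 * (deg G z + s) + 3.
Proof.
move=> zK; have := zK; rewrite inK => /and3P[_ _ zC].
have [h hH <-] := deg_H0; apply: sig; first by apply: contraTneq zC => ->; apply: (hc_out hc).
by apply/negP => /(K_nbr zK); apply/negP/(hc_out hc).
Qed.

Let vK m : 0 < m -> m < N -> m != D -> v m \in K.
Proof.
move=> m0 mN mD; rewrite inK (mem_cset c) andbT; apply/andP; split.
  by apply: contra mD => /eqP/(v_inj c mN DN)->.
by have := v_neq 0 c (o := m); rewrite m0 eq_sym; apply.
Qed.

Lemma side_jelly : (forall m, D < m < N -> G (v 0) (v m)) -> False.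
Proof.
move=> ad; have DO : v D != v 0 by rewrite eq_sym.
have [q qp qs] := full_link' AD A0 DO.
have cy := chord_cycle c DN (hpath_opath hc qp).
have qH : q =i H.
  have [_ uq sq] := qp; have sq' : {subset q <= enum H} by move=> z /sq; rewrite mem_enum.
  have [|_ e z] := uniq_min_size uq sq'; first by rewrite -cardE qs.
  by rewrite e mem_enum.
apply: nj; apply: (jellyfish_of_cycle (cy _) (v := v 0)); first by rewrite qs; nlia.
  by rewrite mem_cat mem_rcons in_cons eqxx orbT.
move=> x; rewrite mem_cat mem_rcons in_cons qH !negb_or => /and3P[x1 x2 xH].
case: (boolP (x \in cset v N)) => [/csetP[m mN e]|/outH]; last by rewrite (negPf xH).
rewrite e; apply: ad; rewrite mN andbT ltnNge; apply/negP => mD.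
case: (posnP m) => m0; first by move: x2; rewrite e m0 eqxx.
by move/negP: x1; apply; rewrite e; apply: map_f; rewrite mem_iota; nlia.
Qed.

(** Without such an edge, a vertex of the smaller side not adjacent to [v 0] has neighbours only on
    that side and at [v D]. Its degree is then below N/2, too small because both sides are longer
    than |H|. *)
Lemma crossed : N - D <= D -> exists i j, [/\ 0 < i, i < D, D < j, j < N & G (v i) (v j)].
Proof.
move=> le.
case: (boolP [exists i : 'I_N, exists j : 'I_N, [&& 0 < i, i < D, D < j & G (v i) (v j)]]).
  by case/existsP=> i /existsP[j /and4P[h1 h2 h3 h4]]; exists i, j; rewrite h1 h2 h3 h4 ltn_ord.
rewrite negb_exists => /forallP no; exfalso; apply: side_jelly => m /andP[Dm mN].
apply/negPn/negP => n0.
have mK : v m \in K by apply: vK => //; [exact: ltn_trans Dm|rewrite gtn_eqF].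
have sub : [set z | G (v m) z] \subset [set z in seg v D (N - D)] :\ v m.
  apply/subsetP => z; rewrite inE => g; rewrite in_setD1 inE.
  have -> : z != v m by apply: contraTneq g => ->; rewrite adjxx.
  have /csetP[j jN e] := K_nbr mK g; rewrite e; apply: map_f; rewrite mem_iota subnKC ?(ltnW DN) // jN andbT.
  rewrite leqNgt; apply/negP => jD.
  case: (posnP j) => j0; first by move: n0; rewrite adjC -j0 -e g.
  have := no (Ordinal jN); rewrite negb_exists => /forallP/(_ (Ordinal mN)); rewrite /= j0 jD Dm /=.
  by rewrite adjC -e g.
have := subset_leq_card sub; rewrite -/(deg G (v m)) => le1.
have le2 : #|[set z in seg v D (N - D)]| <= N - D by rewrite cardsE -{2}(size_seg v D (N - D)) card_size.
have vm : v m \in [set z in seg v D (N - D)] by rewrite inE; apply: map_f; rewrite mem_iota; nlia.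
have := cardsD1 (v m) [set z in seg v D (N - D)]; rewrite vm => e.
have := K_deg mK; move: le le1 le2 e cn side2; clear.
move: #|H| (deg _ _) #|_| #|_ :\ _| => a b d e; nlia.
Qed.

(** The edge is crossed with a spanning link in both orientations of the cycle. The two bounds add
    up to 2|H| + 4 <= N. *)
Let cross_ineq i j : 0 < i -> i < D -> D < j -> j < N -> G (v i) (v j) ->
  s + 2 + D <= i + j /\ s + i + j + 2 <= N + D.
Proof.
move=> i0 iD Dj jN g.
split.
  have [q qp qs] := full_link' A0 AD v0D.
  have := @att_cross _ _ v N H c hc 0 D i.-1 (j - D).-1 q [::].
  rewrite !add0n qs prednK // -addnS prednK ?subn_gt0 // subnKC ?(ltnW Dj) // => h.
  have : s + 0 <= i.-1 + (j - D).-1; last by nlia.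
  by apply: h => //; [nlia|nlia|exact: opath_edge].
have [k' ek] := rev_at 0 N c.
have c' := lcyc_rev c; have hc' := hcomp_rev c hc.
have e1 : v ((k' + 0) * N.-1) = v 0 by rewrite ek // add0n subn0 vN.
have e2 : v ((k' + (N - D)) * N.-1) = v D by rewrite ek ?leq_subr // add0n subKn // ltnW.
have e3 : v ((k' + (N - j)) * N.-1) = v j by rewrite ek ?leq_subr // add0n subKn // ltnW.
have e4 : v ((k' + (N - i)) * N.-1) = v i by rewrite ek ?leq_subr // add0n subKn //; nlia.
have [q qp qs] := full_link' A0 AD v0D.
have := @att_cross _ _ _ N H c' hc' k' (N - D) (N - j).-1 (D - i).-1 q [::].
have -> : (k' + (N - j).-1).+1 = k' + (N - j) by nlia.
have -> : (k' + (N - D) + (D - i).-1).+1 = k' + (N - i) by nlia.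
rewrite addn0 in e1; rewrite /= e1 e2 e3 e4 qs => h.
have : s + 0 <= (N - j).-1 + (D - i).-1; last by nlia.
by apply: h => //; [nlia|nlia|apply: opath_edge; rewrite adjC].
Qed.

Let interval_conn x0 lo hi m0 : hi <= N -> (forall m, lo < m -> m < hi -> v m \in K) -> x0 \in K ->
  lo < m0 < hi -> v m0 \in compo G K x0 -> forall m, lo < m < hi -> v m \in compo G K x0.
Proof.
move=> hN inI x0K /andP[l0 h0] vQ.
have up d : m0 + d < hi -> v (m0 + d) \in compo G K x0.
  elim: d => [|d IH] lt; first by rewrite addn0.
  rewrite addnS in lt *; apply: (comp_closed x0K (IH (ltnW lt)) (lcG c _)).
  by apply: inI => //; apply: leq_trans l0 _; rewrite -addnS leq_addr.
have down d : lo + d < m0 -> v (m0 - d) \in compo G K x0.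
  elim: d => [|d IH] lt; first by rewrite subn0.
  have lt' : lo + d < m0 by nlia.
  apply: (comp_closed x0K (IH lt')).
    have -> : m0 - d = (m0 - d.+1).+1 by nlia.
    by rewrite adjC (lcG c).
  by apply: inI; nlia.
move=> m /andP[lm mh]; case: (leqP m0 m) => le.
  by rewrite -(subnKC le); apply: up; rewrite subnKC.
have lt : lo + (m0 - m) < m0 by nlia.
by have := down _ lt; rewrite subKn // ltnW.
Qed.

Let K_conn i j : 0 < i -> i < D -> D < j -> j < N -> G (v i) (v j) -> connected_in G K.
Proof.
move=> i0 iD Dj jN g.
have iK : v i \in K by apply: vK => //; [exact: ltn_trans DN|rewrite ltn_eqF].
have jK : v j \in K by apply: vK => //; [exact: ltn_trans Dj|rewrite gtn_eqF].
have jQ := comp_closed iK (comp_refl _ _ _) g jK.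
suff -> : K = compo G K (v i) by exact: comp_connected.
apply/eqP; rewrite eqEsubset comp_sub // andbT; apply/subsetP => z zK.
have := zK; rewrite inK => /and3P[zD z0 /csetP[m mN e]]; rewrite e in zD z0 zK *.
case: (ltngtP m D) => mD; last by rewrite mD eqxx in zD.
  have m0 : 0 < m by rewrite lt0n; apply: contraNneq z0 => ->.
  apply: (@interval_conn _ 0 D i); rewrite ?i0 ?m0 ?(ltnW DN) ?comp_refl //.
  by move=> k k0 kD; apply: vK => //; [exact: ltn_trans DN|rewrite ltn_eqF].
apply: (@interval_conn _ D N j); rewrite ?Dj ?mD //.
by move=> k k0 kD; apply: vK => //; [exact: ltn_trans k0|rewrite gtn_eqF].
Qed.

Let v0K : v 0 \notin K. Proof. by rewrite inK eqxx andbF. Qed.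
Let vDK : v D \notin K. Proof. by rewrite inK eqxx. Qed.

Let card_K : #|K| + 2 = N.
Proof.
have := cardsD1 (v 0) (cset v N); have := cardsD1 (v D) (cset v N :\ v 0).
rewrite in_setD1 !(mem_cset c) eq_sym v0D (card_cset c) -/K /= => -> ->; clear; lia.
Qed.

Let path_size q : hpath G K (v 0) q (v D) -> size q + 2 + s <= N.
Proof.
move=> [qp uq qK]; have DO : v D != v 0 by rewrite eq_sym.
have [r [rp ur rH] rs] := full_link' AD A0 DO.
have w1 : wk G (v 0) (rcons q (v D)) (v D) by rewrite /wk qp last_rcons eqxx.
have w2 : wk G (v D) (rcons r (v 0)) (v 0) by rewrite /wk rp last_rcons eqxx.
have := @ucyc_wk _ G (v 0) _ (wk_cat w1 w2).
rewrite size_cat !size_rcons rs => h.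
have -> : size q + 2 + s = (size q).+1 + s.+1 by clear; lia.
have sz : size (rcons q (v D) ++ rcons r (v 0)) = (size q).+1 + s.+1 by rewrite size_cat !size_rcons rs.
rewrite -sz; apply: (lcM c); apply: h; last by nlia.
have nH z : z \in r -> z \notin cset v N by move=> /rH/(hc_out hc).
rewrite cat_uniq !rcons_uniq uq ur !andbT; apply/and3P; split.
- by apply: contra vDK => /qK.
- apply/hasPn => z; rewrite mem_rcons in_cons => /orP[/eqP->|zr].
    rewrite mem_rcons in_cons negb_or v0D; by apply: contra v0K => /qK.
  rewrite mem_rcons in_cons negb_or; apply/andP; split.
    by apply: contraNneq (nH z zr) => ->; exact: (mem_cset c).
  by apply: contra (nH z zr) => /qK; rewrite inK => /and3P[].
by apply/negP => /nH; rewrite (mem_cset c).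
Qed.

Let F := v 0 |: (v D |: K).

Let degF z : z \in K -> degin G F z = deg G z.
Proof.
move=> zK; apply: eq_card => w; rewrite [LHS]in_set [RHS]in_set; case g: (G z w); last by rewrite andbF.
have wC := K_nbr zK g; rewrite andbT /F !in_setU !in_set1 inK wC andbT.
by case: (w == v 0); case: (w == v D).
Qed.

(** Degrees in [K] are at least half of |F|, yet by [path_size] a longest path through [K] misses at
    least |H| vertices of [K]. A component [Q] of the missed part turns out to be complete and
    joined to all its attachments, which are therefore more than |Q| apart on the path. *)
Lemma crossed_false i j : 0 < i -> i < D -> D < j -> j < N -> G (v i) (v j) -> False.
Proof.
move=> i0 iD Dj jN g.
have Kc := K_conn i0 iD Dj jN g.
have [c1 c2] := cross_ineq i0 iD Dj jN g.
(* By 2|H| + 4 <= N, six times the degree is at least 3N - 2; integrality gives N/2. *)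
have dK z : z \in K -> #|K| + 2 <= 2 * degin G F z.
  move=> zK; rewrite degF //; have := K_deg zK; rewrite card_K; move: c1 c2 cn n_ub; clear.
  by move: #|H| (deg _ _) => a b; nlia.
have s3 : 3 <= s by move: n_ub n13; clear; lia.
have [|q [qp q0 qmax]] := @longest_hpath _ G K (v 0) (v D).
  exists (seg v 1 D.-1); last by rewrite size_seg; nlia.
  have := seg_wk c 0 D; rewrite add0n -{1}(prednK D0) segSr add1n prednK // => /andP[h _].
  split=> //.
    rewrite map_inj_in_uniq ?iota_uniq //; apply: (v_inj_in c); apply/allP=> k; rewrite mem_iota; nlia.
  move=> z /mapP[k]; rewrite mem_iota => /andP[k0 kD] ->; apply: vK => //; first by nlia.
  by rewrite ltn_eqF //; nlia.
have Ls := path_size qp.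
have [_ uq qK] := qp.
have cO : #|K :\: [set x in q]| + size q = #|K|.
  rewrite cardsD (setIidPr _); last by apply/subsetP => z; rewrite inE => /qK.
  have -> : #|[set x in q]| = size q by rewrite cardsE (card_uniqP uq).
  by rewrite subnK // (hpath_size qp).
have [x0 x0O] : exists x, x \in K :\: [set x in q].
  by apply/set0Pn; rewrite -card_gt0; move: cO card_K Ls s3; clear; lia.
set O := K :\: _ in cO x0O *; pose Q := compo G O x0; pose L := size q.
pose B i := att G Q (pw (v 0) (v D) q i).
have QO : {subset Q <= O} by apply/subsetP/comp_sub.
have x0Q : x0 \in Q by exact: comp_refl.
have QK z : z \in Q -> z \in K by move/QO; rewrite inE => /andP[].
have [i1 /andP[i10 i1L] Bi1] := inner_att qp q0 Kc x0O.
(* 2-connectivity gives [Q] an attachment other than the inner one, possibly an end of the path. *)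
have [j1 j1L [Bj1 ij1]] : exists2 j, j <= L.+1 & B j /\ j != i1.
  have w1q : pw (v 0) (v D) q i1 \in q.
    by case: i1 i10 i1L {Bi1} => // i1' _ lt; rewrite /pw /= mem_nth.
  have x0q : x0 \notin q by move: x0O; rewrite !inE => /andP[].
  have n1 : x0 != pw (v 0) (v D) q i1 by apply: contraNneq x0q => ->.
  have n2 : v 0 \notin Q by apply: contra v0K => /QK.
  have n3 : v 0 != pw (v 0) (v D) q i1 by apply: contraNneq v0K => ->; apply: qK.
  have [x' [z' [xQ _ zQ zn g']]] := cut_edge k2 x0Q n1 n2 n3.
  have zC := K_nbr (QK _ xQ) g'.
  have pwz k : pw (v 0) (v D) q k = z' -> B k /\ k != i1.
    move=> e; split; first by apply/attP; exists x'; rewrite ?e.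
    by apply: contraNneq zn => <-; rewrite e.
  case: (boolP (z' \in K)) => zK.
    have zq : z' \in q.
      apply: contraNT zQ => zq; apply: (comp_closed x0O xQ g').
      by rewrite in_setD zK inE zq.
    exists (index z' q).+1; first by rewrite ltnS ltnW // index_mem.
    by apply: pwz; rewrite /pw /= nth_index.
  move: zK; rewrite inK zC andbT negb_and !negbK => /orP[/eqP e|/eqP e].
    by exists L.+1 => //; apply: pwz; rewrite /pw nth_default.
  by exists 0 => //; apply: pwz.
have [i2 [j2 [ij2 j2L B2 B2']]] : exists i2 j2, [/\ i2 < j2, j2 <= L.+1, B i2 & B j2].
  move: ij1; rewrite neq_ltn => /orP[lt|lt]; first by exists j1, i1; split=> //; exact: leqW.
  by exists i1, j1.
have Kq u : u \in q -> u \in K by exact: qK.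
(* Two degrees in [K] sum to at least |K| + 2, so the correction term of [rest_sum] cannot
   vanish. *)
have Bb : B L.+1.
  have [u uq'] := rest_sum v0K vDK v0D qp qmax x0O x0Q ij2 j2L B2 B2'.
  have := dK _ (QK _ x0Q); have := dK _ (Kq _ uq'); rewrite /B /Q /O /F.
  by case: (att _ _ _) => //; move: (degin _ _ _) (degin _ _ _); clear; nlia.
have Ba : B 0.
  have [u uq'] := rest_sum_rev v0K vDK v0D qp qmax x0O ij2 j2L B2 B2'.
  have := dK _ (QK _ x0Q); have := dK _ (Kq _ uq'); rewrite /B /Q /O /F.
  by case: (att _ _ _) => //; move: (degin _ _ _) (degin _ _ _); clear; nlia.
have w1K : pw (v 0) (v D) q 1 \in K by apply: qK; rewrite /pw /= mem_nth.
have ds := degin_succ v0K vDK v0D qp qmax x0O Ba q0.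
rewrite -/O -/Q -/F -/(B _) Bb in ds.
pose b := natq G K (v 0) (v D) q x0.
(* [degin_succ] at the end [v 0] gives |Q| + b <= N/2 + 1, so every vertex of [Q] attains the bound
   of [degin_rest]. *)
have full x : x \in Q -> (forall y, y \in Q -> y != x -> G x y) /\ (forall i, i <= L.+1 -> B i -> G x (pw (v 0) (v D) q i)).
  move=> xQ; apply: (degin_rest_eq x0O xQ).
  have := dK _ (QK _ xQ); have := dK _ w1K; move: ds; rewrite -/O -/Q -/F /=.
  by move: (degin _ _ _) (degin _ _ _) #|Q| #|K| (natq _ _ _ _ _ _); clear; nlia.
have gap i2' j2' : i2' < j2' -> j2' < L.+2 -> B i2' -> B j2' -> #|Q|.+1 <= j2' - i2'.
  move=> lt jL Bi Bj; have iL : i2' <= L.+1 by nlia.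
  have [o op <-] : exists2 o, hpath G O (pw (v 0) (v D) q i2') o (pw (v 0) (v D) q j2') & size o = #|Q|.
    have cQ y z : y \in Q -> z \in Q -> y != z -> G y z.
      by move=> yQ zQ yz; apply: (full y yQ).1 => //; rewrite eq_sym.
    case: (ltnP 1 #|Q|) => [/card_gt1P[h [h' [hQ hQ' hh]]]|Q1].
      have [o [p1 p2 p3] os] := complete_hpath cQ hQ hQ' hh ((full h hQ).2 _ iL Bi) ((full h' hQ').2 _ jL Bj).
      by exists o => //; split=> // z /p3/QO.
    have Qe : #|Q| = 1 by have := cardsD1 x0 Q; rewrite x0Q; nlia.
    exists [:: x0]; last by rewrite Qe.
    split=> //=; last by move=> z; rewrite inE => /eqP->.
    by rewrite adjC (full x0 x0Q).2 // (full x0 x0Q).2.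
  exact: max_gap lt jL op.
have sp := spread_sum gap.
have b3 : 3 <= b.
  have i1' : i1.-1 < L by nlia.
  rewrite /b /natq big_ord_recl big_ord_recr /= -/(L.+1) -/(B 0) -/(B L.+1) Ba Bb.
  have e1 : bump 0 i1.-1 = i1 by rewrite /bump leq0n add1n prednK.
  rewrite (bigD1 (Ordinal i1')) //= e1 Bi1.
  by clear; lia.
have dx0 := dK _ (QK _ x0Q); have dr := degin_rest (v 0) (v D) x0O x0Q.
have Q0 : 0 < #|Q| by rewrite card_gt0; apply/set0Pn; exists x0.
(* The numbers |Q| + 1 and b - 1 are at least 2 with sum at least N/2 + 1, so their product is at
   least N - 2. By [sp] and [Ls] it is at most N - |H|, and |H| >= 3. *)
move: sp dx0 dr b3 Q0 Ls card_K s3; rewrite -/(natq G K (v 0) (v D) q x0) -/b -/O -/Q -/F.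
clear; move: (degin _ _ _) #|Q| #|K| #|H| b; nia.
Qed.

End Fixed.

Lemma two_false v N H : lcyc G v N -> hcomp G v N H -> 1 < #|H| -> natt G v N H = 2 -> False.
Proof.
move=> c hc s2 t2.
have main v' D : lcyc G v' N -> hcomp G v' N H -> natt G v' N H = 2 -> 0 < D -> D < N ->
    att G H (v' 0) -> att G H (v' D) -> N - D <= D -> False.
  move=> c' hc' t2' D0 DN A0 AD le.
  have [i [j [i0 iD Dj jN g]]] := crossed c' hc' s2 t2' D0 DN A0 AD le.
  exact: (crossed_false c' hc' s2 t2' D0 DN A0 AD i0 iD Dj jN g).
have [k [d [h [h' [/andP[d0 dN] _ [hH hH'] g g']]]]] := two_reps c hc s2.
have Ak : att G H (v k) by apply/attP; exists h.
have Ad : att G H (v (k + d)) by apply/attP; exists h'.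
have shift m D := main _ D (lcyc_shift m c) (hcomp_shift m c hc) (etrans (natt_shift H c m) t2).
case: (leqP (N - d) d) => le.
  by apply: (shift k d d0 dN _ _ le) => /=; rewrite // addnC.
have e : N - d + (k + d) = k + N by nlia.
by apply: (shift (k + d) (N - d)); rewrite /= ?add0n ?e ?(lcP c) //; nlia.
Qed.

(** For N = 12 attachments are four apart. Replacing the three vertices of one gap by [H] gives
    another longest cycle, and two of the replaced vertices lie in one component outside it. The
    first has degree 4 and is not adjacent to [H], whose vertices also have degree 4; a sum of 8 is
    too small for n = 15. *)
Lemma nontrivial_false v N H : lcyc G v N -> hcomp G v N H -> 1 < #|H| -> False.
Proof.
move=> c hc s2; have t2 := t_ge2 c hc s2.
have main v' H' : lcyc G v' N -> hcomp G v' N H' -> 1 < #|H'| ->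
    [/\ n = 15, #|H'| = 3, natt G v' N H' = 3 & forall h, h \in H' -> deg G h = 4].
  move=> c' hc' s2'; apply: three_att => //; have := t_ge2 c' hc' s2'.
  by rewrite leq_eqVlt => /orP[/eqP e|//]; exfalso; apply: (two_false c' hc' s2').
have [n15 s3 t3 d4] := main v H c hc s2.
have Y0 := outer_eq0 c hc s2.
have N12 : N = 12 by have := card_H_out c hc; rewrite Y0 cards0 addn0; nlia.
have gap k o : att G H (v k) -> 0 < o <= 3 -> ~~ att G H (v (k + o)).
  by move=> Ak oo; apply: (gap_no c hc s2 Ak); rewrite s3.
have [k Ak] : exists k, att G H (v k).
  by have [m [Am _ _]] := third_att (H := H) (v 0) (v 0) c (ltac:(rewrite t3 //)); exists m.
have A4 : att G H (v (k + 4)).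
  pose f j := att G H (v (k + 1 + j)) + att G H (v (k + 2 + j)) + att G H (v (k + 3 + j)) + att G H (v (k + 4 + j)).
  (* Four consecutive vertices contain at most one attachment, and 4 * 3 = 12 makes it exactly
     one. *)
  have f1 : f 0 = 1.
    apply: (@sum_tight f N _ _ 0 (lcN0 c)) => [j _|].
      have g a b : a < b -> b <= a + 3 -> att G H (v (k + a + j)) -> ~~ att G H (v (k + b + j)).
        move=> ab ba Aa; have -> : k + b + j = k + a + j + (b - a) by nlia.
        by apply: gap => //; nlia.
      have := g 1 2 isT isT; have := g 1 3 isT isT; have := g 1 4 isT isT.
      have := g 2 3 isT isT; have := g 2 4 isT isT; have := g 3 4 isT isT; rewrite /f; clear.
      case: (att _ _ _); case: (att _ _ _); case: (att _ _ _); case: (att _ _ _) => //= a1 a2 a3 a4 a5 a6;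
        intuition.
    by rewrite /f !big_split /= !(nattS _ c) t3 N12.
  move: f1; rewrite /f !addn0.
  by rewrite (negPf (gap k 1 Ak isT)) (negPf (gap k 2 Ak isT)) (negPf (gap k 3 Ak isT)); case: (att _ _ _).
have ne : v k != v (k + 4) by apply: (v_neq k c); rewrite N12.
have [q qp qs] := full_link c hc s2 Ak A4 ne.
have c' := lcyc_shift (k + 4) c.
have e0 : v (8 + (k + 4)) = v k by rewrite -(lcP c k) N12; congr v; nlia.
have op : opath G (fun i => v (i + (k + 4))) N ((fun i => v (i + (k + 4))) 8) q ((fun i => v (i + (k + 4))) 0).
  by rewrite (opath_shift _ _ _ _ c) /= e0 add0n; apply: hpath_opath hc qp.
have := chord_cycle c' _ op; rewrite N12 qs s3 => /(_ isT isT) cy.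
set S := _ ++ _ in cy.
have sS : size S = N by rewrite size_cat size_seg size_rcons qs s3 N12.
have [|v' c2 cs] := lcyc_of_seq cy; first by move=> s' /(lcM c); rewrite sS.
rewrite sS in c2 cs.
have out o : 0 < o < 4 -> v (k + o) \notin cset v' N.
  move=> /andP[o0 o4]; have no j : j <= 8 -> v (k + o) = v (j + (k + 4)) -> False.
    move=> j8; have -> : j + (k + 4) = k + o + (j + 4 - o) by nlia.
    by apply/eqP/(v_neq _ c); rewrite N12; nlia.
  have [_ _ sq] := qp.
  have nq : v (k + o) \notin q by apply/negP => /sq/(hc_out hc); rewrite (mem_cset c).
  have ns : v (k + o) \notin seg (fun i => v (i + (k + 4))) 1 8.
    by apply/negP => /mapP[j]; rewrite mem_iota => /andP[_ j9] e; apply: (no j _ e); nlia.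
  rewrite cs mem_cat (negPf ns) orFb mem_rcons in_cons (negPf nq) orbF.
  by apply/eqP => e; apply: (no 0 _ e).
have x1 := out 1 isT; have x2 := out 2 isT.
have hc2 := comp_hcomp G x1.
have x1Q := comp_refl G (~: cset v' N) (v (k + 1)).
have x2Q : v (k + 2) \in compo G (~: cset v' N) (v (k + 1)).
  apply: (comp_closed _ x1Q); rewrite ?in_setC //.
  by rewrite addn1 addn2 (lcG c).
have [] := main _ _ c2 hc2.
  apply/card_gt1P; exists (v (k + 1)), (v (k + 2)); split=> //.
  by rewrite addn1 addn2; apply/eqP => e; have := lcG c k.+1; rewrite e adjxx.
move=> _ _ _ /(_ _ x1Q) d1.
have /attP[h hH _] := Ak; have [u1 u2] := att_succ_far c hc Ak hH.
rewrite addn1 in d1; by have := sig u1 u2; rewrite d1 (d4 h hH) n15.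
Qed.

End Nontrivial.

(** * Assembling the two cases *)

Import Order.TTheory GRing.Theory Num.Theory.

Lemma sigma2_nat (n : nat) (T : finType) (G : sgraph T) :
  sigma2_ge G ((2%:R * n%:R - 3%:R) / 3%:R)%R ->
  forall u w, u != w -> ~~ G u w -> 2 * n <= 3 * (deg G u + deg G w) + 3.
Proof.
move=> sig u w uw nuw; have := sig u w uw nuw.
by rewrite ler_pdivrMr ?ltr0n // lerBlDr -!natrM -natrD ler_nat [_ * 3]mulnC.
Qed.

Theorem theorem1p3 (n : nat) (T : finType) (G : sgraph T) :
  13 <= n ->
  #|T| = n ->
  k_connected 2 G ->
  sigma2_ge G ((2%:R * n%:R - 3%:R) / 3%:R)%R ->
  has_spanning_jellyfish G.
Proof.
move=> n13 Tn k2 /sigma2_nat sig; apply: NNPP => nj.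
(* An edge outside a longest cycle lies in a component with at least two vertices. *)
have Dh v N : lcyc G v N -> forall x y, x \notin cset v N -> y \notin cset v N -> ~~ G x y.
  move=> c x y xc yc; apply/negP => g.
  apply: (nontrivial_false n13 Tn k2 sig nj c (comp_hcomp G xc)).
  apply/card_gt1P; exists x, y; split; first exact: comp_refl.
    by apply: (comp_closed _ (comp_refl _ _ _) g); rewrite in_setC.
  by apply: contraTneq g => ->; rewrite adjxx.
have [v [N [c cmax]]] := max_outdeg k2.
exact: (dominating_false n13 Tn k2 sig nj Dh c cmax).
Qed.
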